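(* Let $A\in\mathbb{R}$, $A\neq 0$, let $a, x_0\in\mathbb{R}$, and let $Z$ be a real-valued Lévy process without diffusion component, with Lévy measure $\Pi$ on $\mathbb{R}$, i.e. $$Z(t)=at+\int_0^t\int_{|u|>1}u\,\nu(ds,du)+\int_0^t\int_{|u|\le 1}u\,\tilde\nu(ds,du),\quad t\ge 0.$$ Let $X$ be the solution of the linear stochastic equation $$X(t)=x_0+\int_0^tAX(s)\,ds+Z(t),\quad t\ge 0.$$ Then the following three statements are equivalent: (i) for every $t>0$, the random variable $X(t)$ possesses a distribution density from the class $C_b^\infty(\mathbb{R})$; (ii) for every $t>0$, the random variable $X(t)$ possesses a bounded distribution density; (iii) $\displaystyle\left[\varepsilon^2\ln\frac{1}{\varepsilon}\right]^{-1}\int_{\mathbb{R}}(u^2\wedge\varepsilon^2)\,\Pi(du)\to+\infty$ as $\varepsilon\to 0+$.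
   Context: A Lévy measure $\Pi$ on $\mathbb{R}$ is a Borel measure with $\Pi(\{0\})=0$ and $\int_{\mathbb{R}}(u^2\wedge 1)\,\Pi(du)<\infty$. $\nu$ is the Poisson random point measure on $[0,\infty)\times\mathbb{R}$ with intensity measure $dt\times\Pi(du)$, and $\tilde\nu(ds,du)=\nu(ds,du)-ds\,\Pi(du)$ is the compensated measure. The equation is understood pathwise (for each $\omega$ as a Volterra integral equation, with $Z$ having a.s. locally bounded trajectories) and has a unique solution with a.s. locally bounded trajectories; explicitly, $$X(t)=e^{tA}x_0+\int_0^te^{(t-s)A}a\,ds+\int_0^t\int_{|u|>1}e^{(t-s)A}u\,\nu(ds,du)+\int_0^t\int_{|u|\le1}e^{(t-s)A}u\,\tilde\nu(ds,du).$$ $C_b^\infty(\mathbb{R})$ is the class of infinitely differentiable functions that are bounded together with all their derivatives. A distribution density of a random variable is a density of its law with respect to Lebesgue measure. $x\wedge y=\min(x,y)$. *)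

(* Defs.v *)
From HB Require Import structures.
From mathcomp Require Import all_boot all_order all_algebra.
From mathcomp Require Import all_classical all_reals all_analysis.
From mathcomp Require Import measurable_realfun.

Set Implicit Arguments.
Unset Strict Implicit.
Unset Printing Implicit Defensive.

Import Order.TTheory GRing.Theory Num.Theory.
Import numFieldNormedType.Exports.

Local Open Scope classical_set_scope.
Local Open Scope ring_scope.

Definition is_levy_measure (R : realType) (Pi : {measure set R -> \bar R}) :
    Prop :=
  Pi [set 0] = 0%E /\ (\int[Pi]_u (Num.min (u ^+ 2) 1)%:E < +oo)%E.

(* Since [B i] may be [setT], this is the product rule for all subfamilies. *)
Definition mutually_independent (d d' : measure_display)
    (T : measurableType d) (E : measurableType d') (R : realType)
    (P : probability T R) (I : finType) (Y : I -> T -> E) : Prop :=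
  forall B : I -> set E, (forall i, measurable (B i)) ->
    P [set w | forall i, B i (Y i w)] = (\prod_i P (Y i @^-1` B i))%E.

(* A kernel from the probability space to [E] is a measure-valued random
   element, i.e. a random measure on [E].  The law of a count is given by
   [poisson_prob], which is the Dirac mass at 0 for rate 0 (unlike
   [poisson_pmf], which is constantly 1 there); its second argument is
   ignored by the library. *)
Record is_poisson_random_measure (d d' : measure_display)
    (T : measurableType d) (E : measurableType d') (R : realType)
    (P : probability T R) (m : set E -> \bar R) (nu : R.-ker T ~> E) : Prop := {
  prm_poisson : forall B, measurable B -> (m B < +oo)%E ->
    forall k : nat, P [set w | nu w B = k%:R%:E] =
                    poisson_prob (fine (m B)) 0 [set k] ;
  prm_infinite : forall B, measurable B -> m B = +oo%E ->
    {ae P, forall w, nu w B = +oo%E} ;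
  prm_independent : forall (n : nat) (B : 'I_n -> set E),
    (forall i, measurable (B i)) -> trivIset setT B ->
    mutually_independent P (fun (i : 'I_n) (w : T) => nu w (B i))
}.

(* The measure dt x Pi(du) on [0, +oo) x R, seen as a measure on R x R. *)
Definition jump_intensity (R : realType) (Pi : {measure set R -> \bar R}) :
    set (R * R) -> \bar R :=
  fun B => ((@lebesgue_measure R) \x Pi)%E (B `&` (`[0, +oo[ `*` setT)).

Definition cadlag (R : realType) (f : R -> R) : Prop :=
  (forall t : R, 0 <= t -> f x @[x --> t^'+] --> f t) /\
  (forall t : R, 0 < t -> cvg (f x @[x --> t^'-])).

(* The processes are indexed by R, but only the times t >= 0 matter.
   Stochastic continuity follows from the other conditions. *)
Record is_levy_process (d : measure_display) (T : measurableType d)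
    (R : realType) (P : probability T R) (Z : R -> {RV P >-> R}) : Prop := {
  levy_start : {ae P, forall w, Z 0 w = 0} ;
  levy_independent : forall (n : nat) (t : nat -> R), 0 <= t 0%N ->
    {homo t : i j / (i <= j)%N >-> i <= j} ->
    mutually_independent P (fun (i : 'I_n) w => Z (t i.+1) w - Z (t i) w) ;
  levy_stationary : forall s t : R, 0 <= s -> 0 <= t ->
    forall B : set R, measurable B ->
    P [set w | B (Z (s + t) w - Z s w)] = P [set w | B (Z t w)] ;
  levy_cadlag : {ae P, forall w, cadlag (fun t => Z t w)}
}.
Arguments is_levy_process {d T R} P Z.

(* The integral of u over [0, t] x {eps < |u| <= 1} with respect to the
   compensated measure nu(ds, du) - ds Pi(du). *)
Definition truncated_compensated_jumps (d : measure_display)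
    (T : measurableType d) (R : realType)
    (Pi : {measure set R -> \bar R}) (nu : R.-ker T ~> (R * R)%type)
    (t eps : R) (w : T) : R :=
  let D := [set u : R | eps < `|u| <= 1] in
  \int[nu w]_(x in `[0, t] `*` D) x.2 -
  \int[@lebesgue_measure R]_(s in `[0, t]) (\int[Pi]_(u in D) u).

(* [J] is (a version of) the stochastic integral of u over
   [0, t] x {|u| <= 1} with respect to the compensated measure: as
   int_{|u| <= 1} |u| Pi(du) may be infinite, it only exists as an L^2 limit. *)
Definition is_compensated_small_jumps (d : measure_display)
    (T : measurableType d) (R : realType) (P : probability T R)
    (Pi : {measure set R -> \bar R}) (nu : R.-ker T ~> (R * R)%type)
    (t : R) (J : {RV P >-> R}) : Prop :=
  'E_P[fun w => ((truncated_compensated_jumps Pi nu t eps w - J w) ^+ 2)%R]%E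
    @[eps --> 0^'+] --> 0%E.
Arguments is_compensated_small_jumps {d T R} P Pi nu t J.

Definition has_jump_representation (d : measure_display)
    (T : measurableType d) (R : realType) (P : probability T R)
    (Pi : {measure set R -> \bar R}) (nu : R.-ker T ~> (R * R)%type)
    (a : R) (Z : R -> {RV P >-> R}) : Prop :=
  forall t : R, 0 <= t -> exists J : {RV P >-> R},
    is_compensated_small_jumps P Pi nu t J /\
    {ae P, forall w,
      Z t w = a * t
              + \int[nu w]_(x in `[0, t] `*` [set u : R | 1 < `|u|]) x.2
              + J w}.
Arguments has_jump_representation {d T R} P Pi nu a Z.

Definition is_linear_sde_solution (d : measure_display)
    (T : measurableType d) (R : realType) (P : probability T R)
    (A x0 : R) (Z X : R -> {RV P >-> R}) : Prop :=
  {ae P, forall w,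
    [/\ measurable_fun (`[0, +oo[ : set R) (fun s => X s w),
        forall t : R, [bounded X s w | s in `[0, t]] &
        forall t : R, 0 <= t ->
          X t w = x0 + \int[@lebesgue_measure R]_(s in `[0, t]) (A * X s w)
                  + Z t w]}.
Arguments is_linear_sde_solution {d T R} P A x0 Z X.

Definition is_density (d : measure_display) (T : measurableType d)
    (R : realType) (P : probability T R) (Y : {RV P >-> R}) (p : R -> R) :
    Prop :=
  [/\ measurable_fun setT p, forall x, 0 <= p x &
      forall B : set R, measurable B ->
        distribution P Y B = (\int[@lebesgue_measure R]_(x in B) (p x)%:E)%E].
Arguments is_density {d T R} P Y p.

Definition Cb_infty (R : realType) (f : R -> R) : Prop :=
  forall n : nat, (forall x, derivable (derive1n n f) x 1) /\
                  [bounded derive1n n f x | x in setT].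

(* Main.v *)
Require Import Defs.
From HB Require Import structures.
From mathcomp Require Import all_boot all_order all_algebra.
From mathcomp Require Import all_classical all_reals all_analysis.
From mathcomp Require Import measurable_realfun.
From mathcomp Require Import ring lra.

Set Implicit Arguments.
Unset Strict Implicit.
Unset Printing Implicit Defensive.

Import Order.TTheory GRing.Theory Num.Theory.
Import numFieldNormedType.Exports.

Local Open Scope classical_set_scope.
Local Open Scope ring_scope.

(** With [psi z] the integral of [1 - cos (z u)] against [Pi], the squared modulus
    of the characteristic function of [Z t] at [z] is [exp (- 2 t psi z)].  As
    [exp (- A t) X t] is, up to a constant, the limit of the Riemann-Stieltjes sums
    of [exp (- A s) dZ s], the squared modulus [m z] of the characteristic function
    of [X t] is [exp (-2 int_0^t psi (z exp (A (t - s))) ds)].  Averaging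
    over [s] smooths out the oscillations of [psi] because [A != 0]: the exponent is
    comparable, uniformly in [z], to [G z], the integral of [min ((z u)^2) 1].
    Condition (iii) says that [G z / ln z] tends to infinity, so under (iii) [m]
    decreases faster than any power and Fourier inversion gives a density in
    [C_b^oo].  Conversely, a bounded density forces the integral of [m] over
    [0, L] to be bounded in [L]; if [G z <= K ln z] for arbitrarily large [z],
    then for a small [t] one has [m >= z^(-1/2)] on [0, z], and that integral is
    at least [z^(1/2)], a contradiction. *)

(** Characteristic functions are handled in real form, as pairs of means of cosine and sine. No
    stochastic integral against [Z] is built: summation by parts is a deterministic identity on each
    path, and it reduces [X t] to finitely many independent increments of [Z]. Their transform comes
    from Poisson counts on windows where jumps are bounded and bounded away from 0.

    The comparison of the exponent with [G] is made for a single jump size [u], through a function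
    of the product [z u] alone, and then integrated against [Pi]; this makes it uniform in [z].

    Both directions damp the transform by [exp (- s z)]. Fubini then turns its integral into a mean
    of the Cauchy kernel [s / (s^2 + x^2)], which has an explicit primitive and total integral [pi].
    If the density is at most [M], every such mean is at most [M pi], which bounds the integral of
    [m]; if the transform decays fast, letting [s] tend to 0 gives the inversion formula.

    A bounded density at a fixed [t] only bounds [G z / ln z] from below by a constant of order
    [1 / t]. Hence the use of all [t] in (ii), with [t] chosen after the constant [K] to be
    reached. *)

Lemma cosB_le (R : realType) (x y : R) : `|cos x - cos y| <= `|x - y|.
Proof.
wlog xy : x y / x <= y.
  by move=> H; case: (leP x y) => [/H//|/ltW/H]; rewrite distrC (distrC y).
have [|c _] := @MVT_segment R cos (fun u => - sin u) x y xy
  (fun u _ => is_derive_cos u).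
  by apply: continuous_subspaceT; exact: continuous_cos.
rewrite distrC (distrC x) => ->.
by rewrite normrM normrN ler_piMl// sin_max.
Qed.

Lemma sinB_le (R : realType) (x y : R) : `|sin x - sin y| <= `|x - y|.
Proof.
rewrite -[sin x]cosBpihalf -[sin y]cosBpihalf.
by rewrite (le_trans (cosB_le _ _))// opprD addrACA subrr addr0.
Qed.

Lemma onemcos_le (R : realType) (x : R) : 1 - cos x <= x ^+ 2 / 2.
Proof.
wlog x0 : x / 0 <= x.
  move=> H; case: (leP 0 x) => [/H//|/ltW x0].
  by rewrite -cosN -sqrrN; apply: H; rewrite oppr_ge0.
pose f (y : R) := y ^+ 2 / 2 + cos y.
have df (y : R) : is_derive y 1 f (y - sin y).
  rewrite /f; apply: trigger_derive; rewrite /GRing.scale/=.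
  by field.
suff : f 0 <= f x by rewrite /f cos0 expr0n/= mul0r add0r lterBDr addrC.
have [|c] := @MVT_segment R f (fun y => y - sin y) 0 x x0 (fun y _ => df y).
  by apply: derivable_within_continuous => y _; have [] := df y.
rewrite in_itv/= => /andP[c0 _] fc.
rewrite -subr_ge0 fc mulr_ge0// ?subr0// subr_ge0.
have := sinB_le c 0; rewrite sin0 !subr0 (ger0_norm c0).
exact/le_trans/ler_norm.
Qed.

(** * Squared modulus of a characteristic function *)

Section sqmod.
Context d (T : measurableType d) (R : realType) (P : probability T R).
Implicit Types f g Y : T -> R.

Lemma bounded_integrable (M : R) f : measurable_fun setT f ->
  (forall x, `|f x| <= M) -> P.-integrable setT (EFin \o f).
Proof.
move=> mf fM; apply: measurable_bounded_integrable => //.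
  exact: (le_lt_trans (probability_le1 P measurableT) (ltry 1)).
exists M; split; first exact: num_real.
by move=> N MN x _; exact: le_trans (fM x) (ltW MN).
Qed.

Lemma measurable_cosT Y : measurable_fun setT Y ->
  measurable_fun setT (fun w => cos (Y w)).
Proof.
move=> mY; apply: measurableT_comp => //; apply: continuous_measurable_fun.
exact: continuous_cos.
Qed.

Lemma measurable_sinT Y : measurable_fun setT Y ->
  measurable_fun setT (fun w => sin (Y w)).
Proof.
move=> mY; apply: measurableT_comp => //; apply: continuous_measurable_fun.
exact: continuous_sin.
Qed.

Lemma integrable_cos Y : measurable_fun setT Y ->
  P.-integrable setT (fun w => (cos (Y w))%:E).
Proof.
move=> mY; apply: (@bounded_integrable 1); first exact: measurable_cosT.
by move=> x; exact: cos_max.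
Qed.

Lemma integrable_sin Y : measurable_fun setT Y ->
  P.-integrable setT (fun w => (sin (Y w))%:E).
Proof.
move=> mY; apply: (@bounded_integrable 1); first exact: measurable_sinT.
by move=> x; exact: sin_max.
Qed.

Lemma Rexp_cst (c : R) : \int[P]_w c = c.
Proof.
rewrite Rintegral_cst//; have -> : (P : {measure set T -> \bar R}) setT = 1%E.
  exact: probability_setT.
by rewrite mulr1.
Qed.

Lemma le_norm_Rexp (M : R) f : measurable_fun setT f ->
  (forall x, `|f x| <= M) -> `|\int[P]_w f w| <= M.
Proof.
move=> mf fM; rewrite (le_trans (le_normr_Rintegral _ _))//.
  exact: (bounded_integrable mf fM).
rewrite -[leRHS]Rexp_cst; apply: le_Rintegral => //.
- apply: (@bounded_integrable M); first exact: measurableT_comp.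
  by move=> x; rewrite normr_id.
- by apply: (@bounded_integrable `|M|).
Qed.

(* This is |E exp (i Y)|^2; squared moduli suffice for the whole argument, which
   removes the drift and the compensator from all computations. *)
Definition sqmod Y : R := (\int[P]_w cos (Y w)) ^+ 2 + (\int[P]_w sin (Y w)) ^+ 2.

Lemma sqmod_ge0 Y : 0 <= sqmod Y.
Proof. by rewrite addr_ge0// sqr_ge0. Qed.

Lemma norm_cosE_le1 Y : measurable_fun setT Y -> `|\int[P]_w cos (Y w)| <= 1.
Proof.
move=> mY; apply: le_norm_Rexp; first exact: measurable_cosT.
by move=> x; exact: cos_max.
Qed.

Lemma norm_sinE_le1 Y : measurable_fun setT Y -> `|\int[P]_w sin (Y w)| <= 1.
Proof.
move=> mY; apply: le_norm_Rexp; first exact: measurable_sinT.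
by move=> x; exact: sin_max.
Qed.

Lemma sqmod_shift (c : R) Y : measurable_fun setT Y ->
  sqmod (fun w => c + Y w) = sqmod Y.
Proof.
move=> mY; rewrite /sqmod.
have ic := integrable_cos mY; have iS := integrable_sin mY.
have iZ k f : P.-integrable setT (EFin \o f) ->
    P.-integrable setT (EFin \o (fun w => k * f w)).
  by move=> fi; apply: eq_integrable (integrableZl measurableT k fi).
have -> : \int[P]_w cos (c + Y w) =
    cos c * \int[P]_w cos (Y w) - sin c * \int[P]_w sin (Y w).
  rewrite -RintegralZl// -RintegralZl// -RintegralB//; try exact: iZ.
  by apply: eq_Rintegral => w _; rewrite cosD.
have -> : \int[P]_w sin (c + Y w) =
    sin c * \int[P]_w cos (Y w) + cos c * \int[P]_w sin (Y w).
  rewrite -RintegralZl// -RintegralZl// -RintegralD//; try exact: iZ.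
  by apply: eq_Rintegral => w _; rewrite sinD.
move: (\int[P]_w cos (Y w)) (\int[P]_w sin (Y w)) => C S.
have := cos2Dsin2 c; move: (cos c) (sin c) => a b ab.
rewrite -[RHS]mul1r -ab; ring.
Qed.

Lemma ae_eq_Rintegral f g : measurable_fun setT f -> measurable_fun setT g ->
  {ae P, forall w, f w = g w} -> \int[P]_w f w = \int[P]_w g w.
Proof.
move=> mf mg fg; rewrite /Rintegral; congr fine.
apply: ae_eq_integral => //; try exact/measurable_EFinP.
by move: fg; apply: filterS => w /= ->.
Qed.

Lemma ae_eq_sqmod Y Y' : measurable_fun setT Y -> measurable_fun setT Y' ->
  {ae P, forall w, Y w = Y' w} -> sqmod Y = sqmod Y'.
Proof.
move=> mY mY' YY'; rewrite /sqmod; congr (_ ^+ 2 + _ ^+ 2).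
  apply: ae_eq_Rintegral; [exact: measurable_cosT|exact: measurable_cosT|].
  by move: YY'; apply: filterS => w ->.
apply: ae_eq_Rintegral; [exact: measurable_sinT|exact: measurable_sinT|].
by move: YY'; apply: filterS => w ->.
Qed.

Lemma bounded_cvg_Rintegral (M : R) (f_ : nat -> T -> R) f :
  (forall n, measurable_fun setT (f_ n)) -> measurable_fun setT f ->
  (forall n x, `|f_ n x| <= M) -> {ae P, forall w, f_ n w @[n --> \oo] --> f w} ->
  \int[P]_w f_ n w @[n --> \oo] --> \int[P]_w f w.
Proof.
move=> mf_ mf fM ff.
have [||||| fint _ H] := @dominated_convergence _ _ _ P _ measurableT
  (fun n w => (f_ n w)%:E) (EFin \o f) (cst M%:E).
- by move=> n; exact/measurable_EFinP.
- exact/measurable_EFinP.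
- by move: ff; apply: filterS => w fw _; apply/fine_cvgP; split => //; exact: nearW.
- by apply: (@bounded_integrable `|M| (cst M)) => //.
- by apply: aeW => w n _ /=; rewrite lee_fin.
apply: fine_cvg; rewrite fineK//.
exact: integrable_fin_num.
Qed.

Lemma cvg_sqmod (Y_ : nat -> T -> R) Y :
  (forall n, measurable_fun setT (Y_ n)) -> measurable_fun setT Y ->
  {ae P, forall w, Y_ n w @[n --> \oo] --> Y w} ->
  sqmod (Y_ n) @[n --> \oo] --> sqmod Y.
Proof.
move=> mY_ mY YY.
have C : \int[P]_w cos (Y_ n w) @[n --> \oo] --> \int[P]_w cos (Y w).
  apply: (@bounded_cvg_Rintegral 1).
  - by move=> n; exact: measurable_cosT.
  - exact: measurable_cosT.
  - by move=> n x; exact: cos_max.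
  - move: YY; apply: filterS => w Yw.
    exact: (cvg_comp _ _ Yw (@continuous_cos R (Y w))).
have S : \int[P]_w sin (Y_ n w) @[n --> \oo] --> \int[P]_w sin (Y w).
  apply: (@bounded_cvg_Rintegral 1).
  - by move=> n; exact: measurable_sinT.
  - exact: measurable_sinT.
  - by move=> n x; exact: sin_max.
  - move: YY; apply: filterS => w Yw.
    exact: (cvg_comp _ _ Yw (@continuous_sin R (Y w))).
rewrite /sqmod expr2 expr2.
under eq_cvg do rewrite expr2 expr2.
by apply: cvgD; apply: cvgM.
Qed.

End sqmod.

(** * Step functions on grids and dominated convergence *)

Section step_functions.
Context (R : realType).
Implicit Types (t v : nat -> R) (y : R).

(** The values [v] are kept apart from the nodes [t]: [v = t] approximates the identity, and other
    choices sample a function at the left or at the right ends of the cells. *)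
Definition stepf t v n y : R := \sum_(i < n) v i * \1_(`[t i, t i.+1[) y.

Lemma grid_cell t n y : t 0%N <= y -> y < t n ->
  exists2 i, (i < n)%N & t i <= y < t i.+1.
Proof.
elim: n => [|n IHn] ty yt; first by move: (le_lt_trans ty yt); rewrite ltxx.
have [ytn|tny] := ltP y (t n).
  by have [i iltn ?] := IHn ty ytn; exists i => //; exact: ltnW.
by exists n => //; rewrite tny.
Qed.

Lemma grid_cell_uniq t y i j : {homo t : i j / (i <= j)%N >-> i <= j} ->
  t i <= y < t i.+1 -> t j <= y < t j.+1 -> i = j.
Proof.
move=> tmono /andP[ty yt] /andP[ty' yt']; apply/eqP; rewrite eqn_leq.
apply/andP; split; rewrite leqNgt; apply/negP => ij.
  by move: (lt_le_trans yt' (tmono _ _ ij)); rewrite ltNge ty.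
by move: (lt_le_trans yt (tmono _ _ ij)); rewrite ltNge ty'.
Qed.

Lemma stepfE t v n y i : {homo t : i j / (i <= j)%N >-> i <= j} ->
  (i < n)%N -> t i <= y < t i.+1 -> stepf t v n y = v i.
Proof.
move=> tmono iltn ity; rewrite /stepf (bigD1 (Ordinal iltn))//= big1 ?addr0.
  by rewrite indicE mem_set ?mulr1//= in_itv.
move=> j /eqP ji; rewrite indicE memNset ?mulr0//= in_itv/= => jty.
by apply: ji; apply/val_inj => /=; exact: grid_cell_uniq jty ity.
Qed.

Definition grid (a b : R) n i : R := a + (b - a) * i%:R / n%:R.

Lemma grid_mono a b n : a <= b -> {homo grid a b n : i j / (i <= j)%N >-> i <= j}.
Proof.
move=> ab i j ij; rewrite /grid lerD2l ler_wpM2r ?invr_ge0//.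
by rewrite ler_wpM2l ?subr_ge0// ler_nat.
Qed.

Lemma grid0 a b n : grid a b n 0 = a.
Proof. by rewrite /grid mulr0 mul0r addr0. Qed.

Lemma gridn a b n : (0 < n)%N -> grid a b n n = b.
Proof. by move=> n0; rewrite /grid mulfK ?pnatr_eq0 -?lt0n// addrC subrK. Qed.

Lemma gridS a b n i : grid a b n i.+1 = grid a b n i + (b - a) / n%:R.
Proof. by rewrite /grid -natr1; ring. Qed.

Lemma measurable_stepf t v n : measurable_fun setT (stepf t v n).
Proof.
by apply: measurable_sum => i; exact: measurable_funM.
Qed.

End step_functions.

Lemma Rintegral_sum d (T : measurableType d) (R : realType)
    (mu : {measure set T -> \bar R}) (D : set T) (I : eqType) (s : seq I)
    (f : I -> T -> R) : measurable D ->
  (forall i, mu.-integrable D (EFin \o f i)) ->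
  \int[mu]_(x in D) (\sum_(i <- s) f i x) = \sum_(i <- s) \int[mu]_(x in D) f i x.
Proof.
move=> mD fi; rewrite /Rintegral; under eq_integral do rewrite -sumEFin.
rewrite integral_sum//; elim: s => [|i s IHs]; first by rewrite !big_nil.
rewrite !big_cons fineD; first by rewrite IHs.
  exact: (integrable_fin_num mD (fi i)).
by apply/sum_fin_numP => j _ _; exact: (integrable_fin_num mD (fi j)).
Qed.

Lemma integrable_scale d (T : measurableType d) (R : realType)
    (mu : {measure set T -> \bar R}) (D : set T) (k : R) (f : T -> R) :
  measurable D -> mu.-integrable D (EFin \o f) ->
  mu.-integrable D (EFin \o (fun x => k * f x)).
Proof. by move=> mD fi; apply: eq_integrable (integrableZl mD k fi). Qed.

Lemma stepf_approx (R : realType) (K y : R) n : `|y| < K -> (0 < n)%N ->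
  `|stepf (grid (- K) K n) (grid (- K) K n) n y - y| <= (K + K) / n%:R.
Proof.
move=> yK n0; have K0 : 0 < K by exact: le_lt_trans yK.
have KK : - K <= K by rewrite ge0_cp// ltW.
have /ltr_normlP[yl yr] := yK.
have [||i iltn ix] := @grid_cell R (grid (- K) K n) n y.
- by rewrite grid0 lerNl ltW.
- by rewrite gridn.
rewrite (stepfE _ (grid_mono n KK) iltn ix) distrC.
case/andP: ix => ty; rewrite gridS opprK => yt.
by rewrite ger0_norm ?subr_ge0// lerBlDl ltW.
Qed.

Lemma cvg_stepf_approx (R : realType) (K y : R) : `|y| < K ->
  stepf (grid (- K) K n.+1) (grid (- K) K n.+1) n.+1 y @[n --> \oo] --> y.
Proof.
move=> yK; have K0 : 0 < K by exact: le_lt_trans yK.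
apply/cvgrPdist_le => e e0.
have /cvgrPdist_le /(_ (e / (K + K))) := @cvg_harmonic R.
rewrite divr_gt0 ?addr_gt0// => /(_ isT); apply: filterS => n /=.
rewrite sub0r normrN ger0_norm ?invr_ge0// => H; rewrite distrC.
by rewrite (le_trans (stepf_approx yK _))// mulrC -ler_pdivlMr ?addr_gt0.
Qed.

(** A crude bound, the width of the whole interval plus [K]; it only has to be uniform in [n], for
    dominated convergence. *)
Lemma norm_stepf_approx (R : realType) (K y : R) n : `|y| < K -> (0 < n)%N ->
  `|stepf (grid (- K) K n) (grid (- K) K n) n y| <= 3 * K.
Proof.
move=> yK n0; have K0 : 0 < K by exact: le_lt_trans yK.
rewrite -[stepf _ _ _ _](subrK y) (le_trans (ler_normD _ _))//.
have -> : 3 * K = (K + K) + K by ring.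
rewrite lerD ?(ltW yK)// (le_trans (stepf_approx yK n0))//.
by rewrite ler_pdivrMr ?ltr0n// ler_peMr ?ler1n// addr_ge0// ltW.
Qed.

Lemma cvg_Rintegral_dominated d (T : measurableType d) (R : realType)
    (mu : {measure set T -> \bar R}) (D : set T) (g : T -> R) (f_ : nat -> T -> R)
    (f : T -> R) : measurable D ->
  (forall n, measurable_fun D (f_ n)) -> mu.-integrable D (EFin \o g) ->
  (forall n x, D x -> `|f_ n x| <= g x) ->
  (forall x, D x -> f_ n x @[n --> \oo] --> f x) ->
  \int[mu]_(x in D) f_ n x @[n --> \oo] --> \int[mu]_(x in D) f x.
Proof.
move=> mD mf_ ig fM ff.
have mf : measurable_fun D f by exact: measurable_fun_cvg ff.
have [||||| fint _ H] := @dominated_convergence _ _ _ mu _ mD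
  (fun n w => (f_ n w)%:E) (EFin \o f) (EFin \o g).
- by move=> n; exact/measurable_EFinP.
- exact/measurable_EFinP.
- by apply: aeW => x Dx; apply/fine_cvgP; split; [exact: nearW|exact: ff].
- exact: ig.
- by apply: aeW => w n Dw /=; rewrite lee_fin fM.
by apply: fine_cvg; rewrite fineK// integrable_fin_num.
Qed.

Lemma cvg_Rintegral_bounded d (T : measurableType d) (R : realType)
    (mu : {measure set T -> \bar R}) (D : set T) (M : R) (f_ : nat -> T -> R)
    (f : T -> R) : measurable D -> (mu D < +oo)%E ->
  (forall n, measurable_fun D (f_ n)) ->
  (forall n x, D x -> `|f_ n x| <= M) ->
  (forall x, D x -> f_ n x @[n --> \oo] --> f x) ->
  \int[mu]_(x in D) f_ n x @[n --> \oo] --> \int[mu]_(x in D) f x.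
Proof.
move=> mD muD mf_ fM ff; apply: (@cvg_Rintegral_dominated _ _ _ _ _ (cst M)) => //.
by apply: measurable_bounded_integrable => //; exact: bounded_cst.
Qed.

Lemma bounded_integrable_on d (T : measurableType d) (R : realType)
    (mu : {measure set T -> \bar R}) (D : set T) (M : R) (f : T -> R) :
  measurable D -> (mu D < +oo)%E -> measurable_fun D f ->
  (forall x, D x -> `|f x| <= M) -> mu.-integrable D (EFin \o f).
Proof.
move=> mD muD mf fM; apply: measurable_bounded_integrable => //.
exists M; split; first exact: num_real.
by move=> N MN x Dx; exact: le_trans (fM x Dx) (ltW MN).
Qed.

Lemma integrable_indic_on d (T : measurableType d) (R : realType)
    (mu : {measure set T -> \bar R}) (D C : set T) :
  measurable D -> (mu D < +oo)%E -> measurable C ->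
  mu.-integrable D (EFin \o (\1_C : T -> R)).
Proof.
move=> mD muD mC; apply: (@bounded_integrable_on _ _ _ _ _ 1) => // x _.
by rewrite indicE; case: (_ \in _); rewrite ?normr1 ?normr0.
Qed.

Lemma stepf_comp (R : realType) (K y : R) (F : R -> R) n : `|y| < K -> (0 < n)%N ->
  stepf (grid (- K) K n) (fun i => F (grid (- K) K n i)) n y =
  F (stepf (grid (- K) K n) (grid (- K) K n) n y).
Proof.
move=> yK n0; have K0 : 0 < K by exact: le_lt_trans yK.
have KK : - K <= K by rewrite ge0_cp// ltW.
have /ltr_normlP[yl yr] := yK.
have [||i iltn ix] := @grid_cell R (grid (- K) K n) n y.
- by rewrite grid0 lerNl ltW.
- by rewrite gridn.
by rewrite !(stepfE _ (grid_mono n KK) iltn ix).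
Qed.

(** * Sums of independent variables and Poisson variables *)

Section independence.
Context d d' (T : measurableType d) (E : measurableType d') (R : realType)
  (P : probability T R).

(** Independence enters through indicators of [Y] only, with [c] in the role of the mean of [W].
    Cutting the range of [g] into cells makes [g (Y w)] a limit of combinations of such indicators,
    and bounded convergence concludes. *)
Lemma indep_integral (W : T -> R) (Y : T -> E) (c M : R) (g : E -> R) (K : R) :
  measurable_fun setT W -> 0 <= M -> (forall w, `|W w| <= M) ->
  measurable_fun setT Y ->
  (forall B, measurable B ->
     \int[P]_w (W w * \1_B (Y w)) = c * fine (P (Y @^-1` B))) ->
  measurable_fun setT g -> 0 < K -> (forall x, `|g x| < K) ->
  \int[P]_w (W w * g (Y w)) = c * \int[P]_w g (Y w).
Proof.
move=> mW M0 WM mY WY mg K0 gK.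
pose t n := grid (- K) K n.
pose s n := stepf (t n) (t n) n.
have msY n : measurable_fun setT (fun w => s n (g (Y w))).
  apply: measurableT_comp; first exact: measurable_stepf.
  exact: measurableT_comp.
have mgY : measurable_fun setT (g \o Y) by exact: measurableT_comp.
have sM n x : `|s n.+1 (g x)| <= 3 * K by exact: norm_stepf_approx.
have scvg x : s n.+1 (g x) @[n --> \oo] --> g x by exact: cvg_stepf_approx.
have scase n : \int[P]_w (W w * s n (g (Y w))) = c * \int[P]_w s n (g (Y w)).
  pose B i := g @^-1` `[t n i, t n i.+1[.
  have mB i : measurable (B i) by rewrite -[B i]setTI; exact: mg.
  have iB i : P.-integrable setT (EFin \o (fun w => \1_(B i) (Y w) : R)).
    apply: (@bounded_integrable _ _ _ _ 1) => //.
    - by apply: measurableT_comp.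
    - by move=> w; rewrite indicE; case: (_ \in _); rewrite ?normr1 ?normr0.
  have iWB i : P.-integrable setT (EFin \o (fun w => W w * \1_(B i) (Y w) : R)).
    apply: (@bounded_integrable _ _ _ _ M) => //.
    - by apply: measurable_funM => //; apply: measurableT_comp.
    - by move=> w; rewrite indicE; case: (_ \in _); rewrite ?mulr1 ?mulr0 ?normr0.
  transitivity (\sum_(i < n) \int[P]_w (t n i * (W w * \1_(B i) (Y w)))).
    rewrite -Rintegral_sum//; last by move=> i; exact: integrable_scale.
    apply: eq_Rintegral => w _; rewrite /s /stepf mulr_sumr.
    by apply: eq_bigr => i _; rewrite mulrCA.
  transitivity (c * \sum_(i < n) \int[P]_w (t n i * \1_(B i) (Y w))); last first.
    by rewrite -Rintegral_sum// => i; exact: integrable_scale.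
  rewrite mulr_sumr; apply: eq_bigr => i _.
  rewrite !RintegralZl// WY// mulrCA; congr (_ * (_ * _)).
  by rewrite /Rintegral integral_indic ?setIT// -[X in measurable X]setTI; exact: mY.
have L : \int[P]_w (W w * s n.+1 (g (Y w))) @[n --> \oo] -->
         \int[P]_w (W w * g (Y w)).
  apply: (@bounded_cvg_Rintegral _ _ _ _ (M * (3 * K))).
  - by move=> n; exact: measurable_funM.
  - exact: measurable_funM.
  - by move=> n w; rewrite normrM ler_pM.
  - by apply: aeW => w; apply: cvgM => //; exact: cvg_cst.
have L' : \int[P]_w (W w * s n.+1 (g (Y w))) @[n --> \oo] -->
    c * \int[P]_w g (Y w).
  under eq_cvg do rewrite scase.
  apply: cvgM; first exact: cvg_cst.
  apply: (@bounded_cvg_Rintegral _ _ _ _ (3 * K)) => //.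
  by apply: aeW => w.
exact: (cvg_unique _ L L').
Qed.

(* The indicators of the product rule are replaced by trigonometric functions one
   index at a time: after [k] steps the integrals of [cos] and [sin] of the first
   [k] terms against the remaining indicators factor with constants [a] and [b]. *)
Lemma sqmod_sum n (Y : 'I_n -> T -> E) (f : 'I_n -> E -> R) :
  (forall i, measurable_fun setT (Y i)) ->
  (forall i, measurable_fun setT (f i)) ->
  mutually_independent P Y ->
  sqmod P (fun w => \sum_(i < n) f i (Y i w)) =
  \prod_(i < n) sqmod P (fun w => f i (Y i w)).
Proof.
move=> mY mf indY.
pose S k w := \sum_(i < n | (i < k)%N) f i (Y i w).
pose I1 (B : 'I_n -> set E) k w : R := \prod_(i < n | (k <= i)%N) \1_(B i) (Y i w).
pose PB (B : 'I_n -> set E) k : R := \prod_(i < n | (k <= i)%N) fine (P (Y i @^-1` B i)).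
have mS k : measurable_fun setT (S k).
  rewrite /S; under eq_fun do rewrite big_mkcond.
  apply: measurable_sum => i; case: (i < k)%N => //.
  exact: measurableT_comp.
have mI1 B k : (forall i, measurable (B i)) -> measurable_fun setT (I1 B k).
  move=> mB; rewrite /I1; under eq_fun do rewrite big_mkcond.
  apply: measurable_prod => i _; case: (k <= i)%N => //.
  by apply: measurableT_comp.
have I1_le B k w : `|I1 B k w| <= 1.
  rewrite /I1; apply: (big_ind (fun x : R => `|x| <= 1)); first by rewrite normr1.
    by move=> x y x1 y1; rewrite normrM mulr_ile1.
  by move=> i _; rewrite indicE; case: (_ \in _); rewrite ?normr1 ?normr0.
have main k : (k <= n)%N -> exists a b : R,
    a ^+ 2 + b ^+ 2 = \prod_(i < n | (i < k)%N) sqmod P (fun w => f i (Y i w)) /\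
    forall B, (forall i, measurable (B i)) ->
      \int[P]_w (cos (S k w) * I1 B k w) = a * PB B k /\
      \int[P]_w (sin (S k w) * I1 B k w) = b * PB B k.
  elim: k => [_|k IHk kn].
    exists 1, 0; split; first by rewrite big_pred0// expr1n expr0n addr0.
    move=> B mB.
    have S0 w : S 0%N w = 0 by rewrite /S big_pred0.
    under eq_Rintegral do rewrite S0 cos0 mul1r.
    under [in X in _ /\ X]eq_Rintegral do rewrite S0 sin0 mul0r.
    rewrite Rexp_cst mul0r mul1r; split => //.
    have mBY i : measurable (Y i @^-1` B i) by rewrite -[X in measurable X]setTI; exact: mY.
    have -> : PB B 0%N = fine (P [set w | forall i, B i (Y i w)]).
      rewrite indY// /PB (eq_bigr (fun i => (fine (P (Y i @^-1` B i)))%:E)).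
        by rewrite prodEFin.
      by move=> i _; rewrite fineK// fin_num_measure.
    transitivity (\int[P]_w (\1_[set w | forall i, B i (Y i w)] w : R)).
      apply: eq_Rintegral => w _; rewrite /I1 indicE.
      have [/set_mem/= BY|/negP nBY] := boolP (w \in _).
        by rewrite big1// => i _; rewrite indicE mem_set.
      have [i nBi] : exists i, ~ B i (Y i w).
        by apply/existsNP => H; apply: nBY; rewrite inE.
      by rewrite (bigD1 i)//= indicE memNset// mul0r.
    rewrite /Rintegral integral_indic ?setIT//.
    rewrite [X in measurable X](_ : _ = \bigcap_(i in setT) (Y i @^-1` B i)).
      by apply: fin_bigcap_measurable.
    by apply/seteqP; split => w /= H i; [move=> _|]; exact: H.
  pose o := Ordinal kn.
  have [a [b [ab IH]]] := IHk (ltnW kn).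
  pose C := \int[P]_w cos (f o (Y o w)); pose D := \int[P]_w sin (f o (Y o w)).
  have lastS (i : 'I_n) : (i < k.+1)%N && (i != o) = (i < k)%N :> bool.
    rewrite ltnS leq_eqVlt -val_eqE/=.
    by case: (eqVneq (i : nat) k) => [->|_]; rewrite ?ltnn ?andbT.
  have lastI (i : 'I_n) : (k <= i)%N && (i != o) = (k < i)%N :> bool.
    rewrite leq_eqVlt -val_eqE/= eq_sym.
    by case: (eqVneq (i : nat) k) => [->|_]; rewrite ?ltnn ?andbT.
  have SS w : S k.+1 w = S k w + f o (Y o w).
    rewrite /S (bigD1 o)/= ?ltnSn// addrC; congr (_ + _).
    by apply: eq_bigl => i; rewrite lastS.
  (* The product [(a + i b) (C + i D)]: one more factor of the characteristic function. *)
  exists (a * C - b * D), (b * C + a * D); split.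
    rewrite (bigD1 o)/= ?ltnSn// (eq_bigl _ _ lastS) -ab /sqmod -/C -/D; ring.
  move=> B mB.
  have L1 (g : R -> R) (c : R) : measurable_fun setT g -> (forall x, `|g x| <= 1) ->
     (forall B, (forall i, measurable (B i)) ->
       \int[P]_w (g (S k w) * I1 B k w) = c * PB B k) ->
     forall (h : R -> R), measurable_fun setT h -> (forall x, `|h x| <= 1) ->
      \int[P]_w (g (S k w) * I1 B k.+1 w * h (f o (Y o w))) =
      c * PB B k.+1 * \int[P]_w h (f o (Y o w)).
    move=> mg g1 gc h mh h1.
    apply: (@indep_integral (fun w => g (S k w) * I1 B k.+1 w) (Y o) _ 1
      (h \o f o) 2) => //.
    - by apply: measurable_funM; [exact: measurableT_comp|exact: mI1].
    - by move=> w; rewrite normrM mulr_ile1.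
    - move=> B0 mB0.
      (* The hypothesis at [k] still carries the indicator of index [o]. Putting [B0] in that place
         yields the factorization against [\1_B0] that [indep_integral] asks for. *)
      pose B' i := if i == o then B0 else B i.
      have mB' i : measurable (B' i) by rewrite /B'; case: ifP.
      have B'o : B' o = B0 by rewrite /B' eqxx.
      have B'i (i : 'I_n) : (k < i)%N -> B' i = B i.
        by move=> ki; rewrite /B' -val_eqE/= gtn_eqF.
      have PBE : PB B' k = fine (P (Y o @^-1` B0)) * PB B k.+1.
        rewrite /PB (bigD1 o)//= B'o (eq_bigl _ _ lastI); congr (_ * _).
        by apply: eq_bigr => i ki; rewrite B'i.
      have I1E w : I1 B' k w = \1_B0 (Y o w) * I1 B k.+1 w.
        rewrite /I1 (bigD1 o)//= B'o (eq_bigl _ _ lastI); congr (_ * _).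
        by apply: eq_bigr => i ki; rewrite B'i.
      rewrite -mulrA [PB _ _ * _]mulrC -PBE -gc//.
      by apply: eq_Rintegral => w _; rewrite I1E; ring.
    - exact: measurableT_comp.
    - by move=> x /=; rewrite (le_lt_trans (h1 _))// ltr1n.
  have mcos : measurable_fun setT (@cos R).
    by apply: continuous_measurable_fun; exact: continuous_cos.
  have msin : measurable_fun setT (@sin R).
    by apply: continuous_measurable_fun; exact: continuous_sin.
  have IHc B' mB' := (IH B' mB').1; have IHs B' mB' := (IH B' mB').2.
  have Lcc := L1 _ _ mcos (@cos_max R) IHc _ mcos (@cos_max R).
  have Lcs := L1 _ _ mcos (@cos_max R) IHc _ msin (@sin_max R).
  have Lsc := L1 _ _ msin (@sin_max R) IHs _ mcos (@cos_max R).
  have Lss := L1 _ _ msin (@sin_max R) IHs _ msin (@sin_max R).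
  have int (g h : R -> R) : measurable_fun setT g -> (forall x, `|g x| <= 1) ->
     measurable_fun setT h -> (forall x, `|h x| <= 1) ->
     P.-integrable setT (EFin \o (fun w => g (S k w) * I1 B k.+1 w * h (f o (Y o w)))).
    move=> mg g1 mh h1; apply: (@bounded_integrable _ _ _ _ 1).
      apply: measurable_funM; last first.
        by apply: measurableT_comp => //; exact: measurableT_comp.
      by apply: measurable_funM; [exact: measurableT_comp|exact: mI1].
    by move=> w; rewrite !normrM mulr_ile1// mulr_ile1.
  split.
    transitivity (\int[P]_w (cos (S k w) * I1 B k.+1 w * cos (f o (Y o w)) -
                             sin (S k w) * I1 B k.+1 w * sin (f o (Y o w)))).
      by apply: eq_Rintegral => w _; rewrite SS cosD; ring.
    rewrite RintegralB//; [|apply: int..] => //; try exact: cos_max; try exact: sin_max.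
    by rewrite Lcc Lss -/C -/D; ring.
  transitivity (\int[P]_w (sin (S k w) * I1 B k.+1 w * cos (f o (Y o w)) +
                           cos (S k w) * I1 B k.+1 w * sin (f o (Y o w)))).
    by apply: eq_Rintegral => w _; rewrite SS sinD; ring.
  rewrite RintegralD//; [|apply: int..] => //; try exact: cos_max; try exact: sin_max.
  by rewrite Lsc Lcs -/C -/D; ring.
have [a [b [ab H]]] := main n (leqnn n).
have [Hc Hs] := H (fun _ => setT) (fun _ => measurableT).
have PBn : PB (fun=> setT) n = 1.
  by rewrite /PB big_pred0// => i; rewrite leqNgt ltn_ord.
have I1n w : I1 (fun=> setT) n w = 1.
  by rewrite /I1 big_pred0// => i; rewrite leqNgt ltn_ord.
have Sn w : S n w = \sum_(i < n) f i (Y i w).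
  by apply: eq_bigl => i; rewrite ltn_ord.
transitivity (a ^+ 2 + b ^+ 2); last first.
  by rewrite ab; apply: eq_bigl => i; rewrite ltn_ord.
rewrite -[a]mulr1 -[b]mulr1 -PBn -Hc -Hs; congr (_ ^+ 2 + _ ^+ 2).
  by apply: eq_Rintegral => w _; rewrite I1n mulr1 Sn.
by apply: eq_Rintegral => w _; rewrite I1n mulr1 Sn.
Qed.

End independence.

Section poisson_transform.
Context (R : realType) (theta : R).

(** The power series with coefficients [c] and [s] are the real and imaginary parts of
    [exp (x exp (i theta))]. Multiplied by [exp (- x)], they are the means of [cos (theta N)] and
    [sin (theta N)] for [N] Poisson of rate [x]. *)
Let c k : R := cos (theta * k%:R) / k`!%:R.
Let s k : R := sin (theta * k%:R) / k`!%:R.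

Let cvg_pseries (u : nat -> R) (M x : R) : 0 <= M -> (forall k, `|u k| <= M / k`!%:R) ->
  cvgn (pseries u x).
Proof.
move=> M0 uM; apply: normed_cvg.
apply: (@series_le_cvg _ _ (fun k => M * exp_coeff `|x| k)).
- by move=> n; exact: normr_ge0.
- by move=> n; rewrite mulr_ge0// exp_coeff_ge0.
- move=> n; rewrite /= normrM normrX /exp_coeff/=.
  by rewrite (_ : M * _ = M / n`!%:R * `|x| ^+ n) ?ler_wpM2r//; ring.
- exact/is_cvg_seriesZ/is_cvg_series_exp_coeff.
Qed.

Let c_le k : `|c k| <= 1 / k`!%:R.
Proof.
rewrite /c normrM (ger0_norm (x := k`!%:R^-1)) ?invr_ge0// ler_wpM2r ?invr_ge0//.
exact: cos_max.
Qed.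

Let s_le k : `|s k| <= 1 / k`!%:R.
Proof.
rewrite /s normrM (ger0_norm (x := k`!%:R^-1)) ?invr_ge0// ler_wpM2r ?invr_ge0//.
exact: sin_max.
Qed.

(** Formal differentiation shifts the index by one: [k.+1] cancels against the factorial and
    [exp (i theta k)] gains a factor [exp (i theta)], so the pair [(c, s)] is rotated by [theta]. *)
Let diffs_c : pseries_diffs c = fun k => cos theta * c k - sin theta * s k.
Proof.
apply/funext => k; rewrite /pseries_diffs /c /s factS natrM -(addn1 k) natrD.
rewrite mulrDr mulr1 cosD; field.
by rewrite natr1 !pnatr_eq0 -lt0n fact_gt0.
Qed.

Let diffs_s : pseries_diffs s = fun k => sin theta * c k + cos theta * s k.
Proof.
apply/funext => k; rewrite /pseries_diffs /c /s factS natrM -(addn1 k) natrD.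
rewrite mulrDr mulr1 sinD; field.
by rewrite natr1 !pnatr_eq0 -lt0n fact_gt0.
Qed.

Let lim_comb (u v : nat -> R) (a b x : R) :
  (forall k, `|u k| <= 1 / k`!%:R) -> (forall k, `|v k| <= 1 / k`!%:R) ->
  limn (pseries (fun k => a * u k + b * v k) x) =
  a * limn (pseries u x) + b * limn (pseries v x).
Proof.
move=> u1 v1; have Cu : cvgn (pseries u x) by exact: (@cvg_pseries _ 1).
have Cv : cvgn (pseries v x) by exact: (@cvg_pseries _ 1).
apply/cvg_lim => //.
rewrite (_ : pseries _ x = fun n => a * pseries u x n + b * pseries v x n).
  by apply: cvgD; apply: cvgM => //; exact: cvg_cst.
apply/funext => n; rewrite /pseries /series/= !mulr_sumr -big_split/=.
by apply: eq_bigr => i _; ring.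
Qed.

Let comb_le (u v : nat -> R) (a b : R) (M : R) k : `|a| <= 1 -> `|b| <= 1 ->
  `|u k| <= M / k`!%:R -> `|v k| <= M / k`!%:R ->
  `|a * u k + b * v k| <= (M + M) / k`!%:R.
Proof.
move=> a1 b1 uk vk; rewrite (le_trans (ler_normD _ _))// mulrDl !normrM.
apply: lerD; first by rewrite (le_trans (ler_wpM2r _ a1))// mul1r.
by rewrite (le_trans (ler_wpM2r _ b1))// mul1r.
Qed.

(** The formal derivatives of [u] and [v] are again combinations of [u] and [v]. Hence the first and
    second formal derivatives, whose convergence is required for termwise differentiation, are all
    dominated by exponential series. *)
Let der (u v : nat -> R) (a b a' b' x : R) :
  (forall k, `|u k| <= 1 / k`!%:R) -> (forall k, `|v k| <= 1 / k`!%:R) ->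
  `|a| <= 1 -> `|b| <= 1 -> `|a'| <= 1 -> `|b'| <= 1 ->
  pseries_diffs u = (fun k => a * u k + b * v k) ->
  pseries_diffs v = (fun k => a' * u k + b' * v k) ->
  is_derive x 1 (fun x => limn (pseries u x))
    (a * limn (pseries u x) + b * limn (pseries v x)).
Proof.
move=> u1 v1 a1 b1 a1' b1' du dv; rewrite -lim_comb// -du.
apply: (@pseries_snd_diffs _ _ (`|x| + 1)).
- exact: (@cvg_pseries _ 1).
- rewrite du; apply: (@cvg_pseries _ (1 + 1)) => // k.
  exact: comb_le.
- have -> : pseries_diffs (pseries_diffs u) =
      (fun k => a * (a * u k + b * v k) + b * (a' * u k + b' * v k)).
    have Eu k : a * u k + b * v k = k.+1%:R * u k.+1.
      by rewrite -[RHS]/(pseries_diffs u k) du.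
    have Ev k : a' * u k + b' * v k = k.+1%:R * v k.+1.
      by rewrite -[RHS]/(pseries_diffs v k) dv.
    by rewrite du; apply/funext => k; rewrite Eu Ev /pseries_diffs; ring.
  apply: (@cvg_pseries _ (1 + 1 + (1 + 1))); first by rewrite !addr_ge0.
  move=> k; apply: (@comb_le (fun k => a * u k + b * v k)
    (fun k => a' * u k + b' * v k)) => //; exact: comb_le.
- by rewrite [ltRHS]ger0_norm ?addr_ge0// ltrDl.
Qed.

Let C (x : R) : R := limn (pseries c x).
Let S (x : R) : R := limn (pseries s x).

Let dC (x : R) : is_derive x 1 C (cos theta * C x + - sin theta * S x).
Proof.
apply: (@der c s (cos theta) (- sin theta) (sin theta) (cos theta)) => //.
- exact: cos_max.
- by rewrite normrN sin_max.
- exact: sin_max.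
- exact: cos_max.
- by rewrite diffs_c; apply/funext => k; rewrite mulNr.
Qed.

Let dS (x : R) : is_derive x 1 S (cos theta * S x + sin theta * C x).
Proof.
apply: (@der s c (cos theta) (sin theta) (- sin theta) (cos theta)) => //.
- exact: cos_max.
- exact: sin_max.
- by rewrite normrN sin_max.
- exact: cos_max.
- by rewrite diffs_s; apply/funext => k; rewrite addrC.
- by rewrite diffs_c; apply/funext => k; rewrite addrC mulNr.
Qed.

Let pseries0 (u : nat -> R) : limn (pseries u 0) = u 0%N.
Proof.
apply: lim_near_cst => //; exists 1%N => // -[//|n] _ /=.
rewrite /pseries /series/= big_nat_recl//= expr0 mulr1 big1 ?addr0// => i _.
by rewrite expr0n/= mulr0.
Qed.

Lemma cvg_pseries_le1 (f : R -> R) (x : R) : (forall y, `|f y| <= 1) ->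
  cvgn (pseries (fun k => f (theta * k%:R) / k`!%:R) x).
Proof.
move=> f1; apply: (@cvg_pseries _ 1) => // k.
by rewrite normrM (ger0_norm (x := k`!%:R^-1)) ?invr_ge0// ler_wpM2r ?invr_ge0.
Qed.

(* Both series solve a linear differential system, so that [(C^2 + S^2)
   exp (- 2 x cos theta)] has derivative zero. *)
Lemma sqr_pseries_cos_sin (x : R) :
  C x ^+ 2 + S x ^+ 2 = expR (2 * cos theta * x).
Proof.
pose h (x : R) : R := (C x ^+ 2 + S x ^+ 2) * expR (- (2 * cos theta) * x).
have dh (y : R) : is_derive y 1 h 0.
  have := dC y; have := dS y => dSy dCy.
  rewrite /h; apply: trigger_derive; rewrite /GRing.scale/=; ring.
have hx : h x = h 0 by exact: is_derive_0_is_cst.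
have h0 : h 0 = 1.
  rewrite /h mulr0 expR0 mulr1 /C /S !pseries0 /c /s mulr0 cos0 sin0 mul0r.
  by rewrite fact0 divr1 expr1n expr0n addr0.
move: hx; rewrite h0 /h mulNr expRN => /eqP.
by rewrite -[_ / _ == _]/(_ / _ == _) (can2_eq (mulfVK _) (mulfK _)) ?expR_eq0// mul1r => /eqP.
Qed.

End poisson_transform.

Section poisson_sqmod.
Context d (T : measurableType d) (R : realType) (P : probability T R).
Variables (N : T -> \bar R) (l : R).
Hypothesis mN : measurable_fun setT N.
Hypothesis l0 : 0 <= l.
Hypothesis PN : forall k : nat,
  P [set w | N w = k%:R%:E] = poisson_prob l 0 [set k].

Let p k : R := expR (- l) * (l ^+ k / k`!%:R).

Let PNp k : P [set w | N w = k%:R%:E] = (p k)%:E.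
Proof.
rewrite PN /poisson_prob /p; case: ltP => [l_gt0|l_le0].
  by rewrite esum_set1 /poisson_pmf ?l_gt0// ?lee_fin ?mulr_ge0 ?exprn_ge0 ?expR_ge0// mulrC.
(* At rate 0 the law is the Dirac mass at 0, and [p] agrees with it because [0 ^+ 0 = 1]. *)
have -> : l = 0 by apply/le_anti; rewrite l0 l_le0.
rewrite diracE oppr0 expR0 mul1r; case: k => [|k].
  by rewrite mem_set//= expr0 fact0 divr1.
by rewrite memNset//= expr0n/= mul0r.
Qed.

Let mNk k : measurable [set w | N w = k%:R%:E].
Proof.
rewrite -[X in measurable X]setTI.
have -> : [set w | N w = k%:R%:E] = N @^-1` [set k%:R%:E] by [].
exact: mN.
Qed.

Let cvg_p : \sum_(k < n) p k @[n --> \oo] --> (1 : R).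
Proof.
have -> : (1 : R) = expR (- l) * expR l by rewrite -expRD addNr expR0.
rewrite (_ : (fun _ => _) = (fun n => expR (- l) * series (exp_coeff l) n)).
  apply: cvgM; first exact: cvg_cst.
  exact: is_cvg_series_exp_coeff.
by apply/funext => n; rewrite /series/= mulr_sumr big_mkord.
Qed.

(** [N] has extended real values and only its masses at the naturals are prescribed. They add up to
    1, which excludes every other value, [+oo] included, up to a null set. *)
Lemma poisson_ae_nat : {ae P, forall w, exists k : nat, N w = k%:R%:E}.
Proof.
pose A := \bigcup_k [set w | N w = k%:R%:E].
have mA : measurable A by exact: bigcupT_measurable.
have PA : P A = 1%E.
  have tA : trivIset setT (fun k : nat => [set w | N w = k%:R%:E]).
    apply/trivIsetP => i j _ _ /eqP ij; apply/seteqP; split => // w [/= -> [] /eqP].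
    by rewrite eqr_nat => /eqP.
  have H := measure_semi_sigma_additive (s := P) _ mNk tA mA.
  have E n : (\sum_(0 <= i < n) P [set w | N w = i%:R%:E])%E = (\sum_(k < n) p k)%:E.
    by rewrite -sumEFin big_mkord; apply: eq_bigr => i _.
  have H' : (\sum_(0 <= i < n) P [set w | N w = i%:R%:E])%E @[n --> \oo] --> 1%E.
    under eq_cvg do rewrite E.
    by apply/fine_cvgP; split; [exact: nearW|exact: cvg_p].
  exact: (cvg_unique _ H H').
exists (~` A); split; first exact: measurableC.
  by have := probability_setC P mA; rewrite PA subee.
by move=> w /= nk [k _ Nk]; apply: nk; exists k.
Qed.

(** The partial sum is the mean of [g (fine (N w))] restricted to the event that [N] is one of the
    first [n] naturals. As [|g| <= 1], the error is at most the mass left over, which tends to 0. *)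
Lemma cvg_poisson_expectation (g : R -> R) : measurable_fun setT g ->
  (forall x, `|g x| <= 1) ->
  \sum_(k < n) g k%:R * p k @[n --> \oo] --> \int[P]_w g (fine (N w)).
Proof.
move=> mg g1.
pose A k : set T := [set w | N w = k%:R%:E].
have mgN : measurable_fun setT (fun w => g (fine (N w))).
  by apply: measurableT_comp => //; exact: measurableT_comp.
have iA k : P.-integrable setT (EFin \o (\1_(A k) : T -> R)).
  apply: (@bounded_integrable _ _ _ _ 1) => [|w].
    by apply: measurable_indic; exact: mNk.
  by rewrite indicE; case: (_ \in _); rewrite ?normr1 ?normr0.
have EA k : \int[P]_w (\1_(A k) w : R) = p k.
  rewrite /Rintegral integral_indic//; last exact: mNk.
  by rewrite setIT; transitivity (fine (p k)%:E) => //; congr fine; exact: PNp.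
(* The events [A k] are disjoint: either exactly one indicator is 1 and it selects a value of [h],
   or both sums vanish. *)
have sumA (h : nat -> R) n w :
    (exists2 k, h k = \sum_(k < n) h k * \1_(A k) w &
       \sum_(k < n) \1_(A k) w = 1 :> R /\ N w = k%:R%:E) \/
    (\sum_(k < n) h k * \1_(A k) w = 0 /\ \sum_(k < n) \1_(A k) w = 0 :> R).
  have [[k0 [k0n Nk0]]|nk] := pselect (exists k, (k < n)%N /\ N w = k%:R%:E).
    have A0 : \1_(A k0) w = 1 :> R by rewrite indicE mem_set.
    have A1 (i : 'I_n) : i != Ordinal k0n -> \1_(A i) w = 0 :> R.
      move=> ik0; rewrite indicE memNset// /A/= Nk0 => -[] /eqP.
      by rewrite eqr_nat eq_sym => /eqP ik; case/eqP: ik0; exact: val_inj.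
    left; exists k0; last split => //.
      rewrite (bigD1 (Ordinal k0n))//= A0 mulr1 big1 ?addr0// => i ik0.
      by rewrite A1 ?mulr0.
    by rewrite (bigD1 (Ordinal k0n))//= A0 big1 ?addr0.
  have A1 (i : 'I_n) : \1_(A i) w = 0 :> R.
    by rewrite indicE memNset// /A/= => Ni; apply: nk; exists i.
  by right; rewrite !big1// => i _; rewrite A1 ?mulr0.
apply/cvgrPdist_le => e e0.
have /cvgrPdist_le /(_ e e0) := cvg_p; apply: filterS => n.
have isum (h : nat -> R) : P.-integrable setT
    (EFin \o (fun w => \sum_(k < n) h k * \1_(A k) w)).
  apply: (eq_integrable measurableT (fun w => \sum_(k < n) (h k * \1_(A k) w)%:E)%E).
    by move=> w _; rewrite sumEFin.
  by apply: integrable_sum => // i _; exact: integrable_scale.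
have Esum (h : nat -> R) :
    \int[P]_w (\sum_(k < n) h k * \1_(A k) w) = \sum_(k < n) h k * p k.
  rewrite Rintegral_sum//; last by move=> i; exact: integrable_scale.
  by apply: eq_bigr => i _; rewrite RintegralZl// EA.
have ig : P.-integrable setT (EFin \o (fun w => g (fine (N w)))).
  exact: (@bounded_integrable _ _ _ _ 1).
rewrite -(Esum (fun k => g k%:R)) -RintegralB//; last exact: (isum (fun k => g k%:R)).
move=> H.
have p_le1 : \sum_(k < n) p k <= 1.
  have -> : \sum_(k < n) p k = \sum_(k < n) (fun=> 1) (k : nat) * p k.
    by apply: eq_bigr => i _; rewrite mul1r.
  rewrite -(Esum (fun=> 1)) -[leRHS](Rexp_cst P); apply: le_Rintegral => //.
  - exact: (isum (fun=> 1)).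
  - by apply: (@bounded_integrable _ _ _ _ 1 (cst 1)) => // w; rewrite normr1.
  move=> w _; have [[k <- _]//|[-> _]//] := sumA (fun=> 1) n w.
apply: le_trans H; rewrite [leRHS]ger0_norm ?subr_ge0//.
have -> : 1 - \sum_(k < n) p k =
    \int[P]_w (1 - \sum_(k < n) (fun=> 1) (k : nat) * \1_(A k) w).
  rewrite RintegralB//; [|by apply: (@bounded_integrable _ _ _ _ 1 (cst 1)) => // w;
    rewrite normr1|exact: (isum (fun=> 1))].
  rewrite Rexp_cst (Esum (fun=> 1)); congr (_ - _).
  by apply: eq_bigr => i _; rewrite mul1r.
have iB : P.-integrable setT
    (EFin \o (fun w => g (fine (N w)) - \sum_(k < n) g k%:R * \1_(A k) w)).
  by apply: eq_integrable (integrableB measurableT ig (isum (fun k => g k%:R))).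
rewrite (le_trans (le_normr_Rintegral _ _))//; apply: le_Rintegral => //.
- by apply: eq_integrable (integrable_abse iB).
- have i1 : P.-integrable setT (EFin \o cst (1 : R)).
    by apply: (@bounded_integrable _ _ _ _ 1 (cst 1)) => // w; rewrite normr1.
  by apply: eq_integrable (integrableB measurableT i1 (isum (fun=> 1))).
- move=> w _; have [[k gk [s1 Nk]]|[-> s0]] := sumA (fun k => g k%:R) n w.
    by rewrite -gk Nk/= subrr normr0; under eq_bigr do rewrite mul1r; rewrite s1 subrr.
  by rewrite subr0; under eq_bigr do rewrite mul1r; rewrite s0 subr0.
Qed.

Lemma sqmod_poisson (theta : R) :
  sqmod P (fun w => theta * fine (N w)) = expR (- (2 * l * (1 - cos theta))).
Proof.
have mul_meas : measurable_fun setT (fun x : R => theta * x).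
  exact: measurable_funM.
have ce (trig : R -> R) : measurable_fun setT trig -> (forall x, `|trig x| <= 1) ->
    \int[P]_w trig (theta * fine (N w)) =
    expR (- l) * limn (pseries (fun k => trig (theta * k%:R) / k`!%:R) l).
  move=> mtrig trig1.
  have := @cvg_poisson_expectation (trig \o *%R theta) _ _.
  move=> /(_ (measurableT_comp mtrig mul_meas) (fun x => trig1 _)) H.
  have E n : \sum_(k < n) trig (theta * k%:R) * p k =
      expR (- l) * pseries (fun k => trig (theta * k%:R) / k`!%:R) l n.
    rewrite /pseries /series/= mulr_sumr big_mkord.
    by apply: eq_bigr => i _; rewrite /p; ring.
  have L : \sum_(k < n) trig (theta * k%:R) * p k @[n --> \oo] -->
      expR (- l) * limn (pseries (fun k => trig (theta * k%:R) / k`!%:R) l).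
    under eq_cvg do rewrite E.
    by apply: cvgM; [exact: cvg_cst|exact: cvg_pseries_le1].
  exact: (cvg_unique _ H L).
have mcos : measurable_fun setT (@cos R).
  by apply: continuous_measurable_fun; exact: continuous_cos.
have msin : measurable_fun setT (@sin R).
  by apply: continuous_measurable_fun; exact: continuous_sin.
rewrite /sqmod (ce _ mcos (@cos_max R)) (ce _ msin (@sin_max R)).
rewrite !exprMn -mulrDr sqr_pseries_cos_sin expr2 -!expRD; congr expR; ring.
Qed.

End poisson_sqmod.

(** * Integrals against the Poisson random measure *)

Lemma measurable_kernel_Rintegral d d' (T : measurableType d) (E : measurableType d')
    (R : realType) (k : R.-ker T ~> E) (D : set E) (f : E -> R) :
  measurable D -> measurable_fun D f ->
  measurable_fun setT (fun w => \int[k w]_(x in D) f x).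
Proof.
move=> mD mf; rewrite /Rintegral.
under eq_fun do rewrite integral_mkcond integralE.
have mfD : measurable_fun setT ((EFin \o f) \_ D).
  by rewrite -measurable_restrictT//; exact/measurable_EFinP.
have mk U : measurable U -> measurable_fun setT (k ^~ U).
  by move=> mU; exact: measurable_kernel.
apply: measurableT_comp => //; apply: emeasurable_funB.
- by apply: measurable_fun_integral_kernel => //; exact: measurable_funepos.
- by apply: measurable_fun_integral_kernel => //; exact: measurable_funeneg.
Qed.

Lemma jump_intensity_rect (R : realType) (Pi : {measure set R -> \bar R}) (t : R)
    (D : set R) : 0 <= t -> measurable D ->
  jump_intensity Pi (`[0, t] `*` D) = (t%:E * Pi D)%E.
Proof.
move=> t0 mD; rewrite /jump_intensity.
have -> : (`[0, t] `*` D) `&` (`[0, +oo[ `*` setT) = (`[0, t] `*` D) :> set (R * R).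
  apply/seteqP; split => [[s u] /= []//|[s u] /= [st Du]]; split => //; split => //.
  by move: st; rewrite !in_itv/= andbT => /andP[].
rewrite /product_measure1/=.
transitivity (\int[@lebesgue_measure R]_x ((\1_(`[0, t] : set R) x)%:E * Pi D))%E.
  apply: eq_integral => x _.
  rewrite indicE; have [xA1|xA1] /= := boolP (x \in `[0, t]%classic).
    by rewrite in_xsectionX// mul1e.
  by rewrite mul0e notin_xsectionX.
rewrite ge0_integralZr ?integral_indic ?setIT//; last exact: measurableT_comp.
suff E : @lebesgue_measure R `[0, t]%classic = t%:E by rewrite -[in RHS]E.
rewrite lebesgue_measure_itv/= lte_fin oppr0 addr0.
by case: ltP => // t0'; congr EFin; apply/le_anti; rewrite t0 t0'.
Qed.

Section prm.
Context d (T : measurableType d) (R : realType) (P : probability T R)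
  (Pi : {measure set R -> \bar R}) (nu : R.-ker T ~> (R * R)%type).
Hypothesis Hnu : is_poisson_random_measure P (jump_intensity Pi) nu.
Variables (t : R) (D : set R).
Hypothesis t0 : 0 <= t.
Hypothesis mD : measurable D.
Hypothesis PiD : (Pi D < +oo)%E.

Let meas_rect C : measurable C -> measurable (`[0, t] `*` C : set (R * R)).
Proof. by move=> mC; apply: measurableX. Qed.

Lemma prm_rect_ae_fin : {ae P, forall w,
  exists k : nat, nu w (`[0, t] `*` D : set (R * R)) = k%:R%:E}.
Proof.
have JD : (jump_intensity Pi (`[0%R, t] `*` D : set (R * R)) < +oo)%E.
  by rewrite jump_intensity_rect// lte_mul_pinfty// ?lee_fin.
apply: (@poisson_ae_nat _ _ _ _ _ (fine (jump_intensity Pi (`[0, t] `*` D : set (R * R))))).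
- by apply: measurable_kernel; exact: meas_rect.
- by rewrite fine_ge0// jump_intensity_rect// mule_ge0.
- by move=> k; apply: (prm_poisson Hnu) => //; exact: meas_rect.
Qed.

(** Campbell's formula for the squared modulus. Cutting [D] by jump size gives independent Poisson
    counts, so the transform of the step sums [S n] is explicit. As the mesh tends to 0, these sums
    converge path by path to the integral against [nu], and their exponents to the integral against
    [Pi]. *)
Lemma sqmod_prm_integral (K z : R) : (forall u, D u -> `|u| < K) -> 0 < K ->
  sqmod P (fun w => z * \int[nu w]_(x in (`[0, t] `*` D : set (R * R))) x.2) =
  expR (- (2 * t * \int[Pi]_(u in D) (1 - cos (z * u)))).
Proof.
move=> DK K0.
pose g n := grid (- K) K n.
pose C n i := D `&` `[g n i, g n i.+1[.
pose B n i : set (R * R) := `[0, t] `*` C n i.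
pose S n w := \sum_(i < n) z * g n i * fine (nu w (B n i)).
have KK : - K <= K by rewrite ge0_cp// ltW.
have mC n i : measurable (C n i) by exact: measurableI.
have mB n i : measurable (B n i) by exact: meas_rect.
have PiC n i : (Pi (C n i) < +oo)%E.
  by apply: le_lt_trans PiD; apply: le_measure; rewrite ?inE//; exact: subIsetl.
have JB n i : jump_intensity Pi (B n i) = (t%:E * Pi (C n i))%E.
  by rewrite jump_intensity_rect.
have JBoo n i : (jump_intensity Pi (B n i) < +oo)%E.
  by rewrite JB lte_mul_pinfty// ?lee_fin.
have mnu n i : measurable_fun setT (fun w => nu w (B n i)).
  exact: measurable_kernel.
have mS n : measurable_fun setT (S n).
  by apply: measurable_sum => i; apply: measurable_funM => //; exact: measurableT_comp.
have msnd : measurable_fun (`[0, t] `*` D : set (R * R)) (snd : R * R -> R).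
  by apply: measurable_funTS.
have SE n : sqmod P (S n) =
    expR (- (2 * t * \int[Pi]_(u in D) stepf (g n) (fun i => 1 - cos (z * g n i)) n u)).
  have := @sqmod_sum _ _ _ _ _ P n (fun i w => nu w (B n i))
    (fun i x => z * g n i * fine x) _ _ _.
  rewrite -[sqmod P _]/(sqmod P (S n)) => ->; first last.
  - apply: (prm_independent Hnu) => //.
    apply/trivIsetP => i j _ _ ij; apply/seteqP; split => // -[s u] /=.
    rewrite /B /C /= => -[[_ [_]]]; rewrite !in_itv/= => ui [_ [_ uj]].
    by case/eqP: ij; apply/val_inj; exact: (grid_cell_uniq (grid_mono n KK) ui uj).
  - by move=> i; apply: measurable_funM.
  - by move=> i.
  have PiCE i : \int[Pi]_(u in D) (\1_(`[g n i, g n i.+1[) u : R) = fine (Pi (C n i)).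
    by rewrite /Rintegral integral_indic//= setIC.
  transitivity (\prod_(i < n) expR (- (2 * (t * fine (Pi (C n i))) * (1 - cos (z * g n i))))).
    apply: eq_bigr => i _; rewrite -(@sqmod_poisson _ _ _ P (fun w => nu w (B n i))) //.
    - by rewrite mulr_ge0.
    - move=> k; rewrite (prm_poisson Hnu)// JB fineM ?ge0_fin_numE//; exact: ltry.
  rewrite -(big_morph expR (@expRD R) (@expR0 R)); congr expR; rewrite sumrN; congr (- _).
  have i1 (i : nat) : Pi.-integrable D (EFin \o (\1_(`[g n i, g n i.+1[) : R -> R)).
    exact: integrable_indic_on.
  rewrite Rintegral_sum//; last by move=> i; exact: integrable_scale.
  rewrite mulr_sumr; apply: eq_bigr => i _.
  by rewrite RintegralZl// PiCE; ring.
have L1 : sqmod P (S n.+1) @[n --> \oo] -->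
    sqmod P (fun w => z * \int[nu w]_(x in (`[0, t] `*` D : set (R * R))) x.2).
  apply: cvg_sqmod => //.
    by apply: measurable_funM => //; exact: measurable_kernel_Rintegral (meas_rect mD) msnd.
  have := prm_rect_ae_fin; apply: filterS => w [N nuN].
  have nuoo : (nu w (`[0%R, t] `*` D : set (R * R)) < +oo)%E by rewrite nuN ltry.
  have -> : (fun n => S n.+1 w) =
      (fun n => z * \int[nu w]_(x in (`[0, t] `*` D : set (R * R)))
        stepf (g n.+1) (g n.+1) n.+1 x.2).
    apply/funext => n; rewrite /stepf.
    have msC i : measurable (snd @^-1` `[g n.+1 i, g n.+1 i.+1[ : set (R * R)).
      by rewrite -[X in measurable X]setTI; exact: measurable_snd.
    have i1 (i : nat) : (nu w).-integrable (`[0%R, t] `*` D : set (R * R))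
        (EFin \o (fun x => \1_(`[g n.+1 i, g n.+1 i.+1[) x.2 : R)).
      exact: (integrable_indic_on (meas_rect mD) nuoo (msC i)).
    rewrite Rintegral_sum//; first last.
    - by move=> i; apply: integrable_scale => //; exact: meas_rect.
    - exact: meas_rect.
    rewrite mulr_sumr; apply: eq_bigr => i _.
    rewrite RintegralZl//; last exact: meas_rect.
    rewrite mulrA; congr (_ * _).
    rewrite /Rintegral (integral_indic (nu w) (meas_rect mD) (msC i)).
    congr (fine (nu w _)); apply/seteqP; split => [[s u] /= [? []]//|[s u] /= []? []//].
  apply: cvgM; first exact: cvg_cst.
  apply: (@cvg_Rintegral_bounded _ _ _ _ _ (3 * K)) => //.
  - exact: meas_rect.
  - move=> n; apply: measurable_funTS; apply: measurableT_comp => //.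
    exact: measurable_stepf.
  - by move=> n [s u] [_ /= Du]; apply: norm_stepf_approx => //; exact: DK.
  - by move=> [s u] [_ /= Du]; apply: cvg_stepf_approx; exact: DK.
have L2 : sqmod P (S n.+1) @[n --> \oo] -->
    expR (- (2 * t * \int[Pi]_(u in D) (1 - cos (z * u)))).
  under eq_cvg do rewrite SE.
  suff H : - (2 * t * \int[Pi]_(u in D)
        stepf (g n.+1) (fun i => 1 - cos (z * g n.+1 i)) n.+1 u) @[n --> \oo] -->
      - (2 * t * \int[Pi]_(u in D) (1 - cos (z * u))).
    exact: (cvg_comp _ _ H (@continuous_expR R _)).
  apply: cvgN; apply: cvgM; first exact: cvg_cst.
  apply: (@cvg_Rintegral_bounded _ _ _ _ _ 2) => //.
  - by move=> n; apply: measurable_funTS; exact: measurable_stepf.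
  - move=> n u Du; rewrite (@stepf_comp _ _ _ (fun y => 1 - cos (z * y)))//; last exact: DK.
    rewrite (le_trans (ler_normB _ _))// normr1 (_ : 2 = 1 + 1)// lerD2l.
    exact: cos_max.
  - move=> u Du; have uK := DK _ Du.
    under eq_cvg do rewrite (@stepf_comp _ _ _ (fun y => 1 - cos (z * y)))//.
    apply: cvgB; first exact: cvg_cst.
    suff H : z * stepf (g n.+1) (g n.+1) n.+1 u @[n --> \oo] --> z * u.
      exact: (cvg_comp _ _ H (@continuous_cos R _)).
    by apply: cvgM; [exact: cvg_cst|exact: cvg_stepf_approx].
exact: (cvg_unique _ L1 L2).
Qed.

End prm.

(** Cosine and sine are 1-Lipschitz, so each mean moves by at most [2 * e], its square by at most
    twice as much, and there are two squares. *)
Lemma sqmod_L2_dist d (T : measurableType d) (R : realType) (P : probability T R)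
    (Y Y' : T -> R) (e : R) :
  measurable_fun setT Y -> measurable_fun setT Y' -> 0 < e ->
  (\int[P]_w ((Y w - Y' w) ^+ 2)%:E <= (e ^+ 2)%:E)%E ->
  `|sqmod P Y - sqmod P Y'| <= 8 * e.
Proof.
move=> mY mY' e0 L2.
have mD : measurable_fun setT (fun w => (Y w - Y' w) ^+ 2).
  by apply: measurable_funX; exact: measurable_funB.
have iD : P.-integrable setT (EFin \o (fun w => (Y w - Y' w) ^+ 2)).
  apply/integrableP; split; first exact/measurable_EFinP.
  apply: (@le_lt_trans _ _ ((e ^+ 2)%:E)); last exact: ltry.
  apply: le_trans L2; apply: ge0_le_integral => //=.
  - by apply/measurable_EFinP; apply: measurableT_comp.
  - exact/measurable_EFinP.
  - by move=> w _; rewrite lee_fin ger0_norm// sqr_ge0.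
have v_le : \int[P]_w ((Y w - Y' w) ^+ 2) <= e ^+ 2.
  by rewrite -lee_fin /Rintegral fineK// integrable_fin_num.
have main (trig : R -> R) : measurable_fun setT trig -> (forall x, `|trig x| <= 1) ->
    (forall x y, `|trig x - trig y| <= `|x - y|) ->
    `|(\int[P]_w trig (Y w)) ^+ 2 - (\int[P]_w trig (Y' w)) ^+ 2| <= 4 * e.
  move=> mtrig trig1 triglip.
  have mtY : measurable_fun setT (fun w => trig (Y w)) by exact: measurableT_comp.
  have mtY' : measurable_fun setT (fun w => trig (Y' w)) by exact: measurableT_comp.
  have itY : P.-integrable setT (EFin \o (fun w => trig (Y w))).
    by apply: (@bounded_integrable _ _ _ _ 1).
  have itY' : P.-integrable setT (EFin \o (fun w => trig (Y' w))).
    by apply: (@bounded_integrable _ _ _ _ 1).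
  rewrite subr_sqr normrM (_ : 4 * e = 2 * e * 2); last by ring.
  apply: ler_pM => //; last first.
    rewrite (le_trans (ler_normD _ _))// (_ : 2 = 1 + 1)//.
    by apply: lerD; apply: le_norm_Rexp.
  rewrite -RintegralB//.
  rewrite (le_trans (le_normr_Rintegral _ _))//.
    by apply: eq_integrable (integrableB measurableT itY itY').
  have i1 : P.-integrable setT (EFin \o cst e).
    by apply: (@bounded_integrable _ _ _ _ `|e|).
  have i2 : P.-integrable setT (EFin \o (fun w => e^-1 * (Y w - Y' w) ^+ 2)).
    exact: integrable_scale.
  (* The inequality [|D| <= e + D^2 / e] replaces Cauchy-Schwarz; it costs a factor 2. *)
  apply: (@le_trans _ _ (\int[P]_w (cst e w + e^-1 * (Y w - Y' w) ^+ 2))).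
    apply: le_Rintegral => //.
    - apply: eq_integrable (integrable_abse (integrableB measurableT itY itY')) => //.
    - by apply: eq_integrable (integrableD measurableT i1 i2).
    move=> w _; rewrite (le_trans (triglip _ _))//=.
    set D := Y w - Y' w; rewrite -(ler_pM2l e0) mulrDr mulVKf ?gt_eqF//.
    rewrite -(real_normK (num_real D)).
    have := normr_ge0 D; have := sqr_ge0 (e - `|D|); nra.
  rewrite RintegralD// Rexp_cst RintegralZl// mulr_natl mulr2n lerD2l.
  by rewrite mulrC ler_pdivrMr// -expr2.
rewrite /sqmod (_ : 8 * e = 4 * e + 4 * e); last by ring.
rewrite opprD addrACA (le_trans (ler_normD _ _))//; apply: lerD; apply: main.
- by apply: continuous_measurable_fun; exact: continuous_cos.
- exact: cos_max.
- exact: cosB_le.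
- by apply: continuous_measurable_fun; exact: continuous_sin.
- exact: sin_max.
- exact: sinB_le.
Qed.

(** Both sequences move with [n]: in [sqmod_levy] they share the truncated large jumps and differ in
    the small ones only. *)
Lemma cvg_sqmod_L2 d (T : measurableType d) (R : realType) (P : probability T R)
    (Y_ Y'_ : nat -> T -> R) :
  (forall n, measurable_fun setT (Y_ n)) -> (forall n, measurable_fun setT (Y'_ n)) ->
  (\int[P]_w ((Y_ n w - Y'_ n w) ^+ 2)%:E)%E @[n --> \oo] --> 0%E ->
  sqmod P (Y_ n) - sqmod P (Y'_ n) @[n --> \oo] --> (0 : R).
Proof.
move=> mY mY' L2; apply/cvgrPdist_le => e e0.
have e8 : 0 < e / 8 by rewrite divr_gt0.
have /fine_cvgP[finV /cvgrPdist_le V0] := L2.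
near=> n; rewrite sub0r normrN.
rewrite [leRHS](_ : e = 8 * (e / 8)); last by field.
apply: sqmod_L2_dist => //.
rewrite -[leLHS]fineK; last by near: n; exact: finV.
rewrite lee_fin.
have : `|0 - fine (\int[P]_w ((Y_ n w - Y'_ n w) ^+ 2)%:E)%E| <= (e / 8) ^+ 2.
  by near: n; apply: V0; rewrite exprn_gt0.
by rewrite sub0r normrN => /(le_trans (ler_norm _)).
Unshelve. all: by end_near. Qed.

(** * The driving process *)

Section levy_measure.
Context (R : realType) (Pi : {measure set R -> \bar R}).
Hypothesis HPi : is_levy_measure Pi.

(* The real part of the characteristic exponent, with opposite sign. *)
Definition levy_exp (z : R) : R := \int[Pi]_u (1 - cos (z * u)).

Lemma onemcos_ge0 (x : R) : 0 <= 1 - cos x.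
Proof. by rewrite subr_ge0 cos_le1. Qed.

Lemma onemcos_le_min (x : R) : 1 - cos x <= 2 * Num.min (x ^+ 2) 1.
Proof.
rewrite minr_pMr// mulr1 le_min; apply/andP; split; last first.
  by rewrite lerBlDl -lerBlDr (_ : 1 - 2 = -1) ?cos_geN1//; ring.
apply: le_trans (onemcos_le x) _; rewrite mulrC ler_wpM2r ?sqr_ge0//.
by rewrite invf_ple ?posrE// (le_trans (y := 1))// ?invf_le1// ler1n.
Qed.

Lemma min_sqrM (c x : R) :
  Num.min ((c * x) ^+ 2) 1 <= Num.max (c ^+ 2) 1 * Num.min (x ^+ 2) 1.
Proof.
set m := Num.max _ _.
have m1 : 1 <= m by rewrite le_max lexx orbT.
have mc : c ^+ 2 <= m by rewrite le_max lexx.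
rewrite minr_pMr ?(le_trans ler01)// le_min exprMn mulr1; apply/andP; split.
  by rewrite ge_min ler_wpM2r// sqr_ge0.
by rewrite ge_min m1 orbT.
Qed.

Lemma measurable_min_sqr (c r : R) :
  measurable_fun setT (fun u : R => Num.min ((c * u) ^+ 2) r).
Proof.
apply: measurable_minr => //; apply: measurable_funX.
exact: measurable_funM.
Qed.

Lemma min_sqr_ge0 (x : R) : 0 <= Num.min (x ^+ 2) 1.
Proof. by rewrite le_min sqr_ge0 ler01. Qed.

Lemma integrable_levy_min (c : R) :
  Pi.-integrable setT (EFin \o (fun u => Num.min ((c * u) ^+ 2) 1)).
Proof.
have i1 : Pi.-integrable setT (EFin \o (fun u => Num.min (u ^+ 2) 1)).
  apply/integrableP; split.
    apply/measurable_EFinP; have := measurable_min_sqr 1 1.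
    by under eq_fun do rewrite mul1r.
  have [_] := HPi; apply: le_lt_trans.
  by under eq_integral do rewrite /= ger0_norm ?min_sqr_ge0//.
have i2 := integrable_scale (Num.max (c ^+ 2) 1) measurableT i1.
apply: le_integrable i2 => //.
  by apply/measurable_EFinP; exact: measurable_min_sqr.
move=> u _ /=; rewrite lee_fin !ger0_norm ?min_sqr_ge0//; last first.
  by rewrite mulr_ge0 ?min_sqr_ge0// le_max ler01 orbT.
exact: min_sqrM.
Qed.

Lemma integrable_levy_exp (z : R) :
  Pi.-integrable setT (EFin \o (fun u => 1 - cos (z * u))).
Proof.
have i2 := integrable_scale 2 measurableT (integrable_levy_min z).
apply: le_integrable i2 => //.
  apply/measurable_EFinP; apply: measurable_funB => //.
  apply: measurable_cosT; exact: measurable_funM.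
move=> u _ /=; rewrite lee_fin !ger0_norm ?onemcos_ge0 ?onemcos_le_min//.
by rewrite mulr_ge0// min_sqr_ge0.
Qed.

Lemma measurable_norm_gt (e : R) : measurable [set u : R | e < `|u|].
Proof.
rewrite -[X in measurable X]setTI.
have -> : [set u : R | e < `|u|] = (fun u : R => `|u|) @^-1` `]e, +oo[.
  by apply/seteqP; split => u /=; rewrite in_itv/= andbT.
by apply: normr_measurable.
Qed.

(** Chebyshev's inequality: on [D] the integrable function [min (u^2) 1] is at least the positive
    constant [c]. *)
Lemma levy_tail_fin (e : R) (D : set R) : 0 < e -> measurable D ->
  D `<=` [set u | e < `|u|] -> (Pi D < +oo)%E.
Proof.
move=> e0 mD De; pose c := Num.min (e ^+ 2) 1.
have c0 : 0 < c by rewrite lt_min exprn_gt0// ltr01.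
have : (c%:E * Pi D < +oo)%E.
  rewrite -integral_cst//; have [_] := HPi; apply: le_lt_trans.
  apply: (@le_trans _ _ (\int[Pi]_(u in D) (Num.min (u ^+ 2) 1)%:E)%E).
    apply: ge0_le_integral => //.
    - by move=> u _; rewrite lee_fin ltW.
    - apply: measurable_funTS; apply/measurable_EFinP.
      by have := measurable_min_sqr 1 1; under eq_fun do rewrite mul1r.
    - move=> u /De/= eu; rewrite lee_fin /c le_min !ge_min lexx orbT andbT.
      apply/orP; left.
      by rewrite -(real_normK (num_real u)) lerXn2r ?nnegrE// ltW.
  apply: ge0_subset_integral => //.
    by have := measurable_min_sqr 1 1; under eq_fun do rewrite mul1r; move/measurable_EFinP.
  by move=> u _; rewrite lee_fin min_sqr_ge0.
have := measure_ge0 Pi D; case: (Pi D) => [r _ _|_|//]; first exact: ltry.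
by rewrite gt0_muley.
Qed.

End levy_measure.

(** A window is bounded and stays away from 0, so its jumps are bounded and a Lévy measure gives it
    finite mass, as [sqmod_prm_integral] asks. The windows exhaust the nonzero reals. *)
Definition jump_window (R : realType) (n : nat) : set R :=
  [set u | n.+1%:R^-1 < `|u| <= n.+1%:R].

Lemma measurable_norm_itv (R : realType) (a b : R) :
  measurable [set u : R | a < `|u| <= b].
Proof.
have -> : [set u : R | a < `|u| <= b] =
    [set u : R | a < `|u|] `&` ~` [set u : R | b < `|u|].
  apply/seteqP; split => u /=; first by move=> /andP[-> ub]; split => //; rewrite ltNge ub.
  by move=> [-> /negP]; rewrite -leNgt.
by apply: measurableI; [|apply: measurableC]; exact: measurable_norm_gt.
Qed.

Lemma cvg_levy_exp_window (R : realType) (Pi : {measure set R -> \bar R}) (z : R) :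
  is_levy_measure Pi ->
  \int[Pi]_(u in (jump_window n : set R)) (1 - cos (z * u)) @[n --> \oo] --> levy_exp Pi z.
Proof.
move=> HPi; rewrite /levy_exp.
have mD n : measurable ((jump_window n : set R)) by exact: measurable_norm_itv.
have mf : measurable_fun setT (fun u : R => 1 - cos (z * u)).
  by apply: measurable_funB => //; apply: measurable_cosT; exact: measurable_funM.
under eq_cvg do rewrite Rintegral_mkcond.
have [||||| fint _ H] := @dominated_convergence _ _ _ Pi _ measurableT
  (fun n => EFin \o ((fun u : R => 1 - cos (z * u)) \_ ((jump_window n : set R))))
  (EFin \o (fun u => 1 - cos (z * u))) (EFin \o (fun u => 1 - cos (z * u))).
- by move=> n; apply/measurable_EFinP; exact/(measurable_restrictT _ _).1/measurable_funTS.
- exact/measurable_EFinP.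
- apply: aeW => u _; apply/fine_cvgP; split; first exact: nearW.
  apply: cvg_near_cst; have [->|u0] := eqVneq u 0.
    (* No window contains 0, but the integrand vanishes there. *)
    by apply: nearW => n /=; rewrite patchE; case: ifP => //; rewrite mulr0 cos0 subrr.
  near=> n; rewrite /= patchE mem_set// /jump_window /=; apply/andP; split.
    near: n; have u_gt0 : 0 < `|u| by rewrite normr_gt0.
    exact: (near_infty_natSinv_lt (PosNum u_gt0)).
  rewrite (@le_trans _ _ n%:R)// ?ler_nat//.
  by near: n; exact: nbhs_infty_ger.
- exact: integrable_levy_exp.
- apply: aeW => u n _ /=; rewrite lee_fin patchE; case: ifPn => _.
    by rewrite ger0_norm ?onemcos_ge0.
  by rewrite normr0 onemcos_ge0.
by apply: fine_cvg; rewrite fineK// integrable_fin_num.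
Unshelve. all: by end_near. Qed.

(** No integrability of the large jumps is available for domination. Instead, the counts of jumps
    beyond [n.+1] are integers decreasing to 0, hence 0 from some [n] on, and the sequence of
    integrals is eventually constant. *)
Lemma cvg_big_jumps (R : realType) (mu : {measure set (R * R) -> \bar R}) (t : R) :
  (forall n : nat, exists k : nat,
     mu (`[0%R, t] `*` [set u : R | n.+1%:R < `|u|] : set (R * R)) = k%:R%:E) ->
  \int[mu]_(x in (`[0, t] `*` [set u : R | 1 < `|u| <= n.+1%:R] : set (R * R))) x.2
    @[n --> \oo] -->
  \int[mu]_(x in (`[0, t] `*` [set u : R | 1 < `|u|] : set (R * R))) x.2.
Proof.
move=> muN.
pose S n : set (R * R) := `[0, t] `*` [set u : R | n.+1%:R < `|u|].
have mS n : measurable (S n).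
  by apply: measurableX => //; exact: measurable_norm_gt.
have S0oo : (mu (S 0%N) < +oo)%E by have [k ->] := muN 0%N; exact: ltry.
have S_cap : \bigcap_n S n = set0.
  apply/seteqP; split => // -[s u] H.
  have [] := H (Num.truncn `|u|) I => /= _.
  by rewrite ltNge => /negP; apply; rewrite ltW// truncnS_gt.
have muS : mu (S n) @[n --> \oo] --> 0%E.
  rewrite -(measure0 mu) -S_cap; apply: nonincreasing_cvg_mu => //.
    by rewrite S_cap.
  move=> m n mn; apply/subsetPset => -[s u] [/= st nu]; split => //=.
  by apply: le_lt_trans nu; rewrite ler_nat.
have [N _ NS] : \forall n \near \oo, mu (S n) = 0%E.
  have /fine_cvgP[_ /cvgrPdist_lt/(_ 1 ltr01)] := muS; apply: filterS => n /=.
  have [k] := muN n; rewrite -/(S n) => ->/=; rewrite sub0r normrN ger0_norm//.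
  by rewrite (ltr_nat _ k 1) ltnS leqn0 => /eqP ->.
apply: cvg_near_cst; exists N => // n /NS Sn0.
have mB : measurable (`[0, t] `*` [set u : R | 1 < `|u| <= n.+1%:R] : set (R * R)).
  by apply: measurableX => //; exact: measurable_norm_itv.
set B : set (R * R) := (X in Rintegral _ X _) in mB *.
have -> : B = S 0%N `&` B.
  apply/seteqP; split => [[s u] [/= st /andP[u1 un]]|[s u] []//].
  by split; split => //=; apply/andP.
rewrite Rintegral_mkcondr; rewrite /Rintegral; congr fine.
have msnd : measurable_fun setT (snd : R * R -> R) by exact: measurable_snd.
apply: ae_eq_integral => //.
- apply/measurable_EFinP; apply: measurable_funTS.
  by apply/(measurable_restrictT _ _).1 => //; exact: measurable_funTS.
- by apply/measurable_EFinP; exact: measurable_funTS.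
- exists (S n); split => // -[s u] /= /not_implyP[[st u1]] H.
  split => //=; rewrite ltNge; apply/negP => un; apply: H.
  by rewrite patchE mem_set//; split => //=; rewrite u1.
Qed.

Lemma cvg_natSinv_right (R : realType) : n.+1%:R^-1 @[n --> \oo] --> (0 : R)^'+.
Proof.
move=> A [e /= e0 eA].
have : \forall n \near \oo, n.+1%:R^-1 < e by exact: (near_infty_natSinv_lt (PosNum e0)).
apply: filterS => n ne; apply: eA => /=; last by rewrite invr_gt0.
by rewrite sub0r normrN ger0_norm ?invr_ge0.
Qed.

Section levy_process_transform.
Context d (T : measurableType d) (R : realType) (P : probability T R)
  (Pi : {measure set R -> \bar R}) (nu : R.-ker T ~> (R * R)%type)
  (a : R) (Z : R -> {RV P >-> R}).
Hypothesis HPi : is_levy_measure Pi.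
Hypothesis Hnu : is_poisson_random_measure P (jump_intensity Pi) nu.
Hypothesis HZ : has_jump_representation P Pi nu a Z.

(** Truncating the large jumps converges almost surely, whereas the compensated small jumps converge
    only in L^2; the two replacements are therefore made one after the other. What remains is, up to
    a constant, the uncompensated integral over [jump_window n], whose transform is known. *)
Lemma sqmod_levy (t z : R) : 0 <= t ->
  sqmod P (fun w => z * Z t w) = expR (- (2 * t * levy_exp Pi z)).
Proof.
move=> t0; have [J [HJ ZE]] := HZ t0.
pose big w := \int[nu w]_(x in (`[0, t] `*` [set u : R | 1 < `|u|] : set (R * R))) x.2.
pose Bn n : set (R * R) := `[0, t] `*` [set u : R | 1 < `|u| <= n.+1%:R].
pose Sn n : set (R * R) := `[0, t] `*` [set u : R | n.+1%:R^-1 < `|u| <= 1].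
pose bign n w := \int[nu w]_(x in Bn n) x.2.
pose tc n w := truncated_compensated_jumps Pi nu t n.+1%:R^-1 w.
pose W n w := \int[nu w]_(x in (`[0, t] `*` jump_window n : set (R * R))) x.2.
have mW0 n : measurable (jump_window n : set R) by exact: measurable_norm_itv.
have msnd D : measurable_fun D (snd : R * R -> R).
  by apply: measurable_funTS; exact: measurable_snd.
have mBn n : measurable (Bn n) by apply: measurableX => //; exact: measurable_norm_itv.
have mSn n : measurable (Sn n) by apply: measurableX => //; exact: measurable_norm_itv.
have mbig : measurable_fun setT big.
  apply: measurable_kernel_Rintegral => //; apply: measurableX => //.
  exact: measurable_norm_gt.
have mbign n : measurable_fun setT (bign n) by exact: measurable_kernel_Rintegral.
have mW n : measurable_fun setT (W n).
  by apply: measurable_kernel_Rintegral => //; exact: measurableX.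
have mtc n : measurable_fun setT (tc n).
  apply: measurable_funB; last exact: measurable_cst.
  exact: (@measurable_kernel_Rintegral _ _ _ _ _ nu (Sn n) snd (mSn n) (msnd _)).
have mJ : measurable_fun setT J by [].
have PiW n : (Pi (jump_window n) < +oo)%E.
  apply: (@levy_tail_fin _ _ HPi n.+1%:R^-1) => //.
  by move=> u /= /andP[].
have sW n : sqmod P (fun w => z * W n w) =
    expR (- (2 * t * \int[Pi]_(u in jump_window n) (1 - cos (z * u)))).
  apply: (@sqmod_prm_integral _ _ _ _ _ _ Hnu _ _ _ _ _ (n.+1%:R + 1)) => //.
  by move=> u /= /andP[_ un]; rewrite (le_lt_trans un)// ltrDl.
have limW : sqmod P (fun w => z * W n w) @[n --> \oo] -->
    expR (- (2 * t * levy_exp Pi z)).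
  under eq_cvg do rewrite sW.
  suff H : - (2 * t * \int[Pi]_(u in jump_window n) (1 - cos (z * u))) @[n --> \oo] -->
      - (2 * t * levy_exp Pi z).
    exact: (cvg_comp _ _ H (@continuous_expR R _)).
  apply: cvgN; apply: cvgM; first exact: cvg_cst.
  exact: cvg_levy_exp_window.
have natB : {ae P, forall w, forall n : nat, exists k : nat,
    nu w (`[0%R, t] `*` [set u : R | n.+1%:R < `|u|] : set (R * R)) = k%:R%:E}.
  apply/ae_foralln => n; apply: (prm_rect_ae_fin Hnu) => //.
    exact: measurable_norm_gt.
  by apply: (@levy_tail_fin _ _ HPi n.+1%:R) => //; exact: measurable_norm_gt.
have natW : {ae P, forall w, forall n : nat, exists k : nat,
    nu w (`[0%R, t] `*` jump_window n : set (R * R)) = k%:R%:E}.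
  by apply/ae_foralln => n; exact: (prm_rect_ae_fin Hnu).
have step1 : sqmod P (fun w => z * (a * t + bign n w + J w)) @[n --> \oo] -->
    sqmod P (fun w => z * Z t w).
  apply: cvg_sqmod.
  - move=> n; apply: measurable_funM => //; apply: measurable_funD => //.
    exact: measurable_funD.
  - exact: measurable_funM.
  apply: filterS2 ZE natB => w -> nB.
  apply: cvgM; first exact: cvg_cst.
  apply: cvgD; last exact: cvg_cst.
  apply: cvgD; first exact: cvg_cst.
  exact: cvg_big_jumps.
have step2 : sqmod P (fun w => z * (a * t + bign n w + tc n w)) -
    sqmod P (fun w => z * (a * t + bign n w + J w)) @[n --> \oo] --> (0 : R).
  apply: cvg_sqmod_L2.
  - move=> n; apply: measurable_funM => //; apply: measurable_funD => //.
    exact: measurable_funD.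
  - move=> n; apply: measurable_funM => //; apply: measurable_funD => //.
    exact: measurable_funD.
  have H : (\int[P]_w ((tc n w - J w) ^+ 2)%:E)%E @[n --> \oo] --> 0%E.
    move: HJ; rewrite /is_compensated_small_jumps unlock => HJ.
    exact: (cvg_comp _ _ (@cvg_natSinv_right R) HJ).
  have -> : (fun n => \int[P]_w ((z * (a * t + bign n w + tc n w) -
      z * (a * t + bign n w + J w)) ^+ 2)%:E)%E =
    (fun n => (z ^+ 2)%:E * \int[P]_w ((tc n w - J w) ^+ 2)%:E)%E.
    apply/funext => n; rewrite -ge0_integralZl//.
    - by apply: eq_integral => w _; rewrite -EFinM; congr EFin; ring.
    - by apply/measurable_EFinP; apply: measurable_funX; exact: measurable_funB.
    - by move=> w _; rewrite lee_fin sqr_ge0.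
    - by rewrite lee_fin sqr_ge0.
  rewrite -[X in _ --> X](mule0 (z ^+ 2)%:E).
  by apply: cvgeZl.
have step3 n : sqmod P (fun w => z * (a * t + bign n w + tc n w)) =
    sqmod P (fun w => z * W n w).
  (* The compensator does not depend on [w]: together with the drift it is a constant shift,
     invisible to [sqmod]. *)
  pose c := \int[@lebesgue_measure R]_(s in `[0, t])
    (\int[Pi]_(u in [set u : R | n.+1%:R^-1 < `|u| <= 1]) u).
  rewrite -(@sqmod_shift _ _ _ _ (z * (a * t - c)) (fun w => z * W n w)); last first.
    exact: measurable_funM.
  apply: ae_eq_sqmod.
  - apply: measurable_funM => //; apply: measurable_funD => //.
    exact: measurable_funD.
  - by apply: measurable_funD => //; exact: measurable_funM.
  move: natW; apply: filterS => w /(_ n) [k nW].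
  have WBS : (`[0, t] `*` jump_window n : set (R * R)) = Bn n `|` Sn n.
    apply/seteqP; split => [[s u] [/= st /andP[nu' un]]|[s u] /= [] [] /= st /andP[u1 un]].
    - have [u1|u1] := ltP 1 `|u|; [left|right]; split => //=; first by rewrite u1.
      by rewrite nu'.
    - split => //; apply/andP; split => //; apply: le_lt_trans u1.
      by rewrite invf_le1// ler1n.
    - by split => //; apply/andP; split => //; rewrite (le_trans un)// ler1n.
  have BS : [disjoint Bn n & Sn n].
    apply/disj_setPS => -[s u] [[/= _ /andP[u1 _]] [/= _ /andP[_]]].
    by rewrite leNgt u1.
  have iW : (nu w).-integrable (Bn n `|` Sn n) (EFin \o snd).
    rewrite -WBS; apply: (@bounded_integrable_on _ _ _ _ _ n.+1%:R) => //.
    - exact: measurableX.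
    - by rewrite nW; exact: ltry.
    - by move=> [s u] /= [_ /andP[]].
  have -> : W n w = bign n w + \int[nu w]_(x in Sn n) x.2.
    by rewrite /W WBS Rintegral_setU.
  rewrite -mulrDr; congr (_ * _).
  rewrite /tc /truncated_compensated_jumps -/(Sn n) -/c; ring.
have L : sqmod P (fun w => z * W n w) @[n --> \oo] --> sqmod P (fun w => z * Z t w).
  have E n : sqmod P (fun w => z * W n w) =
      (sqmod P (fun w => z * (a * t + bign n w + tc n w)) -
       sqmod P (fun w => z * (a * t + bign n w + J w))) +
      sqmod P (fun w => z * (a * t + bign n w + J w)).
    by rewrite subrK step3.
  under eq_cvg do rewrite E.
  have := cvgD step2 step1; rewrite add0r; exact.
exact: (cvg_unique _ L limW).
Qed.

End levy_process_transform.

(** * The solution as a limit of weighted increments of the driving process *)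

Section real_integrals.
Context (R : realType).
Notation leb := (@lebesgue_measure R).

Lemma FTC_itv (f F : R -> R) (a b : R) : a <= b -> continuous f ->
  (forall x : R, is_derive x 1 F (f x)) ->
  \int[leb]_(x in `[a, b]) f x = F b - F a.
Proof.
rewrite le_eqVlt => /predU1P[<-|ab] cf dF.
  by rewrite set_itv1 Rintegral_set1 subrr.
have cF : continuous F.
  by move=> x; apply/differentiable_continuous/derivable1_diffP; have [] := dF x.
rewrite /Rintegral (@continuous_FTC2 _ f F)//.
- exact: continuous_subspaceT.
- split.
  + by move=> x _; have [] := dF x.
  + exact/cvg_at_right_filter/cF.
  + exact/cvg_at_left_filter/cF.
- by move=> x _; rewrite derive1E; have [_ ->] := dF x.
Qed.

Lemma integrable_continuous_itv (f : R -> R) (a b : R) : continuous f ->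
  leb.-integrable `[a, b] (EFin \o f).
Proof.
move=> cf; apply: continuous_compact_integrable; first exact: segment_compact.
exact: continuous_subspaceT.
Qed.

Lemma lebesgue_itv_co_fin (a b : R) : (leb `[a, b[%classic < +oo)%E.
Proof.
by rewrite lebesgue_measure_itv/=; case: ifP => // _; rewrite -EFinB ltry.
Qed.

Lemma FTC_itvco (f F : R -> R) (a b : R) : a <= b -> continuous f ->
  (forall x : R, is_derive x 1 F (f x)) ->
  \int[leb]_(x in `[a, b[) f x = F b - F a.
Proof.
move=> ab cf dF; rewrite Rintegral_itv_bndo_bndc; first exact: FTC_itv.
apply: integrableS (integrable_continuous_itv a b cf) => //.
exact: subset_itv_co_cc.
Qed.

Lemma Rintegral_indic_cell (f : R -> R) (a b c e : R) : a <= c -> e <= b ->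
  \int[leb]_(x in `[a, b[) (\1_(`[c, e[) x * f x) = \int[leb]_(x in `[c, e[) f x.
Proof.
move=> ac eb.
transitivity (\int[leb]_(x in `[a, b[) (f \_ `[c, e[) x); first apply: eq_Rintegral.
  by move=> x _; rewrite patchE indicE; case: ifPn => _; rewrite ?mul1r ?mul0r.
rewrite -Rintegral_mkcondr; congr (Rintegral _ _ _).
apply/seteqP; split => x /=; first by case.
rewrite !in_itv/= => /andP[cx xe]; split; last by rewrite cx.
by rewrite (le_trans ac cx) (lt_le_trans xe eb).
Qed.

End real_integrals.

Section grid_limits.
Context (R : realType).
Variables (t s : R).
Hypothesis st : 0 <= s < t.

Let t_gt0 : 0 < t. Proof. by case/andP: st => /le_lt_trans; apply. Qed.

Lemma grid_cell_at n : exists2 i, (i < n.+1)%N &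
  grid 0 t n.+1 i <= s < grid 0 t n.+1 i.+1.
Proof.
apply: grid_cell; first by rewrite grid0; case/andP: st.
by rewrite gridn//; case/andP: st.
Qed.

Lemma cvg_stepf_left (F : R -> R) : {for s, continuous F} ->
  stepf (grid 0 t n.+1) (fun i => F (grid 0 t n.+1 i)) n.+1 s @[n --> \oo] --> F s.
Proof.
move=> cF; apply/cvgrPdist_le => e e0.
have /cvgrPdist_le/(_ e e0)[r /= r0 H] := cF.
have : \forall n \near \oo, n.+1%:R^-1 < r / t :> R.
  by exact: (near_infty_natSinv_lt (PosNum (divr_gt0 r0 t_gt0))).
apply: filterS => n nr.
have [i iltn ix] := grid_cell_at n.
rewrite (stepfE _ (grid_mono _ (ltW t_gt0)) iltn ix); apply: H => /=.
case/andP: ix => ix; rewrite gridS subr0 => xi.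
rewrite ger0_norm ?subr_ge0// ltrBlDl (lt_trans xi)// ltrD2l.
by rewrite mulrC -ltr_pdivlMr.
Qed.

(** Cells are half-open, so the right end of the cell of [s] lies strictly to the right of [s] and
    right continuity is enough; this is what a cadlag path offers. *)
Lemma cvg_stepf_right (F : R -> R) : F x @[x --> s^'+] --> F s ->
  stepf (grid 0 t n.+1) (fun i => F (grid 0 t n.+1 i.+1)) n.+1 s @[n --> \oo] --> F s.
Proof.
move=> cF; apply/cvgrPdist_le => e e0.
have /cvgrPdist_le/(_ e e0)[r /= r0 H] := cF.
have : \forall n \near \oo, n.+1%:R^-1 < r / t :> R.
  by exact: (near_infty_natSinv_lt (PosNum (divr_gt0 r0 t_gt0))).
apply: filterS => n nr.
have [i iltn ix] := grid_cell_at n.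
rewrite (stepfE _ (grid_mono _ (ltW t_gt0)) iltn ix).
case/andP: ix => ix xi; apply: H => //=.
rewrite distrC ger0_norm ?subr_ge0 ?(ltW xi)// ltrBlDl gridS subr0.
rewrite (le_lt_trans (lerD ix (lexx _)))// ltrD2l.
by rewrite mulrC -ltr_pdivlMr.
Qed.

End grid_limits.

(** Summation by parts in the form that samples [x] at the right ends [k.+1], where
    [cvg_stepf_right] applies. *)
Lemma abel_grid (R : realType) (c x : nat -> R) n :
  \sum_(k < n) c k * (x k.+1 - x k) =
  c n * x n - c 0%N * x 0%N + \sum_(k < n) (c k - c k.+1) * x k.+1.
Proof.
elim: n => [|n IHn]; first by rewrite !big_ord0 subrr addr0.
by rewrite !big_ord_recr/= IHn; ring.
Qed.
Lemma is_derive_expRM (R : realType) (c s : R) :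
  is_derive s 1 (fun s => expR (c * s)) (c * expR (c * s)).
Proof.
have d1 : is_derive s 1 (fun s : R => c * s) c.
  by apply: is_derive_eq; rewrite /GRing.scale/= mulr1 ?mul0r ?addr0 ?mulr0 ?add0r.
have d2 : is_derive (c * s) 1 (@expR R) (expR (c * s)) by exact: is_derive_expR.
have := @is_derive1_comp _ expR (fun s => c * s) s _ _ d2 d1.
by rewrite mulrC.
Qed.

Lemma continuous_expRM (R : realType) (c : R) : continuous (fun s : R => expR (c * s)).
Proof.
move=> s; apply/differentiable_continuous/derivable1_diffP.
by have [] := is_derive_expRM c s.
Qed.

Section path.
Context (R : realType).
Notation leb := (@lebesgue_measure R).
Variables (A x0 t : R) (x z : R -> R).
Hypothesis t_gt0 : 0 < t.
Hypothesis mx : measurable_fun (`[0, +oo[ : set R) x.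
Hypothesis bx : [bounded x s | s in `[0, t]].
Hypothesis xE : forall s : R, 0 <= s ->
  x s = x0 + \int[leb]_(r in `[0, s]) (A * x r) + z s.
Hypothesis zr : forall s : R, 0 <= s -> z r @[r --> s^'+] --> z s.

Let Is (s : R) := \int[leb]_(r in `[0, s]) (A * x r).

Let mAx (D : set R) : measurable D -> D `<=` `[0, t] ->
  measurable_fun D (fun r => A * x r).
Proof.
move=> mD D0; apply: measurable_funM => //.
apply: measurable_funS mx => // r /D0; rewrite /= !in_itv/= => /andP[-> _]//.
Qed.

Let xM : exists2 M : R, 0 < M & forall s, 0 <= s <= t -> `|x s| <= M.
Proof.
have [M [_ H]] := bx; exists (`|M| + 1) => [|s st]; first by rewrite ltr_pwDr.
by apply: H; [rewrite (le_lt_trans (ler_norm M))// ltrDl|rewrite /= in_itv].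
Qed.

Let iAx (D : set R) : measurable D -> D `<=` `[0, t] ->
  leb.-integrable D (EFin \o (fun r => A * x r)).
Proof.
move=> mD D0; have [M M0 HM] := xM.
apply: (@bounded_integrable_on _ _ _ _ _ (`|A| * M)) => //.
- apply: (@le_lt_trans _ _ (leb `[0, t]%classic)).
    by apply: le_measure; rewrite ?inE.
  by rewrite lebesgue_measure_itv/=; case: ifP => // _; rewrite -EFinB ltry.
- exact: mAx.
- move=> s /D0; rewrite /= in_itv/= => st.
  by rewrite normrM ler_wpM2l// HM.
Qed.

(** The solution is only known to be measurable and bounded; the equation transfers right continuity
    from [z] to it, the indefinite integral being continuous. *)
Let xr (s : R) : 0 <= s < t -> x r @[r --> s^'+] --> x s.
Proof.
move=> /andP[s0 st].
have Ir : Is r @[r --> s^'+] --> Is s.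
  have /continuous_within_itvP : {within `[0, t], continuous Is}.
    by apply: parameterized_integral_continuous; [exact: ltW|exact: iAx].
  move=> /(_ t_gt0)[Ic I0 _]; move: s0; rewrite le_eqVlt => /predU1P[<-//|s0].
  by apply: cvg_at_right_filter; apply: Ic; rewrite in_itv/= s0.
have H : x0 + Is r + z r @[r --> s^'+] --> x s.
  by rewrite xE//; apply: cvgD; [apply: cvgD => //; exact: cvg_cst|exact: zr].
apply: cvg_trans H; apply: near_eq_cvg.
by near=> r; rewrite xE// (le_trans s0)//; near: r; exact: nbhs_right_ge.
Unshelve. all: by end_near. Qed.

Lemma Is_diff (a b : R) : 0 <= a <= b -> b <= t ->
  Is b - Is a = \int[leb]_(r in `[a, b[) (A * x r).
Proof.
move=> /andP[a0 ab] bt.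
have sub c d : 0 <= c -> d <= t -> `[c, d] `<=` (`[0, t] : set R).
  by move=> c0 dt r /=; rewrite !in_itv/= => /andP[cr rd]; rewrite (le_trans c0)// (le_trans rd).
have i0 : leb.-integrable `[0, b] (EFin \o (fun r => A * x r)).
  by apply: iAx => //; exact: sub.
rewrite /Is (Rintegral_itvB i0) ?bnd_simp//.
rewrite Rintegral_itv_obnd_cbnd ?Rintegral_itv_bndo_bndc//.
- apply: iAx => //; apply: subset_trans (sub _ _ a0 bt).
  exact: subset_itv_co_cc.
- apply: iAx => //; apply: subset_trans (sub _ _ a0 bt).
  exact: subset_itv_oc_cc.
Qed.

(* Summation by parts along the grid turns the sum into [exp (- A t) x t - x 0]
   plus [J2 - J1], two step approximations of the integral of
   [A exp (- A s) x s]. *)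
Lemma cvg_riemann_path :
  \sum_(k < n.+1) expR (- A * grid 0 t n.+1 k) *
     (z (grid 0 t n.+1 k.+1) - z (grid 0 t n.+1 k)) @[n --> \oo] -->
  expR (- A * t) * x t - x 0.
Proof.
pose g n := grid 0 t n.+1.
pose c n k := expR (- A * g n k).
have [M M0 HM] := xM.
have gmono n := grid_mono n.+1 (ltW t_gt0).
have g0 n k : 0 <= g n k by rewrite -(grid0 0 t n.+1); exact: gmono.
have gt n k : (k <= n.+1)%N -> g n k <= t.
  by move=> kn; rewrite -[leRHS](gridn 0 t (ltn0Sn n)); exact: gmono.
have gS n k : g n k <= g n k.+1 by exact: gmono.
pose J1 n := \int[leb]_(s in `[0, t[) (stepf (g n) (c n) n.+1 s * (A * x s)).
pose J2 n := \int[leb]_(s in `[0, t[)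
  (stepf (g n) (fun i => x (g n i.+1)) n.+1 s * (A * expR (- A * s))).
have Ict (s : R) : 0 <= s < t -> 0 <= s <= t by move=> /andP[-> /ltW].
have mexp : measurable_fun setT (fun s : R => expR (- A * s)).
  by apply: measurableT_comp => //; exact: measurable_funM.
have cexp : continuous (fun s : R => expR (- A * s)).
  exact: continuous_expRM.
have [K K0 HK] : exists2 K : R, 0 < K & forall s, 0 <= s <= t -> expR (- A * s) <= K.
  exists (expR (`|A| * t)); first exact: expR_gt0.
  move=> s /andP[s0 st]; rewrite ler_expR (le_trans (ler_norm _))// normrM normrN.
  by rewrite ler_wpM2l// ger0_norm.
have mAxt : measurable_fun (`[0, t[ : set R) (fun s => A * x s).
  by apply: mAx => //; exact: subset_itv_co_cc.
have mxt : measurable_fun (`[0, t[ : set R) x.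
  by apply: measurable_funS mx => // r; rewrite /= !in_itv/= => /andP[->].
have bAx s : 0 <= s < t -> `|A * x s| <= `|A| * M.
  by move=> /Ict st; rewrite normrM ler_wpM2l// HM.
have sumE n : \sum_(k < n.+1) c n k * (z (g n k.+1) - z (g n k)) =
    expR (- A * t) * x t - x 0 + J2 n - J1 n.
  have zE k : (k < n.+1)%N -> z (g n k.+1) - z (g n k) =
      (x (g n k.+1) - x (g n k)) - \int[leb]_(s in `[g n k, g n k.+1[) (A * x s).
    move=> kn; rewrite -Is_diff ?g0 ?gS ?gt//.
    have xE' s : 0 <= s -> x s = x0 + Is s + z s by exact: xE.
    by rewrite (xE' _ (g0 n k.+1)) (xE' _ (g0 n k)); ring.
  transitivity (\sum_(k < n.+1) c n k * (x (g n k.+1) - x (g n k)) -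
      \sum_(k < n.+1) c n k * \int[leb]_(s in `[g n k, g n k.+1[) (A * x s)).
    by rewrite -sumrB; apply: eq_bigr => k _; rewrite zE// mulrBr.
  congr (_ - _).
    rewrite (abel_grid (c n) (fun k => x (g n k))) /c /g grid0 gridn// mulr0 expR0 mul1r.
    congr (_ + _); rewrite /J2 /stepf -/(g n).
    under [RHS]eq_Rintegral do rewrite mulr_suml.
    rewrite [RHS](_ : _ = \int[leb]_(s in `[0, t[) \sum_(i < n.+1) x (g n i.+1) *
        (\1_(`[g n i, g n i.+1[) s * (A * expR (- A * s)))); last first.
      by apply: eq_Rintegral => s _; apply: eq_bigr => i _; rewrite -mulrA.
    have iE i : leb.-integrable `[0, t[ (EFin \o (fun s =>
        \1_(`[g n i, g n i.+1[) s * (A * expR (- A * s)))).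
      apply: (@bounded_integrable_on _ _ _ _ _ (1 * (`|A| * K))) => //.
      - exact: lebesgue_itv_co_fin.
      - apply: measurable_funTS; apply: measurable_funM => //.
        exact: measurable_funM.
      - move=> s; rewrite /= in_itv/= => st; rewrite normrM ler_pM//.
          by rewrite indicE; case: (_ \in _); rewrite ?normr1 ?normr0.
        by rewrite normrM ler_wpM2l// ger0_norm ?expR_ge0// HK// Ict.
    rewrite Rintegral_sum//; last by move=> i; exact: integrable_scale.
    apply: eq_bigr => i _.
    rewrite RintegralZl// Rintegral_indic_cell// ?gt//.
    (* The difference [c n i - c n i.+1] is the integral of [A * expR (- A * s)] over the cell. *)
    have cE : continuous (fun s : R => A * expR (- A * s)).
      by move=> s; apply: cvgM; [exact: cvg_cst|exact: cexp].
    have dE (s : R) : is_derive s 1 (fun s => - expR (- A * s)) (A * expR (- A * s)).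
      have dE := is_derive_expRM (- A) s.
      by apply: is_derive_eq; rewrite mulNr opprK.
    by rewrite (FTC_itvco (gS n i) cE dE) -/(g n); ring.
  rewrite /J1 /stepf.
  under [RHS]eq_Rintegral do rewrite mulr_suml.
  rewrite [RHS](_ : _ = \int[leb]_(s in `[0, t[) \sum_(i < n.+1) c n i *
        (\1_(`[g n i, g n i.+1[) s * (A * x s))); last first.
    by apply: eq_Rintegral => s _; apply: eq_bigr => i _; rewrite -mulrA.
  have iE i : leb.-integrable `[0, t[ (EFin \o (fun s =>
      \1_(`[g n i, g n i.+1[) s * (A * x s))).
    apply: (@bounded_integrable_on _ _ _ _ _ (1 * (`|A| * M))) => //.
    - exact: lebesgue_itv_co_fin.
    - by apply: measurable_funM => //; apply: measurable_funTS.
    - move=> s; rewrite /= in_itv/= => st; rewrite normrM ler_pM//; last exact: bAx.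
      by rewrite indicE; case: (_ \in _); rewrite ?normr1 ?normr0.
  rewrite Rintegral_sum//; last by move=> i; exact: integrable_scale.
  apply: eq_bigr => i _.
  by rewrite [in RHS]RintegralZl// Rintegral_indic_cell// ?gt.
have L1 : J1 n @[n --> \oo] --> \int[leb]_(s in `[0, t[) (expR (- A * s) * (A * x s)).
  apply: (@cvg_Rintegral_bounded _ _ _ _ _ (K * (`|A| * M))) => //.
  - exact: lebesgue_itv_co_fin.
  - move=> n; apply: measurable_funM => //; apply: measurable_funTS.
    exact: measurable_stepf.
  - move=> n s; rewrite /= in_itv/= => st; rewrite normrM ler_pM//; last exact: bAx.
    have [i iltn ix] := grid_cell_at st n.
    rewrite (stepfE _ (gmono n) iltn ix) ger0_norm ?expR_ge0// HK// g0/= gt//.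
    exact: ltnW.
  - move=> s; rewrite /= in_itv/= => st; apply: cvgM; last exact: cvg_cst.
    by apply: (cvg_stepf_left st (F := fun s => expR (- A * s))); exact: cexp.
have L2 : J2 n @[n --> \oo] --> \int[leb]_(s in `[0, t[) (x s * (A * expR (- A * s))).
  apply: (@cvg_Rintegral_bounded _ _ _ _ _ (M * (`|A| * K))) => //.
  - exact: lebesgue_itv_co_fin.
  - move=> n; apply: measurable_funM => //; apply: measurable_funTS.
      exact: measurable_stepf.
    exact: measurable_funM.
  - move=> n s; rewrite /= in_itv/= => st; rewrite normrM ler_pM//.
      have [i iltn ix] := grid_cell_at st n.
      by rewrite (stepfE _ (gmono n) iltn ix) HM// g0/= gt.
    by rewrite normrM ler_wpM2l// ger0_norm ?expR_ge0// HK// Ict.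
  - move=> s; rewrite /= in_itv/= => st; apply: cvgM; last exact: cvg_cst.
    by apply: (cvg_stepf_right st); exact: xr.
have E12 : \int[leb]_(s in `[0, t[) (x s * (A * expR (- A * s))) =
    \int[leb]_(s in `[0, t[) (expR (- A * s) * (A * x s)).
  by apply: eq_Rintegral => s _; ring.
rewrite E12 in L2.
have L : expR (- A * t) * x t - x 0 + J2 n - J1 n @[n --> \oo] -->
    expR (- A * t) * x t - x 0.
  rewrite -[X in _ --> X](addrK (\int[leb]_(s in `[0, t[) (expR (- A * s) * (A * x s)))).
  by apply: cvgB => //; apply: cvgD => //; exact: cvg_cst.
have -> : (fun n => \sum_(k < n.+1) expR (- A * grid 0 t n.+1 k) *
     (z (grid 0 t n.+1 k.+1) - z (grid 0 t n.+1 k))) =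
  (fun n => expR (- A * t) * x t - x 0 + J2 n - J1 n).
  by apply/funext => n; rewrite -sumE.
exact: L.
Qed.

End path.

Section solution.
Context d (T : measurableType d) (R : realType) (P : probability T R).

Lemma eq_law_Rintegral (Y Y' : T -> R) (g : R -> R) :
  measurable_fun setT Y -> measurable_fun setT Y' ->
  (forall B, measurable B -> P (Y @^-1` B) = P (Y' @^-1` B)) ->
  measurable_fun setT g -> (forall x, `|g x| <= 1) ->
  \int[P]_w g (Y w) = \int[P]_w g (Y' w).
Proof.
move=> mY mY' law mg g1.
have igY : forall U : T -> R, measurable_fun setT U ->
    P.-integrable setT ((EFin \o g) \o U).
  move=> U mU; apply: (@bounded_integrable _ _ _ _ 1 (g \o U)) => //.
    exact: measurableT_comp.
  by move=> x; exact: g1.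
have mEg : measurable_fun setT (EFin \o g) by exact/measurable_EFinP.
have push : forall U : T -> R, measurable_fun setT U ->
    (\int[P]_w (g (U w))%:E = \int[pushforward P U]_y (g y)%:E)%E.
  move=> U mU; rewrite (integral_pushforward mU mEg (igY _ mU) measurableT).
  by rewrite preimage_setT.
rewrite /Rintegral (push _ mY) (push _ mY'); congr fine.
by apply: eq_measure_integral => B mB _; exact: law.
Qed.

Lemma eq_law_sqmod (Y Y' : T -> R) (c : R) :
  measurable_fun setT Y -> measurable_fun setT Y' ->
  (forall B, measurable B -> P (Y @^-1` B) = P (Y' @^-1` B)) ->
  sqmod P (fun w => c * Y w) = sqmod P (fun w => c * Y' w).
Proof.
move=> mY mY' law; have mc : measurable_fun setT (fun x : R => c * x).
  exact: measurable_funM.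
rewrite /sqmod; congr (_ ^+ 2 + _ ^+ 2).
- apply: (@eq_law_Rintegral Y Y' (fun x => cos (c * x))) => //.
    exact: measurable_cosT.
  by move=> x; exact: cos_max.
- apply: (@eq_law_Rintegral Y Y' (fun x => sin (c * x))) => //.
    exact: measurable_sinT.
  by move=> x; exact: sin_max.
Qed.

Variables (A x0 : R) (Z X : R -> {RV P >-> R}) (psi : R -> R).
Hypothesis HZ : is_levy_process P Z.
Hypothesis HX : is_linear_sde_solution P A x0 Z X.
Hypothesis Zpsi : forall t z : R, 0 <= t ->
  sqmod P (fun w => z * Z t w) = expR (- (2 * t * psi z)).

(** Independence and stationarity of the increments make the transform of each Riemann-Stieltjes sum
    explicit, and almost sure convergence of the sums carries it over to [X t]. The exponents are
    left as Riemann sums, from which both later bounds are read off. *)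
Lemma sqmod_solution (t z : R) : 0 < t ->
  expR (- (2 * \sum_(k < n.+1) t / n.+1%:R *
    psi (z * expR (A * (t - grid 0 t n.+1 k))))) @[n --> \oo] -->
  sqmod P (fun w => z * X t w).
Proof.
move=> t0; pose g n := grid 0 t n.+1.
pose b n k := z * expR (A * (t - g n k)).
have gmono n := grid_mono n.+1 (ltW t0).
have g0 n k : 0 <= g n k by rewrite -(grid0 0 t n.+1); exact: gmono.
pose S n w := \sum_(k < n.+1) b n k * (Z (g n k.+1) w - Z (g n k) w).
have mZZ (u v : R) : measurable_fun setT (fun w => Z u w - Z v w).
  by apply: measurable_funB.
have mS n : measurable_fun setT (S n).
  by apply: measurable_sum => k; exact: measurable_funM.
have SE n : sqmod P (S n) = expR (- (2 * \sum_(k < n.+1) t / n.+1%:R * psi (b n k))).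
  have := @sqmod_sum _ _ _ _ _ P n.+1 (fun i w => Z (g n i.+1) w - Z (g n i) w)
    (fun i x => b n i * x) _ _ _.
  rewrite -[sqmod P _]/(sqmod P (S n)) => ->; last first.
  - by apply: (levy_independent HZ); [exact: g0|exact: gmono].
  - by move=> i; exact: measurable_funM.
  - by move=> i; exact: mZZ.
  transitivity (\prod_(i < n.+1) expR (- (2 * (t / n.+1%:R) * psi (b n i)))).
    apply: eq_bigr => i _; rewrite -Zpsi ?divr_ge0 ?(ltW t0)//.
    apply: eq_law_sqmod => // B mB.
    have := levy_stationary HZ (g0 n i) (divr_ge0 (ltW t0) (ler0n R n.+1)) mB.
    by rewrite /g gridS subr0.
  rewrite -(big_morph expR (@expRD R) (@expR0 R)) sumrN mulr_sumr.
  by congr (expR (- _)); apply: eq_bigr => i _; ring.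
have L1 : sqmod P (S n) @[n --> \oo] -->
    sqmod P (fun w => z * expR (A * t) * - x0 + z * X t w).
  apply: cvg_sqmod; [exact: mS|by apply: measurable_funD => //; apply: measurable_funM|].
  apply: filterS3 HX (levy_start HZ) (levy_cadlag HZ) => w [mX bX XE] Z0 [Zr _].
  have X0 : X 0 w = x0.
    by rewrite XE// Z0 addr0 set_itv1 Rintegral_set1 addr0.
  have := cvg_riemann_path t0 mX (bX t) XE Zr; rewrite X0.
  move=> /(cvgM (cvg_cst (z * expR (A * t)))) H.
  have -> : z * expR (A * t) * - x0 + z * X t w =
      z * expR (A * t) * (expR (- A * t) * X t w - x0).
    rewrite mulrBr mulrA -[z * _ * expR _]mulrA -expRD mulNr subrr expR0; ring.
  apply: cvg_trans H; apply: near_eq_cvg; apply: nearW => n /=.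
  rewrite /S mulr_sumr; apply: eq_bigr => k _.
  rewrite mulrA /b; congr (_ * _); rewrite -mulrA -expRD; congr (_ * expR _).
  by rewrite /g; ring.
rewrite sqmod_shift in L1; last exact: measurable_funM.
by under eq_cvg do rewrite -SE.
Qed.

End solution.

Section riemann_sum.
Context (R : realType).
Notation leb := (@lebesgue_measure R).

Lemma lebesgue_itv_co (a b : R) : a <= b -> leb `[a, b[%classic = (b - a)%:E.
Proof.
rewrite le_eqVlt => /predU1P[<-|ab].
  by rewrite lebesgue_measure_itv/= ltxx subrr.
by rewrite lebesgue_measure_itv/= lte_fin ab -EFinB.
Qed.

Lemma Rintegral_cst_co (c a b : R) : a <= b ->
  \int[leb]_(s in `[a, b[) c = c * (b - a).
Proof.
move=> ab; rewrite Rintegral_cst//; congr (_ * _).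
exact: (congr1 fine (lebesgue_itv_co ab)).
Qed.

Lemma cvg_riemann_sum (t M : R) (F : R -> R) : 0 < t -> continuous F ->
  (forall s, `|F s| <= M) ->
  \sum_(k < n.+1) t / n.+1%:R * F (grid 0 t n.+1 k) @[n --> \oo] -->
  \int[leb]_(s in `[0, t[) F s.
Proof.
move=> t0 cF FM; pose g n := grid 0 t n.+1.
have gmono n := grid_mono n.+1 (ltW t0).
have E n : \sum_(k < n.+1) t / n.+1%:R * F (g n k) =
    \int[leb]_(s in `[0, t[) stepf (g n) (F \o g n) n.+1 s.
  rewrite /stepf Rintegral_sum//; last first.
    move=> i; apply: integrable_scale => //; apply: integrable_indic_on => //.
    exact: lebesgue_itv_co_fin.
  apply: eq_bigr => i _; rewrite RintegralZl//; last first.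
    apply: integrable_indic_on => //; exact: lebesgue_itv_co_fin.
  rewrite mulrC; congr (_ * _).
  transitivity (\int[leb]_(s in `[0, t[) (\1_(`[g n i, g n i.+1[) s * cst 1 s)).
    rewrite Rintegral_indic_cell.
    - have gi : g n i <= g n i.+1 by exact: gmono.
      by rewrite Rintegral_cst_co// mul1r /g gridS subr0 addrC addKr.
    - by rewrite -(grid0 0 t n.+1); exact: gmono.
    - by rewrite -[leRHS](gridn 0 t (ltn0Sn n)); exact: gmono.
  by apply: eq_Rintegral => s _; rewrite mulr1.
under eq_cvg do rewrite E.
apply: (@cvg_Rintegral_bounded _ _ _ _ _ M) => //.
- exact: lebesgue_itv_co_fin.
- by move=> n; apply: measurable_funTS; exact: measurable_stepf.
- move=> n s; rewrite /= in_itv/= => st; have [i iltn ix] := grid_cell_at st n.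
  by rewrite (stepfE _ (gmono n) iltn ix) FM.
- move=> s; rewrite /= in_itv/= => st.
  by apply: (cvg_stepf_left st); exact: cF.
Qed.

End riemann_sum.

(** * Two-sided bounds on the transform of the solution *)

Section oscillation.
Context (R : realType).
Notation leb := (@lebesgue_measure R).
Variables (A t : R).
Hypothesis A0 : A != 0.
Hypothesis t0 : 0 < t.

Let E (s : R) := expR (A * (t - s)).
(** For [x = z * u], the contribution of jumps of size [u] to the exponent, accumulated over
    [[0, t]]. *)
Definition osc (x : R) := \int[leb]_(s in `[0, t[) (1 - cos (x * E s)).

Let dE (s : R) : is_derive s 1 E (- A * E s).
Proof.
have -> : E = (fun s => expR (A * t) * expR (- A * s)).
  by apply/funext => r; rewrite -expRD /E; congr expR; ring.
have dexp := is_derive_expRM (- A) s.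
by apply: is_derive_eq; rewrite /GRing.scale/=; ring.
Qed.

Let cE : continuous E.
Proof.
by move=> s; apply/differentiable_continuous/derivable1_diffP; have [] := dE s.
Qed.

Let cosE (x : R) : continuous (fun s => cos (x * E s)).
Proof.
move=> s; have H : x * E r @[r --> s] --> x * E s.
  by apply: cvgM; [exact: cvg_cst|exact: cE].
exact: (cvg_comp _ _ H (@continuous_cos R _)).
Qed.

Let continuous_osc (x : R) : continuous (fun s => 1 - cos (x * E s)).
Proof. by move=> s; apply: cvgB; [exact: cvg_cst|exact: cosE]. Qed.

Let mt : measurable (`[0, t[ : set R). Proof. by []. Qed.

Let ico (f : R -> R) : continuous f -> leb.-integrable `[0, t[ (EFin \o f).
Proof.
move=> cf; apply: integrableS (integrable_continuous_itv 0 t cf) => //.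
exact: subset_itv_co_cc.
Qed.

Lemma cvg_osc (x : R) :
  \sum_(k < n.+1) t / n.+1%:R * (1 - cos (x * expR (A * (t - grid 0 t n.+1 k))))
    @[n --> \oo] --> osc x.
Proof.
apply: (@cvg_riemann_sum _ _ 2 (fun s => 1 - cos (x * E s))) => // s.
by rewrite (le_trans (ler_normB _ _))// normr1 (_ : 2 = 1 + 1)// lerD2l cos_max.
Qed.

(** [1 - cos (2 y) = 2 (1 - cos y) (1 + cos y)], and the last factor is at most 2. *)
Lemma osc_double (x : R) : osc (2 * x) <= 4 * osc x.
Proof.
rewrite /osc -RintegralZl//; last exact: ico.
apply: le_Rintegral => //.
- exact: ico.
- by apply: integrable_scale => //; exact: ico.
- move=> s _; rewrite -mulrA mulr_natl cos_mulr2n.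
  have := cos_max (x * E s); rewrite ler_norml => /andP[_]; set c := cos _.
  by nra.
Qed.

Lemma oscN (x : R) : osc (- x) = osc x.
Proof. by apply: eq_Rintegral => s _; rewrite mulNr cosN. Qed.

(* Integration by parts: the integral of [cos (x E s)] is of order [1 / x]. *)
Lemma osc_large : exists2 x1 : R, 0 < x1 & forall x, x1 <= x -> t / 2 <= osc x.
Proof.
pose K := expR (`|A| * t).
have K0 : 0 < K by exact: expR_gt0.
(* [N] collects the bounds on the remaining integral and on the two boundary terms, divided by
   [|A|]. From [x = 2 * N / t] on, the integral of the cosine is at most [N / x <= t / 2]. *)
pose N := t * K + 2 * K / `|A|.
have N0 : 0 < N.
  apply: addr_gt0; first exact: mulr_gt0.
  by apply: divr_gt0; rewrite ?normr_gt0// mulr_gt0.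
exists (2 * N / t) => [|x x1]; first by rewrite divr_gt0// mulr_gt0.
have x_gt0 : 0 < x by apply: lt_le_trans x1; rewrite divr_gt0// mulr_gt0.
(* [F] is [sin (x E s) / E s]: the division cancels the factor [E s] that the chain rule puts in
   front of the cosine. *)
pose F s := sin (x * E s) * expR (- A * (t - s)).
pose f1 s := A * (sin (x * E s) * expR (- A * (t - s))).
have EV s : E s * expR (- A * (t - s)) = 1.
  by rewrite -expRD -mulrDl subrr mul0r expR0.
have dV (s : R) : is_derive s 1 (fun s => expR (- A * (t - s)))
    (A * expR (- A * (t - s))).
  have -> : (fun s => expR (- A * (t - s))) = (fun s => expR (- A * t) * expR (A * s)).
    by apply/funext => r; rewrite -expRD; congr expR; ring.
  have dexp := is_derive_expRM A s.
  apply: is_derive_eq; rewrite /GRing.scale/=.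
  rewrite (_ : - A * (t - s) = - A * t + A * s) ?expRD; ring.
have dF (s : R) : is_derive s 1 F (f1 s - A * x * cos (x * E s)).
  have dxE : is_derive s 1 (fun s => x * E s) (x * (- A * E s)).
    by have := dE s => dEs; apply: is_derive_eq; rewrite /GRing.scale/=; ring.
  have dS := @is_derive1_comp _ sin (fun s => x * E s) s _ _ (is_derive_sin _) dxE.
  have dsV := dV s.
  apply: (is_derive_eq (is_deriveM dS dsV)).
  rewrite /GRing.scale/= /f1 -[A * x * _]mulr1 -(EV s); ring.
have Fle s : 0 <= s <= t -> `|F s| <= K.
  move=> /andP[s0 st]; rewrite normrM -[leRHS]mul1r ler_pM ?sin_max//.
  rewrite ger0_norm ?expR_ge0// ler_expR (le_trans (ler_norm _))// normrM normrN.
  by rewrite ler_wpM2l// ger0_norm ?subr_ge0// gerBl.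
have cV : continuous (fun s => expR (- A * (t - s))).
  by move=> s; apply/differentiable_continuous/derivable1_diffP; have [] := dV s.
have cf1 : continuous f1.
  move=> s; apply: cvgM; first exact: cvg_cst.
  apply: cvgM; last exact: cV.
  have H : x * E r @[r --> s] --> x * E s.
    by apply: cvgM; [exact: cvg_cst|exact: cE].
  exact: (cvg_comp _ _ H (@continuous_sin R _)).
have cosc : continuous (fun s => A * x * cos (x * E s)).
  by move=> s; apply: cvgM; [exact: cvg_cst|exact: cosE].
have ftc := FTC_itvco (ltW t0) (fun s => cvgB (cf1 s) (cosc s)) dF.
have oscE : osc x = t - \int[leb]_(s in `[0, t[) cos (x * E s).
  rewrite /osc RintegralB//; try exact: ico.
    by rewrite (Rintegral_cst_co _ (ltW t0)) mul1r subr0.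
  by apply: ico => s; exact: cvg_cst.
have f1le : `|\int[leb]_(s in `[0, t[) f1 s| <= `|A| * K * t.
  rewrite (le_trans (le_normr_Rintegral _ _))//; first exact: ico.
  apply: (@le_trans _ _ (\int[leb]_(s in `[0, t[) (`|A| * K))).
    apply: le_Rintegral => //.
    - apply: eq_integrable (integrable_abse (ico cf1)) => //.
    - by apply: ico => s; exact: cvg_cst.
    - move=> s; rewrite /= in_itv/= => /andP[s0 st]; rewrite normrM ler_wpM2l//.
      by rewrite Fle// s0 ltW.
  by rewrite (Rintegral_cst_co _ (ltW t0)) subr0.
have main : A * x * \int[leb]_(s in `[0, t[) cos (x * E s) =
    \int[leb]_(s in `[0, t[) f1 s - (F t - F 0).
  rewrite -ftc RintegralB//; try exact: ico.
  rewrite RintegralZl//; last exact: ico.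
  ring.
have cosle : `|\int[leb]_(s in `[0, t[) cos (x * E s)| <= N / x.
  rewrite ler_pdivlMr// -(ler_pM2l (x := `|A|)) ?normr_gt0//.
  set C := Rintegral _ _ _ in main *.
  have -> : `|A| * (`|C| * x) = `|A * x * C|.
    by rewrite !normrM (ger0_norm (ltW x_gt0)); ring.
  have -> : `|A| * N = `|A| * K * t + (K + K).
    by rewrite /N; field; rewrite normr_eq0.
  rewrite main (le_trans (ler_normB _ _))//; apply: lerD => //.
  rewrite (le_trans (ler_normB _ _))//; apply: lerD; apply: Fle.
    by rewrite lexx ltW.
  by rewrite lexx ltW.
rewrite oscE lerBrDr -lerBrDl (le_trans (ler_norm _))// (le_trans cosle)//.
rewrite ler_pdivrMr//; move: x1; rewrite ler_pdivrMr//; lra.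
Qed.

Lemma osc_ge0 (x : R) : 0 <= osc x.
Proof. by apply: Rintegral_ge0 => s _; exact: onemcos_ge0. Qed.

(* By [osc_double], the bound [t / 2] valid for large [x] propagates down to 0
   by successive halving of [x]. *)
Lemma osc_lower : exists2 c : R, 0 < c & forall x, c * Num.min (x ^+ 2) 1 <= osc x.
Proof.
have [x1 x1_gt0 Hx1] := osc_large.
(* With this [b] one has [4 b x^2 <= t / 2] on [[0, x1]], so that a single halving step stays below
   the bound of [osc_large]. *)
pose b := t / (8 * x1 ^+ 2).
have x1n0 : x1 != 0 by rewrite gt_eqF.
have b0 : 0 < b by rewrite divr_gt0// mulr_gt0// exprn_gt0.
have small j : forall x, 0 <= x <= x1 -> x1 <= 2 ^+ j * x -> b * x ^+ 2 <= osc x.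
  have bx1 x : 0 <= x <= x1 -> b * x ^+ 2 <= t / 8.
    move=> /andP[x_ge0 xx1].
    have -> : t / 8 = b * x1 ^+ 2 by rewrite /b; field.
    by rewrite ler_pM2l// lerXn2r// nnegrE ltW.
  elim: j => [|j IHj] x xx1 jx.
    rewrite expr0 mul1r in jx.
    by have := Hx1 x jx; have := bx1 _ xx1; have := t0; lra.
  have H4 := osc_double x.
  rewrite -(ler_pM2l (x := 4))//; apply: le_trans H4.
  have /andP[x_ge0 _] := xx1.
  have [x2|x2] := leP (2 * x) x1.
    have -> : 4 * (b * x ^+ 2) = b * (2 * x) ^+ 2 by ring.
    apply: IHj; first by rewrite mulr_ge0.
    by rewrite mulrA -exprSr.
  apply: (le_trans (y := t / 2)); last exact/Hx1/ltW.
  have := bx1 _ xx1; lra.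
exists (Num.min (t / 2) b); first by rewrite lt_min b0 divr_gt0.
move=> x.
wlog x_ge0 : x / 0 <= x.
  move=> H; case: (leP 0 x) => [/H//|/ltW x0].
  by rewrite -oscN -sqrrN; apply: H; rewrite oppr_ge0.
have [xx1|xx1] := leP x x1; last first.
  apply: le_trans (Hx1 _ (ltW xx1)); rewrite -[leRHS]mulr1.
  apply: ler_pM => //; rewrite ?min_sqr_ge0// ?ge_min ?lexx ?orbT//.
  by rewrite le_min divr_ge0 ?ltW.
apply: (le_trans (y := b * x ^+ 2)).
  apply: ler_pM => //; rewrite ?min_sqr_ge0// ?ge_min ?lexx ?orbT//.
  by rewrite le_min divr_ge0 ?ltW.
move: x_ge0; rewrite le_eqVlt => /predU1P[<-|x_gt0].
  by rewrite expr0n mulr0 osc_ge0.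
(* Enough halvings: for [j] the integer part of [x1 / x], one has [x1 / x < j + 1 <= 2 ^+ j]. *)
apply: (small (Num.truncn (x1 / x))); first by rewrite xx1 ltW.
rewrite -ler_pdivrMr//; apply: ltW.
apply: lt_le_trans (truncnS_gt _) _.
by rewrite -natrX ler_nat ltn_expl.
Qed.

End oscillation.

Lemma cvg_le (R : realType) (u v : nat -> R) (a b : R) :
  u n @[n --> \oo] --> a -> v n @[n --> \oo] --> b -> (forall n, u n <= v n) -> a <= b.
Proof.
move=> ua vb uv; rewrite -(cvg_lim _ ua)// -(cvg_lim _ vb)//.
by apply: ler_lim; [exact: cvgP ua|exact: cvgP vb|exact: nearW].
Qed.

Section levy_growth.
Context (R : realType) (Pi : {measure set R -> \bar R}).
Hypothesis HPi : is_levy_measure Pi.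

Definition levy_growth (z : R) : R := \int[Pi]_u Num.min ((z * u) ^+ 2) 1.

Lemma levy_exp_le_growth (c z : R) :
  levy_exp Pi (z * c) <= 2 * Num.max (c ^+ 2) 1 * levy_growth z.
Proof.
rewrite /levy_growth -RintegralZl//; last exact: integrable_levy_min.
apply: le_Rintegral => //.
- exact: integrable_levy_exp.
- by apply: integrable_scale => //; exact: integrable_levy_min.
move=> u _; rewrite (le_trans (onemcos_le_min _))// -[leRHS]mulrA ler_pM2l//.
by rewrite (_ : z * c * u = c * (z * u)) ?min_sqrM//; ring.
Qed.

Lemma levy_growth_ge0 z : 0 <= levy_growth z.
Proof. by apply: Rintegral_ge0 => u _; exact: min_sqr_ge0. Qed.

Section solution_bounds.
Variables (A t : R) (m : R -> R).
Hypothesis A0 : A != 0.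
Hypothesis t0 : 0 < t.
Hypothesis mE : forall z : R,
  expR (- (2 * \sum_(k < n.+1) t / n.+1%:R *
    levy_exp Pi (z * expR (A * (t - grid 0 t n.+1 k))))) @[n --> \oo] --> m z.

Lemma transform_lower (z : R) :
  expR (- (4 * t * expR (2 * `|A| * t) * levy_growth z)) <= m z.
Proof.
apply: (@cvg_le _ (fun=> _) _ _ _ (cvg_cst _) (@mE z)) => n /=.
rewrite ler_expR lerN2.
(* [c] dominates both 1 and the square of [expR (A * (t - s))] for [s] in [[0, t]]. Each summand is
   then at most [2 * c * levy_growth z], uniformly in the grid. *)
set c := expR (2 * `|A| * t).
have -> : 4 * t * c * levy_growth z =
    2 * \sum_(k < n.+1) t / n.+1%:R * (2 * c * levy_growth z).
  rewrite sumr_const card_ord -mulr_natl; field.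
  by rewrite ?natr1 ?nat1r pnatr_eq0.
rewrite ler_pM2l//; apply: ler_sum => k _.
rewrite ler_wpM2l ?divr_ge0 ?(ltW t0)// (le_trans (levy_exp_le_growth _ _))//.
rewrite ler_wpM2r ?levy_growth_ge0// ler_pM2l//.
have gk : 0 <= grid 0 t n.+1 k <= t.
  have gm := grid_mono n.+1 (ltW t0).
  apply/andP; split; first by rewrite -[leLHS](grid0 0 t n.+1); exact: gm.
  by rewrite -[leRHS](gridn 0 t (ltn0Sn n)); apply: gm; exact: ltnW.
case/andP: gk => g0 gt.
rewrite ge_max; apply/andP; split; last first.
  by rewrite -expR0 ler_expR !mulr_ge0// ltW.
rewrite -expRM_natl ler_expR -mulrA ler_pM2l//.
rewrite (le_trans (ler_norm _))// normrM ler_wpM2l// ger0_norm ?subr_ge0//.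
by rewrite gerBl.
Qed.

(* [osc_lower] integrated against [Pi]; the passage to the limit in the Riemann
   sums uses dominated convergence for their minimum with the lower bound. *)
Lemma transform_upper : exists2 c : R, 0 < c &
  forall z, m z <= expR (- (c * levy_growth z)).
Proof.
have [c c0 Hc] := osc_lower A0 t0; exists (2 * c); first by rewrite mulr_gt0.
move=> z.
pose r n u := \sum_(k < n.+1) t / n.+1%:R *
  (1 - cos (z * u * expR (A * (t - grid 0 t n.+1 k)))).
pose h u := c * Num.min ((z * u) ^+ 2) 1.
have ih : Pi.-integrable setT (EFin \o h).
  by apply: integrable_scale => //; exact: integrable_levy_min.
have h0 u : 0 <= h u by rewrite mulr_ge0 ?min_sqr_ge0 ?ltW.
have r0 n u : 0 <= r n u.
  by apply: sumr_ge0 => k _; rewrite mulr_ge0 ?onemcos_ge0 ?divr_ge0 ?ltW.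
have rint n (k : 'I_n.+1) : Pi.-integrable setT (EFin \o (fun u =>
    t / n.+1%:R * (1 - cos (z * u * expR (A * (t - grid 0 t n.+1 k)))))).
  apply: integrable_scale => //.
  have -> : (fun u => 1 - cos (z * u * expR (A * (t - grid 0 t n.+1 k)))) =
    (fun u => 1 - cos (z * expR (A * (t - grid 0 t n.+1 k)) * u)).
    by apply/funext => u; rewrite mulrAC.
  exact: integrable_levy_exp.
have rE n : \sum_(k < n.+1) t / n.+1%:R *
    levy_exp Pi (z * expR (A * (t - grid 0 t n.+1 k))) = \int[Pi]_u r n u.
  rewrite Rintegral_sum//; apply: eq_bigr => k _; rewrite -RintegralZl//.
    by apply: eq_Rintegral => u _; congr (_ * (1 - cos _)); ring.
  exact: integrable_levy_exp.
have ir n : Pi.-integrable setT (EFin \o r n).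
  apply: (eq_integrable measurableT (fun u => \sum_(k < n.+1) (t / n.+1%:R *
    (1 - cos (z * u * expR (A * (t - grid 0 t n.+1 k)))))%:E)%E).
    by move=> u _; rewrite sumEFin.
  by apply: integrable_sum => // k _; exact: rint.
have mr n : measurable_fun setT (r n).
  by have /measurable_EFinP := measurable_int Pi (ir n).
have mh : measurable_fun setT h.
  by have /measurable_EFinP := measurable_int Pi ih.
pose f n u := Num.min (r n u) (h u).
have mf n : measurable_fun setT (f n) by exact: measurable_minr.
have fr n u : f n u <= r n u by rewrite ge_min lexx.
have fh n u : f n u <= h u by rewrite ge_min lexx orbT.
have f0 n u : 0 <= f n u by rewrite le_min r0 h0.
have if_ n : Pi.-integrable setT (EFin \o f n).
  apply: le_integrable ih => //; first exact/measurable_EFinP.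
  by move=> u _ /=; rewrite lee_fin !ger0_norm.
have fcvg u : f n u @[n --> \oo] --> h u.
  have hr : h u <= osc A t (z * u) by exact: Hc.
  have rc : r n u @[n --> \oo] --> osc A t (z * u) by exact: cvg_osc.
  apply/cvgrPdist_le => e e0.
  have : \forall n \near \oo, osc A t (z * u) - e <= r n u.
    by apply: (cvgr_ge _ rc); rewrite gtrBl.
  apply: filterS => n rn; rewrite ger0_norm ?subr_ge0// lerBlDr -lerBlDl.
  by rewrite le_min (le_trans _ rn) ?lerD2r//= lerBlDr lerDl ltW.
have If : \int[Pi]_u f n u @[n --> \oo] --> \int[Pi]_u h u.
  have [||||| _ _ H] := @dominated_convergence _ _ _ Pi _ measurableT
    (fun n => EFin \o f n) (EFin \o h) (EFin \o h) => //.
  - by move=> n; exact/measurable_EFinP.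
  - exact/measurable_EFinP.
  - apply: aeW => u _; apply/fine_cvgP; split; first exact: nearW.
    exact: fcvg.
  - by apply: aeW => u n _ /=; rewrite lee_fin ger0_norm.
  by apply: fine_cvg; rewrite fineK// integrable_fin_num.
have expf : expR (- (2 * \int[Pi]_u f n u)) @[n --> \oo] -->
    expR (- (2 * c * levy_growth z)).
  suff H : - (2 * \int[Pi]_u f n u) @[n --> \oo] --> - (2 * c * levy_growth z).
    exact: (cvg_comp _ _ H (@continuous_expR R _)).
  apply: cvgN; rewrite -mulrA; apply: cvgM; first exact: cvg_cst.
  by rewrite /levy_growth -RintegralZl//; exact: integrable_levy_min.
apply: (cvg_le (@mE z) expf) => n.
rewrite ler_expR lerN2 ler_pM2l// rE.
by apply: le_Rintegral.
Qed.

End solution_bounds.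
End levy_growth.

(** * Damped integrals over the half-line and Fubini's theorem *)

Section half_line.
Context (R : realType).
Notation leb := (@lebesgue_measure R).

Lemma continuous_of_derive (F f : R -> R) : (forall x : R, is_derive x 1 F (f x)) ->
  continuous F.
Proof.
by move=> dF x; apply/differentiable_continuous/derivable1_diffP; have [] := dF x.
Qed.

Lemma FTC_half_line (f F : R -> R) (l : R) : (forall x, 0 <= f x) -> continuous f ->
  (forall x : R, is_derive x 1 F (f x)) -> F x @[x --> +oo%R] --> l ->
  (\int[leb]_(x in `[0%R, +oo[) (f x)%:E = (l - F 0)%:E)%E.
Proof.
move=> f0 cf dF Fl; rewrite EFinB.
have cF := continuous_of_derive dF.
apply: ge0_continuous_FTC2y => //.
- by apply: continuous_subspaceT.
- exact/cvg_at_right_filter/cF.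
- by move=> x _; rewrite derive1E; have [_ ->] := dF x.
Qed.

Lemma FTC_half_line_integrable (f F : R -> R) (l : R) : (forall x, 0 <= f x) ->
  continuous f -> (forall x : R, is_derive x 1 F (f x)) -> F x @[x --> +oo%R] --> l ->
  leb.-integrable `[0, +oo[ (EFin \o f).
Proof.
move=> f0 cf dF Fl; apply/integrableP; split.
  by apply/measurable_EFinP; apply: measurable_funTS; exact: continuous_measurable_fun.
under eq_integral do rewrite /= ger0_norm//.
by rewrite (FTC_half_line f0 cf dF Fl) ltry.
Qed.

Lemma cvg_expRN_bounded (s M : R) (h : R -> R) : 0 < s -> (forall x, `|h x| <= M) ->
  expR (- s * x) * h x @[x --> +oo%R] --> (0 : R).
Proof.
move=> s0 hM.
have e0 : expR (- s * x) @[x --> +oo%R] --> (0 : R).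
  have H : s * x @[x --> +oo%R] --> +oo%R.
    apply: gt0_cvgMry s0 _. exact: cvg_id.
  have := cvg_comp _ _ H (@cvgr_expR R); apply: cvg_trans.
  by apply: near_eq_cvg; apply: nearW => x /=; rewrite mulNr.
apply: norm_cvg0; apply: (@squeeze_cvgr _ _ _ _ (cst 0) (fun x => expR (- s * x) * M)).
- apply: nearW => x /=; rewrite normr_ge0/= normrM ger0_norm ?expR_ge0//.
  by rewrite ler_wpM2l ?expR_ge0.
- exact: cvg_cst.
- by rewrite -[X in _ --> X](mul0r M); apply: cvgM => //; exact: cvg_cst.
Qed.

Lemma integral_expRN (s : R) : 0 < s ->
  leb.-integrable `[0, +oo[ (EFin \o (fun z => expR (- s * z))) /\
  \int[leb]_(z in `[0, +oo[) expR (- s * z) = s^-1.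
Proof.
move=> s0; pose F z := - s^-1 * expR (- s * z).
have dF (z : R) : is_derive z 1 F (expR (- s * z)).
  have d1 := is_derive_expRM (- s) z.
  by apply: is_derive_eq; rewrite /GRing.scale/=; field; rewrite gt_eqF.
have F0 : F x @[x --> +oo%R] --> (0 : R).
  have := @cvg_expRN_bounded s `|s^-1| (fun=> - s^-1) s0.
  move=> /(_ (fun=> _)); rewrite normrN => /(_ (lexx _)); apply: cvg_trans.
  by apply: near_eq_cvg; apply: nearW => x /=; rewrite mulrC.
have e0 z : 0 <= expR (- s * z) by exact: expR_ge0.
have ce := @continuous_expRM R (- s).
split; first exact: FTC_half_line_integrable e0 ce dF F0.
by rewrite /Rintegral (FTC_half_line e0 ce dF F0)/= /F mulr0 expR0 mulr1 sub0r opprK.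
Qed.

Lemma continuous_cosMr (x : R) : continuous (fun z : R => cos (z * x)).
Proof.
move=> z; have H : y * x @[y --> z] --> z * x by apply: cvgM => //; exact: cvg_cst.
exact: (cvg_comp _ _ H (@continuous_cos R _)).
Qed.

Lemma continuous_sinMr (x : R) : continuous (fun z : R => sin (z * x)).
Proof.
move=> z; have H : y * x @[y --> z] --> z * x by apply: cvgM => //; exact: cvg_cst.
exact: (cvg_comp _ _ H (@continuous_sin R _)).
Qed.

Lemma integral_expRN_cos (s x : R) : 0 < s ->
  \int[leb]_(z in `[0, +oo[) (expR (- s * z) * cos (z * x)) = s / (s ^+ 2 + x ^+ 2).
Proof.
move=> s0; have [ie inte] := integral_expRN s0.
have sx0 : s ^+ 2 + x ^+ 2 != 0.
  by rewrite gt_eqF// ltr_pwDl ?sqr_ge0// exprn_gt0.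
pose F z := expR (- s * z) *
  ((x * sin (z * x) - s * cos (z * x)) / (s ^+ 2 + x ^+ 2) - s^-1).
(* [FTC_half_line] asks for a nonnegative integrand, hence the added 1; its contribution [s^-1] is
   taken away at the end by [integral_expRN]. *)
pose f z := expR (- s * z) * (1 + cos (z * x)).
have dF (z : R) : is_derive z 1 F (f z).
  have d1 := is_derive_expRM (- s) z.
  have d2 : is_derive z 1 (fun z : R => z * x) x.
    by apply: is_derive_eq; rewrite /GRing.scale/=; ring.
  have d3 := @is_derive1_comp _ sin (fun z => z * x) z _ _ (is_derive_sin _) d2.
  have d4 := @is_derive1_comp _ cos (fun z => z * x) z _ _ (is_derive_cos _) d2.
  have d3' : is_derive z 1 (fun z => sin (z * x)) (cos (z * x) * x) by exact: d3.
  have d4' : is_derive z 1 (fun z => cos (z * x)) (- sin (z * x) * x) by exact: d4.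
  rewrite /F; apply: is_derive_eq; rewrite /GRing.scale/= /f.
  by field; rewrite sx0 gt_eqF.
have f0 z : 0 <= f z.
  by rewrite mulr_ge0 ?expR_ge0// -lerBlDl sub0r cos_geN1.
have cf : continuous f.
  move=> z; apply: cvgM; first exact: continuous_expRM.
  by apply: cvgD; [exact: cvg_cst|exact: continuous_cosMr].
have Foo : F z @[z --> +oo%R] --> (0 : R).
  apply: (@cvg_expRN_bounded s ((`|x| + s) / (s ^+ 2 + x ^+ 2) + s^-1)) => // z.
  rewrite (le_trans (ler_normB _ _))//; apply: lerD; last by rewrite ger0_norm// invr_ge0 ltW.
  rewrite normrM [X in _ * X]ger0_norm ?invr_ge0 ?addr_ge0 ?sqr_ge0//.
  rewrite ler_wpM2r ?invr_ge0 ?addr_ge0 ?sqr_ge0// (le_trans (ler_normB _ _))//.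
  apply: lerD; rewrite normrM; first by rewrite ler_piMr// sin_max.
  by rewrite (ger0_norm (ltW s0)) ler_piMr ?cos_max// ltW.
have If : \int[leb]_(z in `[0, +oo[) f z = s^-1 + s / (s ^+ 2 + x ^+ 2).
  rewrite /Rintegral (FTC_half_line f0 cf dF Foo)/= /F mulr0 expR0 mul0r sin0 cos0.
  by field; rewrite sx0 gt_eqF.
have if_ := FTC_half_line_integrable f0 cf dF Foo.
transitivity (\int[leb]_(z in `[0, +oo[) (f z - expR (- s * z))).
  by apply: eq_Rintegral => z _; rewrite /f; ring.
by rewrite RintegralB// If inte addrC addKr.
Qed.

End half_line.

Section Fubini_dominated.
Context (R : realType).
Notation leb := (@lebesgue_measure R).

(** A majorant [g z] uniform in [w] gives integrability on the product, because [P] has mass 1. The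
    domain [D] is turned into an indicator so that Fubini's theorem applies on the whole product
    space. *)
Lemma Fubini_dominated d (T : measurableType d) (P : probability T R)
    (D : set R) (k : T * R -> R) (g : R -> R) :
  measurable D -> measurable_fun setT k ->
  (@lebesgue_measure R).-integrable D (EFin \o g) ->
  (forall w z, D z -> `|k (w, z)| <= g z) ->
  \int[P]_w (\int[@lebesgue_measure R]_(z in D) k (w, z)) =
  \int[@lebesgue_measure R]_(z in D) (\int[P]_w k (w, z)).
Proof.
move=> mD mk ig kg.
pose f (q : T * R) := (k q * \1_D q.2)%:E.
have mf : measurable_fun setT f.
  apply/measurable_EFinP; apply: measurable_funM => //.
  by apply: (measurableT_comp (f := \1_D : R -> R)) => //.
have mkw w : measurable_fun setT (fun z => k (w, z)).
  by apply: (measurableT_comp mk); exact: measurable_pair1.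
have mkz z : measurable_fun setT (fun w => k (w, z)).
  by apply: (measurableT_comp mk); exact: measurable_pair2.
have fD w : (fun z => f (w, z)) = (EFin \o (fun z => k (w, z))) \_ D.
  apply/funext => z; rewrite patchE /f/= indicE.
  by case: (z \in D); rewrite ?mulr1 ?mulr0.
have ikD w : leb.-integrable D (EFin \o (fun z => k (w, z))).
  apply: le_integrable ig => //.
    by apply/measurable_EFinP; apply: measurable_funTS; exact: mkw.
  by move=> z Dz /=; rewrite lee_fin (le_trans (kg w z Dz))// ler_norm.
have ikP z : D z -> P.-integrable setT (EFin \o (fun w => k (w, z))).
  by move=> Dz; apply: (@bounded_integrable _ _ _ _ (g z)) => // w; exact: kg.
have intf : (P \x leb)%E.-integrable setT f.
  apply/(integrable12ltyP P leb mf).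
  have goo : (\int[leb]_(z in D) `|(g z)%:E| < +oo)%E by have /integrableP[] := ig.
  apply: (@le_lt_trans _ _ (\int[P]_w \int[leb]_(z in D) `|(g z)%:E|)%E); last first.
    have PT : (P : {measure set T -> \bar R}) setT = 1%E by exact: probability_setT.
    by rewrite integral_cst// PT mule1.
  apply: ge0_le_integral => //.
  - by move=> w _; exact: integral_ge0.
  - apply: (@measurable_fun_fubini_tonelli_F _ _ _ _ _ leb (abse \o f)) => //.
    + by apply: measurableT_comp => //; exact: mf.
    + by move=> q; exact: abse_ge0.
  - move=> w _; rewrite [leRHS]integral_mkcond.
    apply: ge0_le_integral => //.
    + by apply: measurableT_comp => //; apply: measurableT_comp => //; exact: measurable_pair1.
    + by have /integrableP[/(measurable_restrictT _ mD).1 mg _] := integrable_abse ig.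
    + move=> z _; rewrite (congr1 (fun h => h z) (fD w)) !patchE; case: ifPn => [/set_mem Dz|_].
        by rewrite /= lee_fin (le_trans (kg w z Dz))// ler_norm.
      by rewrite abse0.
have inner1 w : (\int[leb]_(z in D) k (w, z))%:E = (\int[leb]_z f (w, z))%E.
  rewrite fD -integral_mkcond /Rintegral fineK//.
  by apply: integrable_fin_num => //; exact: ikD.
have inner2 z : (\int[P]_w k (w, z) * \1_D z)%:E = (\int[P]_w f (w, z))%E.
  rewrite /f indicE/=; case: (boolP (z \in D)) => [/set_mem Dz|_].
    rewrite mulr1; under [RHS]eq_integral do rewrite mulr1.
    rewrite /Rintegral fineK//.
    exact: (integrable_fin_num measurableT (ikP z Dz)).
  by rewrite mulr0; under [RHS]eq_integral do rewrite mulr0; rewrite integral0.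
have := Fubini intf; under eq_integral do rewrite -inner1.
under [X in _ = X -> _]eq_integral do rewrite -inner2.
move=> H; rewrite [LHS]/Rintegral H [RHS]Rintegral_mkcond /Rintegral; congr fine.
apply: eq_integral => z _; rewrite patchE indicE.
by case: (z \in D); rewrite ?mulr1 ?mulr0.
Qed.

End Fubini_dominated.

(** * The Cauchy kernel and Abel summation *)

Section cauchy_kernel.
Context (R : realType).
Notation leb := (@lebesgue_measure R).

(** The Poisson kernel of the half-plane without its factor [1 / pi]: its total integral is [pi],
    which is where the constant in [cauchy_mean_le] comes from. *)
Definition cauchy (s x : R) : R := s / (s ^+ 2 + x ^+ 2).

Lemma cauchy_den_gt0 (s x : R) : 0 < s -> 0 < s ^+ 2 + x ^+ 2.
Proof. by move=> s0; rewrite ltr_pwDl ?sqr_ge0// exprn_gt0. Qed.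

Lemma cauchy_ge0 (s x : R) : 0 < s -> 0 <= cauchy s x.
Proof. by move=> s0; rewrite divr_ge0 ?(ltW s0)// ltW// cauchy_den_gt0. Qed.

Lemma cauchy_le (s x : R) : 0 < s -> cauchy s x <= s^-1.
Proof.
move=> s0; rewrite /cauchy ler_pdivrMr ?cauchy_den_gt0// mulrDr.
by rewrite expr2 mulKf ?gt_eqF// lerDl mulr_ge0 ?sqr_ge0// invr_ge0 ltW.
Qed.

Lemma continuous_cauchy (s x : R) : 0 < s -> continuous (fun y : R => cauchy s (x - y)).
Proof.
move=> s0 y; apply: cvgM; first exact: cvg_cst.
apply: cvgV; first by rewrite gt_eqF// cauchy_den_gt0.
apply: cvgD; first exact: cvg_cst.
have H : x - z @[z --> y] --> x - y by apply: cvgB => //; exact: cvg_cst.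
by rewrite expr2; under eq_cvg do rewrite expr2; exact: cvgM.
Qed.

Lemma measurable_cauchy (s x : R) : 0 < s ->
  measurable_fun setT (fun y : R => cauchy s (x - y)).
Proof. by move=> s0; apply: continuous_measurable_fun; exact: continuous_cauchy. Qed.

Lemma integral_cauchy (s x a b : R) : 0 < s -> a <= b ->
  \int[leb]_(y in `[a, b]) cauchy s (y - x) = atan ((b - x) / s) - atan ((a - x) / s).
Proof.
move=> s0 ab; apply: (FTC_itv (F := fun y : R => atan ((y - x) / s))) => //.
  have -> : (fun y : R => cauchy s (y - x)) = (fun y : R => cauchy s (x - y)).
    by apply/funext => y; rewrite /cauchy -[(y - x) ^+ 2]sqrrN opprB.
  exact: continuous_cauchy.
move=> y.
have d1 : is_derive y 1 (fun y : R => (y - x) / s) s^-1.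
  by apply: is_derive_eq; rewrite /GRing.scale/=; field; rewrite gt_eqF.
have d2 := @is_derive1_comp _ atan (fun y : R => (y - x) / s) y _ _ (is_derive1_atan _) d1.
apply: (is_derive_eq d2); rewrite /cauchy; field.
by rewrite !gt_eqF// cauchy_den_gt0.
Qed.

End cauchy_kernel.

Section le_measure.
Import HBNNSimple.

Lemma le_measure_integral d (T : measurableType d) (R : realType)
    (m1 m2 : {measure set T -> \bar R}) (f : T -> \bar R) :
  (forall A, measurable A -> (m1 A <= m2 A)%E) -> (forall x, (0 <= f x)%E) ->
  (\int[m1]_x f x <= \int[m2]_x f x)%E.
Proof.
move=> m12 f0; rewrite !ge0_integralTE//.
apply: ub_ereal_sup => _ [h hf <-].
apply: le_trans (ereal_sup_ubound _); last by exists h.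
rewrite !sintegralE; apply: lee_fsum => [|_ [x _ <-]]; first exact: fimfunP.
by rewrite lee_wpmul2l ?lee_fin//; exact: m12.
Qed.

End le_measure.

Section transform_integrals.
Context d (T : measurableType d) (R : realType) (P : probability T R).
Notation leb := (@lebesgue_measure R).
Variable Y : T -> R.
Hypothesis mY : measurable_fun setT Y.

Definition cosE (z : R) : R := \int[P]_w cos (z * Y w).
Definition sinE (z : R) : R := \int[P]_w sin (z * Y w).

Let mzY (z : R) : measurable_fun setT (fun w => z * Y w).
Proof. exact: measurable_funM. Qed.

Lemma norm_cosE (z : R) : `|cosE z| <= 1.
Proof. exact: norm_cosE_le1. Qed.

Lemma norm_sinE (z : R) : `|sinE z| <= 1.
Proof. exact: norm_sinE_le1. Qed.

Let continuous_trigE (trig : R -> R) : continuous trig -> (forall x, `|trig x| <= 1) ->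
  continuous (fun z : R => \int[P]_w trig (z * Y w)).
Proof.
move=> ct t1 a.
have mt : measurable_fun setT trig by exact: continuous_measurable_fun.
have := @continuity_under_integral R d T P (fun z w => trig (z * Y w)) setT measurableT
  (a - 1) (a + 1) _ _ (cst 1) _ _.
apply.
- move=> z _; apply: (@bounded_integrable _ _ _ _ 1) => //.
  exact: measurableT_comp.
- apply: aeW => w _ z _.
  have H : y * Y w @[y --> z] --> z * Y w by apply: cvgM => //; exact: cvg_cst.
  exact: (cvg_comp _ _ H (ct _)).
- by apply: (@bounded_integrable _ _ _ _ 1) => // w; rewrite normr1.
- by move=> z _; apply: aeW => w _.
- by rewrite inE/= in_itv/= gtrBl ltrDl ltr01.
Qed.

Lemma continuous_cosE : continuous cosE.
Proof. by apply: continuous_trigE; [exact: continuous_cos|exact: cos_max]. Qed.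

Lemma continuous_sinE : continuous sinE.
Proof. by apply: continuous_trigE; [exact: continuous_sin|exact: sin_max]. Qed.

Lemma sqmodM (z : R) : sqmod P (fun w => z * Y w) = cosE z ^+ 2 + sinE z ^+ 2.
Proof. by []. Qed.

(* The real part of [exp (i z x)] times the conjugate of [E exp (i z Y)]. *)
Lemma cosE_sinE_comb (z x : R) :
  cos (z * x) * cosE z + sin (z * x) * sinE z = \int[P]_w cos (z * (x - Y w)).
Proof.
have ic := integrable_cos P (mzY z); have is_ := integrable_sin P (mzY z).
rewrite -RintegralZl// -RintegralZl// -RintegralD//; try exact: integrable_scale.
by apply: eq_Rintegral => w _; rewrite mulrBr cosB.
Qed.

(** Fourier inversion with Abel damping. The factor [expR (- s * z)] makes the integral absolutely
    convergent for every law of [Y]; after exchanging the integrals, the one over [z] is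
    explicit. *)
Lemma abel_transform (s x : R) : 0 < s ->
  \int[leb]_(z in `[0, +oo[)
    (expR (- s * z) * (cos (z * x) * cosE z + sin (z * x) * sinE z)) =
  \int[P]_w cauchy s (x - Y w).
Proof.
move=> s0; have [ie _] := integral_expRN s0.
transitivity (\int[leb]_(z in `[0, +oo[) \int[P]_w
    (expR (- s * z) * cos (z * (x - Y w)))).
  apply: eq_Rintegral => z _; rewrite cosE_sinE_comb RintegralZl//.
  by apply: integrable_cos; apply: measurable_funM => //; exact: measurable_funB.
rewrite -(@Fubini_dominated _ _ _ P _
  (fun q => expR (- s * q.2) * cos (q.2 * (x - Y q.1))) (fun z => expR (- s * z)))//.
- apply: eq_Rintegral => w _.
  by rewrite /= integral_expRN_cos.
- have mexp : measurable_fun setT (fun z : R => expR (- s * z)).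
    by apply: continuous_measurable_fun; exact: continuous_expRM.
  apply: measurable_funM.
    by apply: (measurableT_comp mexp).
  apply: measurable_cosT; apply: measurable_funM => //.
  by apply: measurable_funB => //; exact: measurableT_comp.
- move=> w z _ /=; rewrite normrM ger0_norm ?expR_ge0// ler_piMr ?expR_ge0//.
  exact: cos_max.
Qed.

(** The squared modulus is the characteristic function of the difference of two independent copies
    of [Y]. The double integral stands for the two copies: [abel_transform] at [x = Y w] is averaged
    over [w]. *)
Lemma abel_sqmod (s : R) : 0 < s ->
  \int[leb]_(z in `[0, +oo[) (expR (- s * z) * sqmod P (fun w => z * Y w)) =
  \int[P]_w (\int[P]_v cauchy s (Y w - Y v)).
Proof.
move=> s0; have [ie _] := integral_expRN s0.
have mc : measurable_fun setT cosE.
  by apply: continuous_measurable_fun; exact: continuous_cosE.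
have ms : measurable_fun setT sinE.
  by apply: continuous_measurable_fun; exact: continuous_sinE.
transitivity (\int[leb]_(z in `[0, +oo[) \int[P]_w
    (expR (- s * z) * (cos (z * Y w) * cosE z + sin (z * Y w) * sinE z))).
  apply: eq_Rintegral => z _.
  have ic := integrable_cos P (mzY z); have is_ := integrable_sin P (mzY z).
  transitivity (\int[P]_w ((expR (- s * z) * cosE z) * cos (z * Y w) +
      (expR (- s * z) * sinE z) * sin (z * Y w))).
    rewrite RintegralD//; try exact: integrable_scale.
    by rewrite !RintegralZl// sqmodM -/(cosE z) -/(sinE z); ring.
  by apply: eq_Rintegral => w _; ring.
rewrite -(@Fubini_dominated _ _ _ P _
  (fun q => expR (- s * q.2) * (cos (q.2 * Y q.1) * cosE q.2 + sin (q.2 * Y q.1) * sinE q.2))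
  (fun z => 2 * expR (- s * z)))//.
- by apply: eq_Rintegral => w _; rewrite /= abel_transform.
- have mexp : measurable_fun setT (fun z : R => expR (- s * z)).
    by apply: continuous_measurable_fun; exact: continuous_expRM.
  have mYq : measurable_fun setT (fun q : T * R => q.2 * Y q.1).
    by apply: measurable_funM => //; exact: measurableT_comp.
  apply: measurable_funM; first by apply: (measurableT_comp mexp).
  apply: measurable_funD; apply: measurable_funM.
  + exact: measurable_cosT.
  + exact: (measurableT_comp mc).
  + exact: measurable_sinT.
  + exact: (measurableT_comp ms).
- exact: integrable_scale.
- move=> w z _ /=; rewrite normrM ger0_norm ?expR_ge0// mulrC ler_wpM2r ?expR_ge0//.
  rewrite (le_trans (ler_normD _ _))// (_ : 2 = 1 + 1)//.
  apply: lerD; rewrite normrM mulr_ile1 ?cos_max ?sin_max ?norm_cosE ?norm_sinE//.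
Qed.

End transform_integrals.

Lemma cauchyC (R : realType) (s x y : R) : cauchy s (x - y) = cauchy s (y - x).
Proof. by rewrite /cauchy -[(x - y) ^+ 2]sqrrN opprB. Qed.

(** * Consequences of a bounded density *)

Section bounded_density.
Context d (T : measurableType d) (R : realType) (P : probability T R).
Notation leb := (@lebesgue_measure R).
Variable Y : {RV P >-> R}.
Let mY : measurable_fun setT Y. Proof. by []. Qed.

Lemma continuous_sqmodM : continuous (fun z : R => sqmod P (fun w => z * Y w)).
Proof.
move=> z; rewrite /continuous_at sqmodM !expr2.
have cc : cosE P Y y @[y --> z] --> cosE P Y z by exact: continuous_cosE.
have cs : sinE P Y y @[y --> z] --> sinE P Y z by exact: continuous_sinE.
under eq_cvg do rewrite sqmodM !expr2.
by apply: cvgD; apply: cvgM.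
Qed.

Lemma sqmod_le2 (z : R) : sqmod P (fun w => z * Y w) <= 2.
Proof.
have sq (x : R) : `|x| <= 1 -> x ^+ 2 <= 1.
  by move=> x1; rewrite -(real_normK (num_real x)) expr_le1.
rewrite sqmodM (_ : 2 = 1 + 1)//; apply: lerD; apply: sq.
  exact: norm_cosE.
exact: norm_sinE.
Qed.

Lemma measurable_cauchy_mean (s : R) : 0 < s ->
  measurable_fun setT (fun x : R => \int[P]_v cauchy s (x - Y v)).
Proof.
move=> s0; apply: continuous_measurable_fun => a.
have mc (x : R) : measurable_fun setT (fun v => cauchy s (x - Y v)).
  exact: (measurableT_comp (measurable_cauchy x s0) mY).
have cle (x : R) : `|cauchy s x| <= s^-1.
  by rewrite ger0_norm ?cauchy_ge0 ?cauchy_le.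
have := @continuity_under_integral R d T P (fun (x : R) v => cauchy s (x - Y v)) setT measurableT
  (a - 1) (a + 1) _ _ (cst s^-1) _ _.
apply.
- by move=> x _; apply: (@bounded_integrable _ _ _ _ s^-1).
- apply: aeW => v _ x _.
  have -> : (fun x : R => cauchy s (x - Y v)) = (fun x : R => cauchy s (Y v - x)).
    by apply/funext => y; exact: cauchyC.
  exact: continuous_cauchy.
- apply: (@bounded_integrable _ _ _ _ s^-1) => // w.
  by rewrite ger0_norm// invr_ge0 ltW.
- by move=> z _; apply: aeW => w _.
- by rewrite inE/= in_itv/= gtrBl ltrDl ltr01.
Qed.

Variable M : R.
Hypothesis M0 : 0 <= M.
Hypothesis YM : forall B : set R, measurable B ->
  (distribution P Y B <= M%:E * leb B)%E.

(** Under a law at most [M] times Lebesgue measure, the mean is at most [M] times the total integral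
    of the kernel. Truncating to [[-n, n]] makes that integral a difference of arctangents, smaller
    than [pi]. *)
Lemma cauchy_mean_le (s x : R) : 0 < s -> \int[P]_v cauchy s (x - Y v) <= M * pi.
Proof.
move=> s0.
pose D (n : nat) := `[(- n%:R : R), n%:R]%classic.
pose f n (y : R) := cauchy s (x - y) * \1_(D n) y.
have mf n : measurable_fun setT (f n).
  apply: measurable_funM; first exact: (measurable_cauchy x s0).
  by apply: measurable_indic; rewrite /D; exact: measurable_itv.
have f0 n y : 0 <= f n y by rewrite mulr_ge0// cauchy_ge0.
have fle n : \int[P]_v f n (Y v) <= M * pi.
  (* [Y'] is [Y] with its codomain viewed as [measurableTypeR R], so that its law can be compared
     with Lebesgue measure. *)
  have mY' : measurable_fun setT (Y : T -> measurableTypeR R) by exact: mY.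
  pose Y' : {mfun T >-> measurableTypeR R} := MeasurableFun.Pack
    (MeasurableFun.Class (isMeasurableFun.Build _ _ T (measurableTypeR R) Y mY')).
  have E1 : (\int[P]_v (f n (Y v))%:E = \int[distribution P Y']_y (f n y)%:E)%E.
    rewrite ge0_integral_distribution//; last by move=> y; rewrite lee_fin.
    by apply/measurable_EFinP; exact: mf.
  have E2 : (\int[leb]_y (f n y)%:E)%E = (atan ((n%:R - x) / s) - atan ((- n%:R - x) / s))%:E.
    rewrite -integral_cauchy//; last by rewrite ge0_cp.
    have ic : leb.-integrable (D n) (EFin \o (fun y => cauchy s (y - x))).
      apply: integrable_continuous_itv => y; under eq_fun do rewrite cauchyC.
      exact: continuous_cauchy.
    rewrite /Rintegral fineK ?integrable_fin_num// [RHS]integral_mkcond.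
    apply: eq_integral => y _; rewrite patchE /f indicE.
    by case: (y \in _); rewrite ?mulr1 ?mulr0// cauchyC.
  have le2 : (\int[leb]_y (f n y)%:E <= pi%:E)%E.
    rewrite E2 lee_fin.
    have := atan_ltpi2 ((n%:R - x) / s); have := atan_gtNpi2 ((- n%:R - x) / s).
    lra.
  have : (\int[P]_v (f n (Y v))%:E <= (M * pi)%:E)%E.
    rewrite E1; apply: (@le_trans _ _ (\int[mscale (NngNum M0) leb]_y (f n y)%:E)%E).
      apply: le_measure_integral => [A mA|y]; last by rewrite lee_fin.
      exact: YM.
    rewrite ge0_integral_mscale//.
    - by rewrite EFinM; apply: lee_wpmul2l; rewrite ?lee_fin//; exact: le2.
    - by apply/measurable_EFinP; exact: mf.
    - by move=> y _; rewrite lee_fin.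
  move=> H; rewrite -lee_fin /Rintegral fineK//.
  rewrite ge0_fin_numE; first exact: le_lt_trans H (ltry _).
  by apply: integral_ge0 => v _; rewrite lee_fin.
have L : \int[P]_v f n (Y v) @[n --> \oo] --> \int[P]_v cauchy s (x - Y v).
  apply: (@bounded_cvg_Rintegral _ _ _ _ s^-1).
  - by move=> n; exact: measurableT_comp.
  - exact: (measurableT_comp (measurable_cauchy x s0) mY).
  - move=> n v; rewrite ger0_norm// -[leRHS]mulr1; apply: ler_pM => //.
    + exact: cauchy_ge0.
    + exact: cauchy_le.
  - apply: aeW => v; apply: cvg_near_cst.
    have := nbhs_infty_ger `|Y v|; apply: filterS => n nY.
    rewrite /f indicE mem_set ?mulr1// /D/= in_itv/=.
    by rewrite -ler_norml.
exact: (@cvg_le _ _ (fun=> M * pi) _ _ L (cvg_cst _) fle).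
Qed.

(** Damping at rate [1 / L] costs at most a factor [expR 1] on [[0, L]], and the damped integral
    over the half-line is an average of Cauchy means, bounded independently of [L]. *)
Lemma sqmod_integral_bounded (L : R) : 0 < L ->
  \int[leb]_(z in `[0, L]) sqmod P (fun w => z * Y w) <= expR 1 * (M * pi).
Proof.
move=> L0; have s0 : 0 < L^-1 by rewrite invr_gt0.
have [ie _] := integral_expRN s0.
pose h z := expR (- L^-1 * z) * sqmod P (fun w => z * Y w).
have ch : continuous h.
  by move=> z; apply: cvgM; [exact: continuous_expRM|exact: continuous_sqmodM].
have h0 z : 0 <= h z by rewrite mulr_ge0 ?expR_ge0 ?sqmod_ge0.
have ih : leb.-integrable `[0, +oo[ (EFin \o h).
  have i2 := integrable_scale 2 _ ie.
  apply: le_integrable (i2 _) => //.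
    by apply/measurable_EFinP; apply: measurable_funTS; exact: continuous_measurable_fun.
  move=> z _ /=; rewrite lee_fin (ger0_norm (h0 z)) ger0_norm ?mulr_ge0 ?expR_ge0//.
  by rewrite /h mulrC ler_wpM2r ?expR_ge0 ?sqmod_le2.
have bound : \int[leb]_(z in `[0, +oo[) h z <= M * pi.
  rewrite /h abel_sqmod// -[leRHS](Rexp_cst P).
  have qle w : `|\int[P]_v cauchy L^-1 (Y w - Y v)| <= M * pi.
    by rewrite ger0_norm ?cauchy_mean_le// Rintegral_ge0// => v _; exact: cauchy_ge0.
  apply: le_Rintegral => //.
  - apply: (@bounded_integrable _ _ _ _ (M * pi)) => //.
    exact: (measurableT_comp (measurable_cauchy_mean s0) mY).
  - by apply: (@bounded_integrable _ _ _ _ `|M * pi|).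
  - by move=> w _; exact: cauchy_mean_le.
apply: (@le_trans _ _ (\int[leb]_(z in `[0, L]) (expR 1 * h z))).
  apply: le_Rintegral => //.
  - exact/integrable_continuous_itv/continuous_sqmodM.
  - by apply: integrable_scale => //; exact: integrable_continuous_itv.
  - move=> z; rewrite /= in_itv/= => /andP[z0 zL].
    rewrite mulrA -expRD ler_peMl ?sqmod_ge0// -[leLHS]expR0 ler_expR mulNr subr_ge0.
    by rewrite mulrC ler_pdivrMr// mul1r.
rewrite RintegralZl//; last exact: integrable_continuous_itv.
rewrite ler_wpM2l ?expR_ge0//; apply: le_trans bound.
have sub : `[0, L] `<=` (`[0, +oo[ : set R).
  by move=> z /=; rewrite !in_itv/= andbT => /andP[].
rewrite /Rintegral fine_le ?integrable_fin_num//.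
  exact: integrableS ih.
apply: ge0_subset_integral => //.
  by apply/measurable_EFinP; apply: measurable_funTS; exact: continuous_measurable_fun.
by move=> z _; rewrite lee_fin.
Qed.

End bounded_density.

(** * Fourier inversion *)

Section fourier.
Context (R : realType).
Notation leb := (@lebesgue_measure R).
Implicit Types g h : R -> R.

(* Only the half-line [0 <= z] matters, as the transforms are taken in real form. *)
Definition rapid g := continuous g /\ forall n : nat, exists B : R,
  forall z, 0 <= z -> `|g z| * z ^+ n <= B * (1 + z ^+ 2)^-1.

(** For even [g] and odd [h], this is [pi] times the inverse Fourier transform of [g + i h]. *)
Definition fourier g h (x : R) : R :=
  \int[leb]_(z in `[0, +oo[) (cos (z * x) * g z + sin (z * x) * h z).

Lemma integrable_oneDsqrV :
  leb.-integrable `[0, +oo[ (EFin \o (fun z : R => (1 + z ^+ 2)^-1)).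
Proof.
apply: (@FTC_half_line_integrable _ (fun z => (1 + z ^+ 2)^-1) atan (pi / 2)).
- by move=> z; rewrite invr_ge0 addr_ge0// sqr_ge0.
- exact: continuous_oneDsqrV.
- exact: cvgy_atan.
Qed.

Lemma rapid_mulz g : rapid g -> rapid (fun z => z * g z).
Proof.
move=> [cg gB]; split => [z|n].
  by apply: cvgM => //; exact: cg.
have [B HB] := gB n.+1; exists B => z z0.
by rewrite normrM ger0_norm// mulrC mulrA -exprSr mulrC HB.
Qed.

Lemma rapidZ (c : R) g : rapid g -> rapid (fun z => c * g z).
Proof.
move=> [cg gB]; split => [z|n].
  by apply: cvgM; [exact: cvg_cst|exact: cg].
have [B HB] := gB n; exists (`|c| * B) => z z0.
by rewrite normrM -!mulrA ler_wpM2l// HB.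
Qed.

Lemma rapid_le g : rapid g -> exists2 B : R, 0 <= B &
  forall z, 0 <= z -> `|g z| <= B * (1 + z ^+ 2)^-1.
Proof.
move=> [_ /(_ 0%N)[B HB]]; exists `|B| => // z z0.
have := HB z z0; rewrite expr0 mulr1 => /le_trans; apply.
by rewrite ler_wpM2r ?ler_norm// invr_ge0 addr_ge0// sqr_ge0.
Qed.

Section rapid_pair.
Variables (g h : R -> R).
Hypotheses (rg : rapid g) (rh : rapid h).

Let f (x z : R) := cos (z * x) * g z + sin (z * x) * h z.

Let cf x : continuous (f x).
Proof.
move=> z; apply: cvgD; apply: cvgM.
- exact: continuous_cosMr.
- by case: rg => + _; apply.
- exact: continuous_sinMr.
- by case: rh => + _; apply.
Qed.

Lemma rapid_pair_le : exists2 B : R, 0 <= B & forall x z, 0 <= z ->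
  `|cos (z * x) * g z + sin (z * x) * h z| <= B * (1 + z ^+ 2)^-1.
Proof.
have [B1 B10 H1] := rapid_le rg; have [B2 B20 H2] := rapid_le rh.
exists (B1 + B2) => [|x z z0]; first exact: addr_ge0.
rewrite (le_trans (ler_normD _ _))// mulrDl !normrM; apply: lerD.
  by rewrite (le_trans _ (H1 z z0))// ler_piMl// cos_max.
by rewrite (le_trans _ (H2 z z0))// ler_piMl// sin_max.
Qed.

Lemma integrable_fourier x : leb.-integrable `[0, +oo[ (EFin \o f x).
Proof.
have [B B0 HB] := rapid_pair_le.
have iB := integrable_scale B _ integrable_oneDsqrV.
apply: le_integrable (iB _) => //.
  by apply/measurable_EFinP; apply: measurable_funTS; exact: continuous_measurable_fun.
move=> z; rewrite /= in_itv/= andbT => z0; rewrite lee_fin (le_trans (HB x z z0))//.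
by rewrite ler_norm.
Qed.

Lemma fourier_bounded : exists2 B : R, 0 <= B & forall x, `|fourier g h x| <= B.
Proof.
have [B B0 HB] := rapid_pair_le.
have iB := integrable_scale B _ integrable_oneDsqrV.
exists (\int[leb]_(z in `[0, +oo[) (B * (1 + z ^+ 2)^-1)).
  by apply: Rintegral_ge0 => z _; rewrite mulr_ge0// invr_ge0 addr_ge0// sqr_ge0.
move=> x; rewrite (le_trans (le_normr_Rintegral _ _))//; first exact: integrable_fourier.
apply: le_Rintegral => //.
- by apply: eq_integrable (integrable_abse (integrable_fourier x)).
- exact: iB.
- by move=> z; rewrite /= in_itv/= andbT => z0; exact: HB.
Qed.

End rapid_pair.

(** Differentiation stays within the family: multiplication by [z] preserves rapid decay, so the
    lemma can be iterated. The sign is written [-1 *] to be covered by [rapidZ]. *)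
Lemma is_derive_fourier g h (x : R) : rapid g -> rapid h ->
  is_derive x 1 (fourier g h) (fourier (fun z => z * h z) (fun z => -1 * (z * g z)) x).
Proof.
move=> rg rh.
have rzg := rapidZ (-1) (rapid_mulz rg); have rzh := rapid_mulz rh.
pose f (x z : R) := cos (z * x) * g z + sin (z * x) * h z.
have df (y z : R) : is_derive y 1 (f ^~ z)
    (cos (z * y) * (z * h z) + sin (z * y) * (-1 * (z * g z))).
  have d2 : is_derive y 1 (fun y : R => z * y) z.
    by apply: is_derive_eq; rewrite /GRing.scale/=; ring.
  have d3 := @is_derive1_comp _ sin (fun y => z * y) y _ _ (is_derive_sin _) d2.
  have d4 := @is_derive1_comp _ cos (fun y => z * y) y _ _ (is_derive_cos _) d2.
  have d3' : is_derive y 1 (fun y => sin (z * y)) (cos (z * y) * z) by exact: d3.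
  have d4' : is_derive y 1 (fun y => cos (z * y)) (- sin (z * y) * z) by exact: d4.
  by rewrite /f; apply: is_derive_eq; rewrite /GRing.scale/=; ring.
have [B B0 HB] := rapid_pair_le rzh rzg.
have d1E y z : partial1of2 f y z =
    cos (z * y) * (z * h z) + sin (z * y) * (-1 * (z * g z)).
  by rewrite partial1of2E; have [_ ->] := df y z.
have mD : measurable (`[0, +oo[ : set R) by [].
have Ix : `]x - 1, x + 1[%classic x by rewrite /= in_itv/= gtrBl ltrDl ltr01.
pose G z := B * (1 + z ^+ 2)^-1.
have G0 z : 0 <= G z by rewrite mulr_ge0// invr_ge0 addr_ge0// sqr_ge0.
have iG : leb.-integrable `[0, +oo[ (EFin \o G).
  by apply: integrable_scale => //; exact: integrable_oneDsqrV.
have ifx y : `]x - 1, x + 1[%classic y -> leb.-integrable `[0, +oo[ (EFin \o f y).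
  by move=> _; exact: integrable_fourier.
have derf y z : `]x - 1, x + 1[%classic y -> `[(0:R), +oo[%classic z -> derivable (f ^~ z) y 1.
  by move=> _ _; have [] := df y z.
have Gub y z : `]x - 1, x + 1[%classic y -> `[(0:R), +oo[%classic z ->
    `|partial1of2 f y z| <= G z.
  by move=> _; rewrite /= in_itv/= andbT => z0; rewrite d1E; exact: HB.
have H1 := @derivable_under_integral R _ (measurableTypeR R) leb f _ mD x _ _
  Ix ifx derf G G0 iG Gub.
have H2 := @differentiation_under_integral R _ (measurableTypeR R) leb f _ mD x _ _
  Ix ifx derf G G0 iG Gub.
apply: DeriveDef; first exact: H1.
rewrite -derive1E H2; apply: eq_Rintegral => z _; exact: d1E.
Qed.

Lemma Cb_infty_fourier g h : rapid g -> rapid h -> Cb_infty (fourier g h).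
Proof.
move=> rg rh.
have main n : exists g' h', [/\ rapid g', rapid h' & derive1n n (fourier g h) = fourier g' h'].
  elim: n => [|n [g' [h' [rg' rh' E]]]]; first by exists g, h.
  exists (fun z => z * h' z), (fun z => -1 * (z * g' z)); split.
  - exact: rapid_mulz.
  - exact/rapidZ/rapid_mulz.
  - apply/funext => x; rewrite derive1nS E derive1E.
    by have [_ ->] := is_derive_fourier x rg' rh'.
move=> n; have [g' [h' [rg' rh' ->]]] := main n; split.
  by move=> x; have [] := is_derive_fourier x rg' rh'.
have [B B0 HB] := fourier_bounded rg' rh'.
exists B; split; first exact: num_real.
by move=> M BM x _; exact: le_trans (HB x) (ltW BM).
Qed.

End fourier.

(** At [c = 0] the limit is 0, half-way between the two others: an atom at an end of an interval
    would thus be counted with half its mass, which is why [no_atom] is proved before [F_itv]. *)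
Lemma cvg_atanM (R : realType) (c : R) :
  atan (c * n.+1%:R) @[n --> \oo] --> pi / 2 * Num.sg c.
Proof.
have pos (b : R) : 0 < b -> atan (b * n.+1%:R) @[n --> \oo] --> pi / 2.
  move=> b0; apply: (cvg_comp _ _ _ (@cvgy_atan R)).
  apply/cvgryPge => M.
  apply: filterS (nbhs_infty_ger (b^-1 * M)) => n Hn.
  by rewrite -ler_pdivrMl// (le_trans Hn)// ler_nat.
have [c0|c0|<-] := ltgtP 0 c.
- by rewrite gtr0_sg// mulr1; exact: pos.
- rewrite ltr0_sg// mulrN1.
  have L : atan (- c * n.+1%:R) @[n --> \oo] --> pi / 2 by apply: pos; rewrite oppr_gt0.
  have -> : (fun n => atan (c * n.+1%:R)) = (fun n => - atan (- c * n.+1%:R)).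
    by apply/funext => n; rewrite mulNr atanN opprK.
  exact: cvgN.
- rewrite sgr0 mulr0.
  have -> : (fun n => atan (0 * n.+1%:R)) = (fun=> 0 : R).
    by apply/funext => n; rewrite mul0r atan0.
  exact: cvg_cst.
Qed.

Section density_measure.
Context (R : realType).
Notation leb := (@lebesgue_measure R).
Variable p : R -> R.
Hypotheses (mp : measurable_fun setT p) (p0 : forall x, 0 <= p x).

(* The hypotheses are arguments so that the measure structure can be inferred. *)
Definition density_measure of measurable_fun setT p & (forall x, 0 <= p x) :=
  fun A : set (measurableTypeR R) => (\int[leb]_(x in A) (p x)%:E)%E.

Local Notation nu := (density_measure mp p0).

Let nu0 : nu set0 = 0%E. Proof. by rewrite /density_measure integral_set0. Qed.

Let nu_ge0 A : (0 <= nu A)%E.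
Proof. by apply: integral_ge0 => x _; rewrite lee_fin. Qed.

Let nu_sigma_additive : semi_sigma_additive nu.
Proof.
apply: semi_sigma_additive_nng_induced => [|x]; last by rewrite lee_fin.
by apply/measurable_EFinP; exact: mp.
Qed.

HB.instance Definition _ := isMeasure.Build _ _ _ nu nu0 nu_ge0 nu_sigma_additive.

Lemma density_of_itv d (T : measurableType d) (P : probability T R) (Y : {RV P >-> R}) :
  (forall a b, a <= b ->
    distribution P Y `]a, b]%classic = (\int[leb]_(x in `]a, b]) (p x)%:E)%E) ->
  is_density P Y p.
Proof.
move=> Yp; split => // B mB.
have mY : measurable_fun setT Y by [].
have mY' : measurable_fun setT (Y : T -> measurableTypeR R) by exact: mY.
pose Y' : {mfun T >-> measurableTypeR R} := MeasurableFun.Pack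
  (MeasurableFun.Class (isMeasurableFun.Build _ _ T (measurableTypeR R) Y mY')).
apply: (@measure_unique _ R (measurableTypeR R) (@ocitv R)
  (fun k => `](- k%:R : R), k%:R]%classic) _ _ _ _ (distribution P Y') nu) => //.
- exact: ocitvI.
- by move=> k; exact: is_ocitv.
- rewrite -subTset => x _; exists (Num.bound `|x|) => //=; rewrite in_itv/=.
  have := archi_boundP (normr_ge0 x).
  by rewrite ltr_norml => /andP[-> /ltW].
- move=> _ [[a b] _ <-] /=; have [ab|ba] := leP a b; first exact: Yp.
  by rewrite set_itv_ge ?measure0// bnd_simp -leNgt ltW.
- move=> k; rewrite (@le_lt_trans _ _ 1%E) ?ltry//.
  exact: probability_le1.
Qed.

End density_measure.

Section inversion.
Context d (T : measurableType d) (R : realType) (P : probability T R).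
Notation leb := (@lebesgue_measure R).
Variable Y : {RV P >-> R}.
Let mY : measurable_fun setT Y. Proof. by []. Qed.
Hypotheses (rc : rapid (cosE P Y)) (rs : rapid (sinE P Y)).

Let s n : R := n.+1%:R^-1.
Let s0 n : 0 < s n. Proof. by rewrite invr_gt0. Qed.

(** Up to the factor [pi], the density of [Y] plus an independent Cauchy variable of scale [s n]. *)
Let q n x := \int[P]_w cauchy (s n) (x - Y w).
Let F := fourier (cosE P Y) (sinE P Y).

Let q_ge0 n x : 0 <= q n x.
Proof. by apply: Rintegral_ge0 => w _; exact: cauchy_ge0. Qed.

Let expR_le1 n z : 0 <= z -> expR (- s n * z) <= 1.
Proof. by move=> z0; rewrite -[leRHS]expR0 ler_expR mulNr oppr_le0 mulr_ge0// ltW. Qed.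

(** Damping only lowers the absolute value of the integrand of [abel_transform], so the majorant
    given by rapid decay serves for all [n] and [x] at once. *)
Let q_bounded : exists2 B : R, 0 <= B & forall n x, q n x <= B.
Proof.
have [B B0 HB] := rapid_pair_le rc rs.
have iB := integrable_scale B _ (integrable_oneDsqrV R).
have B'0 z : 0 <= B * (1 + z ^+ 2)^-1 by rewrite mulr_ge0// invr_ge0 addr_ge0// sqr_ge0.
exists (\int[leb]_(z in `[0, +oo[) (B * (1 + z ^+ 2)^-1)).
  by apply: Rintegral_ge0 => z _.
move=> n x; rewrite /q -(@abel_transform _ _ _ P _ mY _ x (s0 n)).
have ck : continuous (fun z => expR (- s n * z) *
    (cos (z * x) * cosE P Y z + sin (z * x) * sinE P Y z)).
  move=> z; apply: cvgM; first exact: continuous_expRM.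
  by apply: cvgD; apply: cvgM; [exact: continuous_cosMr|case: rc => + _; apply|
    exact: continuous_sinMr|case: rs => + _; apply].
have le z : 0 <= z -> `|expR (- s n * z) *
    (cos (z * x) * cosE P Y z + sin (z * x) * sinE P Y z)| <= B * (1 + z ^+ 2)^-1.
  move=> z0; rewrite normrM ger0_norm ?expR_ge0//.
  by rewrite (le_trans _ (HB x z z0))// ler_piMl ?expR_le1.
apply: le_Rintegral => //.
- apply: le_integrable (iB _) => //.
    by apply/measurable_EFinP; apply: measurable_funTS; exact: continuous_measurable_fun.
  move=> z; rewrite /= in_itv/= andbT => z0; rewrite lee_fin (le_trans (le z z0))//.
  by rewrite ler_norm.
- exact: iB.
- move=> z; rewrite /= in_itv/= andbT => z0.
  by apply: le_trans (le z z0); rewrite ler_norm.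
Qed.

Let cvg_q x : q n x @[n --> \oo] --> F x.
Proof.
have -> : q^~ x = (fun n => \int[leb]_(z in `[0, +oo[) (expR (- s n * z) *
    (cos (z * x) * cosE P Y z + sin (z * x) * sinE P Y z))).
  by apply/funext => n; rewrite abel_transform.
rewrite /F /fourier; have [B B0 HB] := rapid_pair_le rc rs.
have iB := integrable_scale B _ (integrable_oneDsqrV R).
apply: (@cvg_Rintegral_dominated _ (measurableTypeR R) R leb `[0, +oo[%classic
  (fun z => B * (1 + z ^+ 2)^-1) (fun n z => expR (- s n * z) *
    (cos (z * x) * cosE P Y z + sin (z * x) * sinE P Y z))
    (fun z => cos (z * x) * cosE P Y z + sin (z * x) * sinE P Y z)) => //.
- move=> n; apply: measurable_funTS; apply: continuous_measurable_fun.
  move=> z; apply: cvgM; first exact: continuous_expRM.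
  by apply: cvgD; apply: cvgM; [exact: continuous_cosMr|case: rc => + _; apply|
    exact: continuous_sinMr|case: rs => + _; apply].
- exact: iB.
- move=> n z; rewrite /= in_itv/= andbT => z0.
  rewrite normrM ger0_norm ?expR_ge0//.
  by rewrite (le_trans _ (HB x z z0))// ler_piMl ?expR_le1.
- move=> z _; rewrite -[X in _ --> X]mul1r; apply: cvgM; last exact: cvg_cst.
  rewrite -expR0.
  have H : - s n * z @[n --> \oo] --> (0 : R).
    rewrite -[0](mul0r z); apply: cvgM; last exact: cvg_cst.
    by rewrite -oppr0; apply: cvgN; exact: cvg_harmonic.
  exact: (cvg_comp _ _ H (@continuous_expR R _)).
Qed.

Let measurable_q n : measurable_fun setT (q n).
Proof. exact: measurable_cauchy_mean. Qed.

Let F_ge0 x : 0 <= F x.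
Proof. exact: (cvg_le (cvg_cst 0) (@cvg_q x)). Qed.

Let continuous_F : continuous F.
Proof. by move=> x; apply: continuous_of_derive => y; exact: is_derive_fourier. Qed.

(* The Cauchy means of [Y], as functions of [x], tend to [F] and have arctangent
   primitives, which tend to signs. *)
Let integral_F a b : a <= b -> \int[leb]_(x in `[a, b]) F x =
  \int[P]_w (pi / 2 * (Num.sg (b - Y w) - Num.sg (a - Y w))).
Proof.
move=> ab; have [B B0 qB] := q_bounded.
have L1 : \int[leb]_(x in `[a, b]) q n x @[n --> \oo] --> \int[leb]_(x in `[a, b]) F x.
  apply: (@cvg_Rintegral_bounded _ _ _ _ _ B) => //.
  - by rewrite /= lebesgue_measure_itv/=; case: ifPn => //; rewrite -EFinB ltry.
  - by move=> n; apply: measurable_funTS; exact: measurable_q.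
  - by move=> n x _; rewrite ger0_norm.
have E n : \int[leb]_(x in `[a, b]) q n x =
    \int[P]_w (atan ((b - Y w) * n.+1%:R) - atan ((a - Y w) * n.+1%:R)).
  rewrite -(@Fubini_dominated _ _ _ P _ (fun w => cauchy (s n) (w.2 - Y w.1)) (cst (s n)^-1))//.
  - by apply: eq_Rintegral => w _ /=; rewrite integral_cauchy// /s invrK.
  - have m2 : measurable_fun setT (fun w : T * R => Y w.1 - w.2).
      by apply: measurable_funB => //; exact: measurableT_comp.
    have := measurableT_comp (measurable_cauchy 0 (s0 n)) m2.
    by congr (measurable_fun _ _); apply/funext => w /=; rewrite sub0r opprB.
  - by apply: integrable_continuous_itv => x; exact: cvg_cst.
  - by move=> w z _; rewrite ger0_norm ?cauchy_ge0 ?cauchy_le.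
have m1 (c : R) n : measurable_fun setT (fun w => atan ((c - Y w) * n.+1%:R)).
  apply: (@measurableT_comp _ _ _ _ _ _ (@atan R)).
    by apply: continuous_measurable_fun; exact: continuous_atan.
  by apply: measurable_funM => //; exact: measurable_funB.
have cv w : atan ((b - Y w) * n.+1%:R) - atan ((a - Y w) * n.+1%:R)
    @[n --> \oo] --> pi / 2 * (Num.sg (b - Y w) - Num.sg (a - Y w)).
  by rewrite mulrBr; apply: cvgB; exact: cvg_atanM.
have L2 : \int[P]_w (atan ((b - Y w) * n.+1%:R) - atan ((a - Y w) * n.+1%:R)) @[n --> \oo] -->
    \int[P]_w (pi / 2 * (Num.sg (b - Y w) - Num.sg (a - Y w))).
  apply: (@bounded_cvg_Rintegral _ _ _ _ pi).
  - by move=> n; apply: measurable_funB; exact: m1.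
  - apply: (@measurable_fun_cvg _ _ _ _ (fun n w =>
      atan ((b - Y w) * n.+1%:R) - atan ((a - Y w) * n.+1%:R))) => [n|w _].
      by apply: measurable_funB; exact: m1.
    exact: cv.
  - move=> n w; rewrite ler_norml.
    have := atan_ltpi2 ((b - Y w) * n.+1%:R); have := atan_gtNpi2 ((a - Y w) * n.+1%:R).
    have := atan_ltpi2 ((a - Y w) * n.+1%:R); have := atan_gtNpi2 ((b - Y w) * n.+1%:R).
    move=> h1 h2 h3 h4; apply/andP; split; lra.
  - exact: aeW.
have L1' : \int[P]_w (atan ((b - Y w) * n.+1%:R) - atan ((a - Y w) * n.+1%:R))
    @[n --> \oo] --> \int[leb]_(x in `[a, b]) F x.
  by under eq_cvg do rewrite -E.
exact: (cvg_unique _ L1' L2).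
Qed.

Let sg_bounded (x y : R) : `|pi / 2 * (Num.sg x - Num.sg y)| <= pi.
Proof.
have p0 := pi_gt0 R.
rewrite normrM gtr0_norm ?divr_gt0// -ler_pdivlMl ?divr_gt0//.
apply: le_trans (ler_normB _ _) _.
have sg1 (z : R) : `|Num.sg z| <= 1 by rewrite normr_sg; case: (z != 0).
by rewrite (le_trans (lerD (sg1 _) (sg1 _)))// invf_div mulfVK ?gt_eqF.
Qed.

Let measurable_sgY (c : R) : measurable_fun setT (fun w => Num.sg (c - Y w)).
Proof.
have m1 n : measurable_fun setT (fun w => (pi / 2)^-1 * atan ((c - Y w) * n.+1%:R)).
  apply: measurable_funM => //; apply: (@measurableT_comp _ _ _ _ _ _ (@atan R)).
    by apply: continuous_measurable_fun; exact: continuous_atan.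
  by apply: measurable_funM => //; exact: measurable_funB.
apply: measurable_fun_cvg m1 _ => w _.
have pi20 : pi / 2 != 0 :> R by rewrite gt_eqF// divr_gt0// pi_gt0.
rewrite -[X in _ --> X](mulKf pi20); apply: cvgM; first exact: cvg_cst.
exact: cvg_atanM.
Qed.

Let measurable_sgB (a b : R) : measurable_fun setT
  (fun w => pi / 2 * (Num.sg (b - Y w) - Num.sg (a - Y w))).
Proof. by apply: measurable_funM => //; exact: measurable_funB. Qed.

Let F_bounded : exists2 B : R, 0 <= B & forall x, F x <= B.
Proof.
have [B B0 HB] := fourier_bounded rc rs; exists B => // x.
by rewrite (le_trans _ (HB x))// ler_norm.
Qed.

(** In [integral_F] over [[c, c + e]], an atom of mass [r] at [c] contributes [pi / 2 * r] to the
    right side, while the left side is at most [B * e]; a small [e] gives a contradiction. *)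
Let no_atom (c : R) : P (Y @^-1` [set c]) = 0%E.
Proof.
have mA : measurable (Y @^-1` [set c]) by rewrite -[X in measurable X]setTI; exact: mY.
have [B B0 FB] := F_bounded.
have p0 := pi_gt0 R.
pose r := fine (P (Y @^-1` [set c])).
have rE : P (Y @^-1` [set c]) = r%:E by rewrite /r fineK ?fin_num_measure.
have le (e : R) : 0 < e -> pi / 2 * r <= B * e.
  move=> e0.
  have -> : pi / 2 * r = \int[P]_w (pi / 2 * \1_(Y @^-1` [set c]) w).
    rewrite RintegralZl//; last first.
      apply: integrable_indic_on => //.
      by rewrite (@le_lt_trans _ _ 1%E)// ?probability_le1 ?ltry.
    by rewrite /Rintegral integral_indic// setIT.
  apply: (@le_trans _ _ (\int[P]_w (pi / 2 * (Num.sg (c + e - Y w) - Num.sg (c - Y w))))).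
    apply: le_Rintegral => //.
    - apply: integrable_scale => //; apply: integrable_indic_on => //.
      by rewrite (@le_lt_trans _ _ 1%E)// ?probability_le1 ?ltry.
    - by apply: (@bounded_integrable _ _ _ _ pi).
    - move=> w _; rewrite ler_pM2l ?divr_gt0// indicE.
      case: (boolP (w \in _)) => [|_].
        by rewrite inE/= => ->; rewrite subrr sgr0 subr0 addrAC subrr add0r gtr0_sg.
      rewrite subr_ge0; have : c - Y w <= c + e - Y w by lra.
      case: (sgrP (c - Y w)) => h1; case: sgrP => h2 //; lra.
  rewrite -integral_F; last by rewrite lerDl ltW.
  apply: (@le_trans _ _ (\int[leb]_(x in `[c, (c + e)%R]) B)).
    apply: le_Rintegral => //.
    - exact: integrable_continuous_itv.
    - by apply: integrable_continuous_itv => x; exact: cvg_cst.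
  rewrite -Rintegral_itv_bndo_bndc; last first.
    have iB : leb.-integrable `[c, (c + e)%R] (EFin \o cst B).
      by apply: integrable_continuous_itv => x; exact: cvg_cst.
    by apply: integrableS iB => //; exact: subset_itv_co_cc.
  rewrite Rintegral_cst_co; last by rewrite lerDl ltW.
  by rewrite addrAC subrr add0r.
rewrite rE; congr EFin; apply/eqP; rewrite eq_le; apply/andP; split; last first.
  by rewrite -lee_fin -rE.
rewrite leNgt; apply/negP => r0.
have B1 : 0 < B + 1 by rewrite ltr_pwDr.
(* Chosen so that [B * e] is at most half of [pi / 2 * r]; the denominator is [B + 1] as [B] may be
   0. *)
have /le : 0 < pi / 2 * r / (B + 1) / 2 by rewrite !divr_gt0// mulr_gt0// divr_gt0.
have k0 : 0 < pi / 2 * r by rewrite mulr_gt0// divr_gt0.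
move: k0; set k := pi / 2 * r => k0.
have -> : B * (k / (B + 1) / 2) = k * (B / (B + 1)) / 2 by field; rewrite gt_eqF.
have : k * (B / (B + 1)) <= k.
  by rewrite ler_piMr ?ltW// ltr_pdivrMr// mul1r ltrDl.
move: (k * _) => k'; lra.
Qed.

Let F_itv (a b : R) : a <= b ->
  distribution P Y `]a, b]%classic = (\int[leb]_(x in `]a, b]) (pi^-1 * F x)%:E)%E.
Proof.
move=> ab; have p0 := pi_gt0 R.
have mA : measurable (Y @^-1` `]a, b]) by rewrite -[X in measurable X]setTI; exact: mY.
have iF : leb.-integrable `[a, b] (EFin \o (fun x => pi^-1 * F x)).
  by apply: integrable_scale => //; exact: integrable_continuous_itv.
rewrite integral_itv_obnd_cbnd; last first.
  apply/measurable_EFinP; apply: measurable_funTS; apply: continuous_measurable_fun => x.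
  by apply: cvgM; [exact: cvg_cst|exact: continuous_F].
have <- : (\int[leb]_(x in `[a, b]) (pi^-1 * F x))%:E =
    (\int[leb]_(x in `[a, b]) (pi^-1 * F x)%:E)%E.
  by rewrite /Rintegral fineK// integrable_fin_num.
rewrite RintegralZl//; last exact: integrable_continuous_itv.
rewrite integral_F// -RintegralZl//; last exact: (@bounded_integrable _ _ _ _ pi).
rewrite (@ae_eq_Rintegral _ _ _ _ _ (\1_(Y @^-1` `]a, b]))).
- rewrite /Rintegral integral_indic// setIT fineK ?fin_num_measure//.
- by apply: measurable_funM.
- by [].
(* Off the two null events that [Y] is [a] or [b], the difference of signs is twice the indicator of
   []a, b]], and [pi^-1 * (pi / 2) * 2 = 1]. *)
- have neg c : {ae P, forall w, Y w <> c}.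
    exists (Y @^-1` [set c]); split; last by move=> w /= /contrapT.
      by rewrite -[X in measurable X]setTI; exact: mY.
    exact: no_atom.
  apply: filterS2 (neg a) (neg b) => w /eqP wa /eqP wb.
  rewrite mulrA mulrA [pi^-1 * _]mulrC mulrAC divff ?gt_eqF// mul1r indicE.
  case: (boolP (w \in _)); rewrite ?inE/= ?notin_setE/= in_itv/=.
    move=> /andP[h1 h2].
    rewrite gtr0_sg ?subr_gt0 ?lt_neqAle ?wb//= ltr0_sg ?subr_lt0//; lra.
  move=> /negP; rewrite negb_and -leNgt -ltNge => /orP[h|h].
    have ha : Y w < a by rewrite lt_neqAle wa.
    by rewrite !gtr0_sg ?subr_gt0 ?(lt_le_trans ha)// subrr mul0r.
  by rewrite !ltr0_sg ?subr_lt0 ?(le_lt_trans ab)// subrr mul0r.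
Qed.

Lemma density_of_rapid : exists2 p, is_density P Y p & Cb_infty p.
Proof.
exists (fun x => pi^-1 * F x).
  apply: density_of_itv; last exact: F_itv.
  - apply: continuous_measurable_fun => x; apply: cvgM; first exact: cvg_cst.
    exact: continuous_F.
  - by move=> x; rewrite mulr_ge0// invr_ge0 pi_ge0.
have -> : (fun x => pi^-1 * F x) =
    fourier (fun z => pi^-1 * cosE P Y z) (fun z => pi^-1 * sinE P Y z).
  apply/funext => x; rewrite /F /fourier -RintegralZl//; last exact: integrable_fourier.
  by apply: eq_Rintegral => z _; rewrite mulrDr !mulrA ![_ * pi^-1]mulrC.
by apply: Cb_infty_fourier; exact: rapidZ.
Qed.

End inversion.

(** * The equivalence *)

Section growth.
Context (R : realType) (Pi : {measure set R -> \bar R}).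
Hypothesis HPi : is_levy_measure Pi.

Lemma levy_growth_scale (eps : R) : 0 < eps ->
  (\int[Pi]_u (Num.min (u ^+ 2) (eps ^+ 2))%:E = (eps ^+ 2 * levy_growth Pi eps^-1)%:E)%E.
Proof.
move=> e0; have ig := integrable_levy_min HPi eps^-1.
rewrite EFinM /levy_growth /Rintegral fineK; last by apply: integrable_fin_num => //; exact: ig.
rewrite -integralZl//; apply: eq_integral => u _ /=; rewrite -EFinM; congr EFin.
rewrite minr_pMr ?sqr_ge0// mulr1 exprMn exprVn mulrA divff ?mul1r//.
by rewrite sqrf_eq0 gt_eqF.
Qed.

Lemma levy_growth_homo (y z : R) : 0 <= y -> y <= z -> levy_growth Pi y <= levy_growth Pi z.
Proof.
move=> y0 yz; apply: le_Rintegral => //; [exact: integrable_levy_min..|].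
move=> u _; rewrite le_min ge_min ge_min lexx orbT andbT; apply/orP; left.
by rewrite !exprMn ler_wpM2r ?sqr_ge0// ler_sqr ?nnegrE// (le_trans y0).
Qed.

(** The substitution [z = 1 / eps]. Thresholds are raised to at least 1 so that the logarithm in the
    denominator is positive. *)
Lemma levy_growth_cond :
  (((eps ^+ 2 * ln (1 / eps))^-1%:E * \int[Pi]_u (Num.min (u ^+ 2) (eps ^+ 2))%:E)%E
    @[eps --> 0^'+] --> +oo%E) <->
  (forall K : R, \forall z \near +oo, K * ln z <= levy_growth Pi z).
Proof.
have E (eps : R) : 0 < eps -> eps < 1 ->
    ((eps ^+ 2 * ln (1 / eps))^-1%:E * \int[Pi]_u (Num.min (u ^+ 2) (eps ^+ 2))%:E)%E =
    (levy_growth Pi eps^-1 / ln eps^-1)%:E.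
  move=> e0 e1; rewrite levy_growth_scale// -EFinM div1r; congr EFin.
  have l0 : 0 < ln eps^-1 by rewrite ln_gt0// invf_gt1.
  by field; rewrite !gt_eqF.
split=> [/cvgeyPge H K|H].
  have [e /= e0 He] := H K.
  exists (Num.max 1 e^-1); split; first exact: num_real.
  move=> z; rewrite gt_max => /andP[z1 ez].
  have z0 : 0 < z by exact: lt_trans z1.
  have zV0 : 0 < z^-1 by rewrite invr_gt0.
  have := He z^-1; rewrite /= sub0r normrN gtr0_norm// invf_plt ?posrE// => /(_ ez zV0).
  by rewrite E// ?invf_lt1// lee_fin invrK ler_pdivlMr// ln_gt0.
apply/cvgeyPge => K; have [M [_ HM]] := H K.
have M1 : 0 < Num.max 1 M by rewrite lt_max ltr01.
exists (Num.max 1 M)^-1; first by rewrite /= invr_gt0.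
move=> eps /=; rewrite sub0r normrN => + e0; rewrite gtr0_norm// => eM.
have : Num.max 1 M < eps^-1 by rewrite invf_pgt ?posrE.
rewrite gt_max => /andP[e1 Me].
rewrite E//; last by rewrite -invf_gt1.
by rewrite lee_fin ler_pdivlMr ?ln_gt0//; exact: HM.
Qed.

End growth.

Lemma rapid_of_decay (R : realType) (f : R -> R) : continuous f ->
  (forall z, `|f z| <= 1) ->
  (forall N : nat, \forall z \near +oo, `|f z| <= expR (- (N%:R * ln z))) ->
  rapid f.
Proof.
move=> cf f1 fN; split => // n.
(* The two powers beyond [n] pay for the factor [1 + z ^+ 2]. *)
have [M [_ HM]] := fN n.+2.
pose z0 := Num.max 1 M.
have z01 : 1 <= z0 by rewrite le_max lexx.
(* The second term serves up to [z0], where only [|f| <= 1] is used; the 2 serves beyond, as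
   [(1 + z^2) / z^2 <= 2] for [z >= 1]. *)
exists (2 + z0 ^+ n * (1 + z0 ^+ 2)) => z zge0.
have d0 : 0 < 1 + z ^+ 2 by rewrite ltr_pwDl// sqr_ge0.
rewrite ler_pdivlMr//; have [zz|zz] := leP z z0.
  apply: (@le_trans _ _ (z0 ^+ n * (1 + z0 ^+ 2))); last by rewrite lerDr.
  apply: ler_pM => //; [by rewrite mulr_ge0// exprn_ge0|exact: ltW| |].
    rewrite -[leRHS]mul1r; apply: ler_pM => //; first by rewrite exprn_ge0.
    by apply: lerXn2r; rewrite ?nnegrE// (le_trans zge0).
  by rewrite lerD2l; apply: lerXn2r; rewrite ?nnegrE// (le_trans zge0).
move: zz; rewrite gt_max => /andP[z1 Mz].
have zp : 0 < z by exact: lt_trans z1.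
apply: (@le_trans _ _ 2); last first.
  by rewrite lerDl mulr_ge0// ?exprn_ge0 ?addr_ge0 ?sqr_ge0 ?(le_trans _ z01).
have := HM z Mz; rewrite expRN mulr_natl -lnXn// lnK ?posrE ?exprn_gt0// => fz.
apply: (@le_trans _ _ ((z ^+ n.+2)^-1 * z ^+ n * (1 + z ^+ 2))).
  by apply: ler_wpM2r; [exact: ltW|apply: ler_wpM2r => //; exact: exprn_ge0].
have -> : (z ^+ n.+2)^-1 * z ^+ n = (z ^+ 2)^-1.
  by rewrite -addn2 exprD invfM mulrAC mulVf ?mul1r ?expf_neq0 ?gt_eqF.
rewrite ler_pdivrMl ?exprn_gt0//.
have : 1 <= z ^+ 2 by rewrite expr_ge1// ltW.
lra.
Qed.

Lemma density_le_measure d (T : measurableType d) (R : realType) (P : probability T R)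
    (Y : {RV P >-> R}) (p : R -> R) (M : R) : 0 <= M ->
  is_density P Y p -> (forall x, p x <= M) -> forall B : set R, measurable B ->
  (distribution P Y B <= M%:E * (@lebesgue_measure R) B)%E.
Proof.
move=> M0 [mp p0 Yp] pM B mB; rewrite Yp// -integral_cst//.
apply: ge0_le_integral => //.
- by move=> x _; rewrite lee_fin.
- by apply/measurable_EFinP; apply: measurable_funTS; exact: mp.
- by move=> x _; rewrite lee_fin.
Qed.

Section equivalence.
Context (R : realType) (d : measure_display) (T : measurableType d) (P : probability T R).
Notation leb := (@lebesgue_measure R).
Variables (A : R) (Pi : {measure set R -> \bar R}) (X : R -> {RV P >-> R}).
Hypothesis A0 : A != 0.
Hypothesis HPi : is_levy_measure Pi.
Hypothesis mE : forall t z : R, 0 < t ->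
  expR (- (2 * \sum_(k < n.+1) t / n.+1%:R *
    levy_exp Pi (z * expR (A * (t - grid 0 t n.+1 k))))) @[n --> \oo] -->
  sqmod P (fun w => z * X t w).

Lemma smooth_density (t : R) : 0 < t ->
  (forall K : R, \forall z \near +oo, K * ln z <= levy_growth Pi z) ->
  exists2 p, is_density P (X t) p & Cb_infty p.
Proof.
move=> t0 growth.
have [c c0 Hc] := transform_upper HPi A0 t0 (fun z => @mE t z t0).
have decay (N : nat) : \forall z \near +oo,
    sqmod P (fun w => z * X t w) <= expR (- (N%:R * ln z)) ^+ 2.
  (* The squared modulus has to be below [z^(- 2 N)]; the constant [c] of [transform_upper] is
     divided out. *)
  apply: filterS (growth (2 * N%:R / c)) => z Hz.
  apply: le_trans (Hc z) _; rewrite -expRM_natl ler_expR mulrN lerN2 -ler_pdivrMl//.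
  by apply: le_trans Hz; rewrite [c^-1 * _]mulrC !mulrA mulrAC.
have mX : measurable_fun setT (X t) by [].
apply: density_of_rapid; apply: rapid_of_decay.
- exact: continuous_cosE.
- exact: norm_cosE.
- move=> N; apply: filterS (decay N) => z.
  rewrite sqmodM// => Hz; rewrite -ler_sqr ?nnegrE ?expR_ge0// real_normK ?num_real//.
  by apply: le_trans Hz; rewrite lerDl sqr_ge0.
- exact: continuous_sinE.
- exact: norm_sinE.
- move=> N; apply: filterS (decay N) => z.
  rewrite sqmodM// => Hz; rewrite -ler_sqr ?nnegrE ?expR_ge0// real_normK ?num_real//.
  by apply: le_trans Hz; rewrite lerDr sqr_ge0.
Qed.

Lemma growth_of_bounded_density :
  (forall t : R, 0 < t -> exists2 p, is_density P (X t) p & [bounded p x | x in setT]) ->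
  forall K : R, \forall z \near +oo, K * ln z <= levy_growth Pi z.
Proof.
(* Replacing [K] by a larger constant at least 1 forces [t <= 1] below. *)
move=> Hp K; pose K' := `|K| + 1.
have K'1 : 1 <= K' by rewrite lerDr.
have K'0 : 0 < K' by exact: lt_le_trans K'1.
have D0 : 0 < 8 * expR (2 * `|A|) * K' by rewrite !mulr_gt0// expR_gt0.
(* Makes [4 * t * expR (2 * |A|) * K'] equal to [1 / 2]; since [t <= 1], the exponent in
   [transform_lower] is then at most [ln z / 2] as long as [levy_growth Pi z <= K' * ln z]. *)
pose t := (8 * expR (2 * `|A|) * K')^-1.
have t0 : 0 < t by rewrite invr_gt0.
have e1 : 1 <= expR (2 * `|A|) by rewrite -expR0 ler_expR mulr_ge0.
have t1 : t <= 1.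
  rewrite invf_le1//; apply: (le_trans K'1); apply: ler_peMl; first exact: ltW.
  by rewrite (le_trans e1)// ler_peMl ?expR_ge0//; lra.
have tK : 4 * t * expR (2 * `|A| * t) * K' <= 2^-1.
  apply: (@le_trans _ _ (4 * t * expR (2 * `|A|) * K')).
    rewrite ler_pM2r// ler_pM2l ?mulr_gt0// ler_expR ler_piMr// mulr_ge0//.
  suff -> : 4 * t * expR (2 * `|A|) * K' = 2^-1 by [].
  by rewrite /t; field; rewrite !gt_eqF// expR_gt0.
have [p dp /pinfty_ex_gt0[M M0 pM]] := Hp t t0.
have pM' x : p x <= M by apply: le_trans (ler_norm _) (pM x I).
have HM := density_le_measure (ltW M0) dp pM'.
have pi0 := pi_gt0 R.
pose C := expR 1 * (M * pi).
have C0 : 0 < C by rewrite !mulr_gt0// expR_gt0.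
(* The contradiction will be [z <= C ^+ 2]; adding 1 also ensures [z > 1], hence [ln z > 0]. *)
exists (C ^+ 2 + 1); split; first exact: num_real.
move=> z zC; rewrite leNgt; apply/negP => Gz.
have z1 : 1 < z by rewrite (le_lt_trans _ zC)// lerDr sqr_ge0.
have z0 : 0 < z by exact: lt_trans z1.
have lz0 : 0 < ln z by rewrite ln_gt0.
have GK : levy_growth Pi z <= K' * ln z.
  rewrite (le_trans (ltW Gz))// ler_pM2r// (le_trans (ler_norm _))// lerDl.
  by [].
have low y : `[0, z]%classic y -> expR (- (2^-1 * ln z)) <= sqmod P (fun w => y * X t w).
  rewrite /= in_itv/= => /andP[y0 yz].
  apply: le_trans (transform_lower HPi t0 (fun z => @mE t z t0) y).
  rewrite ler_expR lerN2.
  apply: (@le_trans _ _ (4 * t * expR (2 * `|A| * t) * (K' * ln z))).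
    rewrite ler_pM2l ?mulr_gt0 ?expR_gt0//.
    exact: le_trans (levy_growth_homo HPi y0 yz) GK.
  by rewrite mulrA ler_pM2r.
have up := sqmod_integral_bounded (ltW M0) HM z0.
have {}low : expR (- (2^-1 * ln z)) * z <= C.
  apply: le_trans up.
  have <- : \int[leb]_(y in `[0, z]) expR (- (2^-1 * ln z)) = expR (- (2^-1 * ln z)) * z.
    have ic : leb.-integrable `[0, z] (EFin \o cst (expR (- (2^-1 * ln z)))).
      by apply: integrable_continuous_itv => x; exact: cvg_cst.
    rewrite -Rintegral_itv_bndo_bndc; last first.
      by apply: integrableS ic => //; exact: subset_itv_co_cc.
    by rewrite Rintegral_cst_co ?subr0// ltW.
  apply: le_Rintegral => //.
  - by apply: integrable_continuous_itv => x; exact: cvg_cst.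
  - exact/integrable_continuous_itv/continuous_sqmodM.
(* The lower bound times the length of [[0, z]] is the square root of [z]. *)
have zE : (expR (- (2^-1 * ln z)) * z) ^+ 2 = z.
  rewrite exprMn -expRM_natl mulrN mulVKf// expRN lnK//.
  by rewrite expr2 mulrA mulVf ?mul1r ?gt_eqF.
have : z <= C ^+ 2.
  rewrite -zE; apply: lerXn2r => //; rewrite nnegrE ltW//.
  by rewrite mulr_gt0// expR_gt0.
move: zC; set C2 := C ^+ 2 => h1 h2; lra.
Qed.

End equivalence.

Theorem theorem1 (R : realType) (d : measure_display) (T : measurableType d)
    (P : probability T R) (A a x0 : R) (Pi : {measure set R -> \bar R})
    (nu : R.-ker T ~> (R * R)%type) (Z X : R -> {RV P >-> R}) :
  A != 0 ->
  is_levy_measure Pi ->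
  is_poisson_random_measure P (jump_intensity Pi) nu ->
  is_levy_process P Z ->
  has_jump_representation P Pi nu a Z ->
  is_linear_sde_solution P A x0 Z X ->
  [<-> forall t : R, 0 < t -> exists2 p, is_density P (X t) p & Cb_infty p ;
       forall t : R, 0 < t ->
         exists2 p, is_density P (X t) p & [bounded p x | x in setT] ;
       ((eps ^+ 2 * ln (1 / eps))^-1%:E *
         \int[Pi]_u (Num.min (u ^+ 2) (eps ^+ 2))%:E)%E
         @[eps --> 0^'+] --> +oo%E].
Proof.
move=> A0 HPi Hnu HZ HJ HX.
have mE t z : 0 < t -> _ := @sqmod_solution _ _ _ _ _ _ _ _ _ HZ HX
  (fun t z => sqmod_levy HPi Hnu HJ z) t z.
tfae => [H t t0|H|H t t0].
- have [p dp cp] := H t t0; exists p => //.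
  by have [_] := cp 0%N.
- exact/(levy_growth_cond HPi)/(growth_of_bounded_density HPi mE).
- exact: (smooth_density A0 HPi mE t0 ((levy_growth_cond HPi).1 H)).
Qed.
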